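(* Assume that the following two conditions hold. (1) The limit $$\bar k(t,s)=\lim_{\varepsilon\to0}\frac{\mathrm{Cov}(X_{T_n+\varepsilon t}-X_{T_n},\,X_{T_n+\varepsilon s}-X_{T_n})}{\gamma_\varepsilon^2}$$ exists uniformly in $(t,s)\in[0,1]\times[0,1]$. (2) For every fixed $T>0$ the limit $$\bar\rho(t,T)=\lim_{\varepsilon\to0}\frac{k(T_n+\varepsilon t,T)-k(T_n,T)}{\gamma_\varepsilon}$$ exists uniformly in $t\in[0,1]$. Then the family $\{(X^n_{T_n+\varepsilon t})_{t\in[0,1]}\}_\varepsilon$ satisfies a large deviation principle on $C([0,1])$ as $\varepsilon\to0$, with inverse speed $\gamma_\varepsilon^2$ and good rate function $$J_n(h)=\begin{cases}\frac12\|h-x_n\|^2_{\bar{\mathscr H}_n}&\text{if }h_0=x_n\text{ and }h-x_n\in\bar{\mathscr H}_n,\\+\infty&\text{otherwise,}\end{cases}$$ where $\bar{\mathscr H}_n$ is the reproducing kernel Hilbert space associated to the covariance function $$\bar k_n(t,s)=\bar k(t,s)-\sum_{j=1}^n k_{j-1}(T_j,T_j)\,\bar\alpha_j(t)\,\bar\alpha_j(s).$$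
   Context: Let $X=(X_t)_{t\ge0}$ be a continuous centered Gaussian process with continuous covariance function $k(t,s)=\mathrm{Cov}(X_t,X_s)$. Fix $n\in\mathbb N$, $n\geq 1$, times $0<T_1<\dots<T_n$ and real numbers $x_1,\dots,x_n$. Set $X^0=X$, $k_0=k$ and, for $j=1,\dots,n$, $$\alpha_j(t)=\frac{k_{j-1}(t,T_j)}{k_{j-1}(T_j,T_j)},\qquad X^j_t=X^{j-1}_t-\alpha_j(t)(X^{j-1}_{T_j}-x_j),\qquad k_j(t,s)=k_{j-1}(t,s)-\alpha_j(t)k_{j-1}(s,T_j),$$ where it is assumed that $k_{j-1}(T_j,T_j)>0$. Then $k_j$ is the covariance function of $X^j$, and $X^j$ has the law of $X$ conditioned on $X_{T_1}=x_1,\dots,X_{T_j}=x_j$. Let $\gamma_\varepsilon>0$ with $\gamma_\varepsilon\to0$ as $\varepsilon\to0$. Put $\bar\rho_0=\bar\rho$ and recursively, for $j=1,\dots,n$, $\bar\alpha_j(t)=\bar\rho_{j-1}(t,T_j)/k_{j-1}(T_j,T_j)$ and $\bar\rho_j(t,T)=\bar\rho_{j-1}(t,T)-\alpha_j(T)\bar\rho_{j-1}(t,T_j)$. $C([0,1])$ is the space of continuous real paths on $[0,1]$ with the sup-norm; $x_n$ also denotes the constant path. A family $\{U^\varepsilon\}_\varepsilon$ of $C([0,1])$-valued random variables satisfies a large deviation principle with inverse speed $\gamma_\varepsilon^2$ and good rate function $I$ if $\gamma_\varepsilon\to0$, the set $\{I\le a\}$ is compact for every real $a$, $\liminf_{\varepsilon\to0}\gamma_\varepsilon^2\log\mathbb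 P(U^\varepsilon\in G)\ge-\inf_GI$ for every open $G$, and $\limsup_{\varepsilon\to0}\gamma_\varepsilon^2\log\mathbb P(U^\varepsilon\in F)\le-\inf_FI$ for every closed $F$. The reproducing kernel Hilbert space of a continuous, symmetric, positive (semi)definite kernel $q$ on $[0,1]^2$ is the completion, inside $C([0,1])$, of the paths $h_t=\int_0^1q(t,s)\lambda(ds)$, $\lambda$ a signed Borel measure on $[0,1]$, with $\|h\|^2=\int_0^1\int_0^1q(t,s)\lambda(dt)\lambda(ds)$. *)

(* Defs.v *)
From HB Require Import structures.
From mathcomp Require Import all_boot all_order all_algebra.
From mathcomp Require Import all_classical all_reals all_analysis.

Set Implicit Arguments.
Unset Strict Implicit.
Unset Printing Implicit Defensive.

Import Order.TTheory GRing.Theory Num.Theory.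
Import numFieldNormedType.Exports.

Local Open Scope classical_set_scope.
Local Open Scope ring_scope.

Definition I01 (R : realType) : Type := set_type [set` `[0, 1 : R]%R].

HB.instance Definition _ (R : realType) :=
  PseudoMetric.copy (I01 R) (set_type [set` `[0, 1 : R]%R]).

Lemma zero_in_I01 (R : realType) : (0 : R) \in [set` `[0, 1 : R]%R].
Proof. by rewrite inE /= in_itv /= lexx ler01. Qed.

Definition zero01 (R : realType) : I01 R := SigSub (@zero_in_I01 R).

HB.instance Definition _ (R : realType) := isPointed.Build (I01 R) (@zero01 R).

Definition time {R : realType} (t : I01 R) : R := \val t.

(* Continuous paths on [0,1], with the distance of uniform convergence. *)
Definition C01 (R : realType) : Type := continuousType (I01 R) R.

HB.instance Definition _ (R : realType) :=
  PseudoMetric.copy (C01 R)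
    (initial_topology
      (id : continuousType (I01 R) R -> arrow_uniform_type (I01 R) R)).

HB.instance Definition _ (R : realType) :=
  isPointed.Build (C01 R) (cst 0 : continuousType (I01 R) R).

Definition path_fun {R : realType} (h : C01 R) : I01 R -> R := fun t => h t.

Notation borel T := (g_sigma_algebraType (@open T)).

Section gaussian_process.
Context d (T : measurableType d) (R : realType) (P : probability T R).

(* [normal_prob m 0] is not a Dirac mass in the library, hence the case
   distinction. *)
Definition gaussian_law (m s : R) (A : set R) : \bar R :=
  if s == 0 then \d_m A else normal_prob m s A.

(* Processes are indexed by the real line, but only their values at
   nonnegative times matter. *)
Definition gaussian_process (X : R -> {RV P >-> R}) : Prop :=
  forall (m : nat) (t c : 'I_m -> R), (forall i, 0 <= t i) ->
  exists mu sigma : R, forall A : set R, measurable A ->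
    P ((fun w => \sum_(i < m) c i * X (t i) w) @^-1` A)
    = gaussian_law mu sigma A.

Definition centered_process (X : R -> {RV P >-> R}) : Prop :=
  forall t, 0 <= t -> ('E_P[X t] = 0)%E.

Definition continuous_process (X : R -> {RV P >-> R}) : Prop :=
  forall w, {within [set t | 0 <= t], continuous (fun t => X t w)}.

(* The covariance is an extended real in the library; it is finite for
   Gaussian variables. *)
Definition cov (Y Z : T -> R) : R := fine (covariance P Y Z).

Definition cov_fun (X : R -> {RV P >-> R}) (t s : R) : R := cov (X t) (X s).

Definition increment (X : R -> {RV P >-> R}) (a b : R) : T -> R :=
  fun w => X b w - X a w.

End gaussian_process.

(* The pinning times [tau] and values [x] are sequences whose entries of index
   1, ..., n are used. *)
Section conditioning.
Context (R : realType) (k : R -> R -> R) (tau : nat -> R).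

Definition regression (q : R -> R -> R) (u t : R) : R := q t u / q u u.

Fixpoint k_cond (j : nat) (t s : R) : R :=
  if j is i.+1 then
    k_cond i t s - regression (k_cond i) (tau i.+1) t * k_cond i s (tau i.+1)
  else k t s.

Definition var_cond (j : nat) : R := k_cond j.-1 (tau j) (tau j).

Definition alpha (j : nat) (t : R) : R := regression (k_cond j.-1) (tau j) t.

Fixpoint X_cond {T : Type} (X : R -> T -> R) (x : nat -> R) (j : nat)
    (t : R) (w : T) : R :=
  if j is i.+1 then
    X_cond X x i t w - alpha i.+1 t * (X_cond X x i (tau i.+1) w - x i.+1)
  else X t w.

Fixpoint rhobar_cond (rhobar : I01 R -> R -> R) (j : nat) (t : I01 R) (u : R)
    : R :=
  if j is i.+1 then
    rhobar_cond rhobar i t u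
    - alpha i.+1 u * rhobar_cond rhobar i t (tau i.+1)
  else rhobar t u.

Definition alphabar (rhobar : I01 R -> R -> R) (j : nat) (t : I01 R) : R :=
  rhobar_cond rhobar j.-1 t (tau j) / var_cond j.

Definition kbar_cond (kbar : I01 R -> I01 R -> R) (rhobar : I01 R -> R -> R)
    (n : nat) (t s : I01 R) : R :=
  kbar t s
  - \sum_(1 <= j < n.+1) var_cond j * alphabar rhobar j t * alphabar rhobar j s.

End conditioning.

(* Integral against a signed measure, through its Jordan decomposition. *)
Section charge_integral.
Context d (T : measurableType d) (R : realType).
Variable nu : {charge set T -> \bar R}.

Definition hahn_pos : set T := projT1 (cid (Hahn_decomposition nu)).

Definition hahn_neg : set T :=
  projT1 (cid (projT2 (cid (Hahn_decomposition nu)))).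

Definition hahn_posneg : hahn_decomposition nu hahn_pos hahn_neg :=
  projT2 (cid (projT2 (cid (Hahn_decomposition nu)))).

Definition charge_integral (f : T -> R) : R :=
  \int[jordan_pos hahn_posneg]_x f x - \int[jordan_neg hahn_posneg]_x f x.

End charge_integral.

Definition signed_measure (R : realType) : Type :=
  {charge set (borel (I01 R)) -> \bar R}.

(* The completion is realised inside C([0,1]): its elements are the uniform
   limits of paths [kernel_path q (lambda m)] that form a Cauchy sequence for
   the norm below, and the squared norm of the limit is the limit of the
   squared norms. *)
Section rkhs.
Context (R : realType) (q : I01 R -> I01 R -> R).

Definition kernel_path (lambda : signed_measure R) (t : I01 R) : R :=
  charge_integral lambda (q t).

Definition kernel_sqnorm (lambda : signed_measure R) : R :=
  charge_integral lambda (kernel_path lambda).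

Definition charge_sub (lambda mu : signed_measure R) : signed_measure R :=
  cadd lambda (cscale (-1) mu).

Definition rkhs_approx (lambda : nat -> signed_measure R) (h : I01 R -> R)
    : Prop :=
  (forall e : R, 0 < e -> exists N : nat, forall m l : nat,
    (N <= m)%N -> (N <= l)%N ->
    kernel_sqnorm (charge_sub (lambda m) (lambda l)) < e) /\
  {uniform, (fun m => kernel_path (lambda m)) @ \oo --> h}.

Definition rkhs (h : I01 R -> R) : Prop :=
  continuous h /\ exists lambda, rkhs_approx lambda h.

Definition rkhs_sqnorm (h : I01 R -> R) : R :=
  xget 0 [set r | exists2 lambda, rkhs_approx lambda h &
                    (fun m => kernel_sqnorm (lambda m)) @ \oo --> r].

End rkhs.

(* J(h) = ||h - y||^2 / 2 if h_0 = y and h - y is in the RKHS of q, and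
   +oo otherwise. *)
Definition gaussian_rate (R : realType) (q : I01 R -> I01 R -> R) (y : R)
    (h : C01 R) : \bar R :=
  let h' : I01 R -> R := fun t => path_fun h t - y in
  if `[< path_fun h (@zero01 R) = y /\ rkhs q h' >]
  then (2^-1 * rkhs_sqnorm q h')%:E else +oo%E.

(* Measurability is part of the definition: each [U e] is a random variable for
   the Borel sigma-algebra of C([0,1]). *)
Definition satisfies_LDP d (T : measurableType d) (R : realType)
    (P : probability T R) (U : R -> T -> C01 R) (gamma : R -> R)
    (I : C01 R -> \bar R) : Prop :=
  [/\ gamma e @[e --> 0^'+] --> 0,
      forall e, 0 < e -> measurable_fun setT (U e : T -> borel (C01 R)),
      forall a : R, compact [set h | (I h <= a%:E)%E],
      forall G : set (C01 R), open G ->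
        (- ereal_inf (I @` G)
         <= limf_einf (fun e : R => (gamma e ^+ 2)%:E * lne (P (U e @^-1` G)))
              0^'+)%E
    & forall F : set (C01 R), closed F ->
        (limf_esup (fun e : R => (gamma e ^+ 2)%:E * lne (P (U e @^-1` F))) 0^'+
         <= - ereal_inf (I @` F))%E].

(* Main.v *)
(** Finite linear combinations of the conditioned process are centered Gaussian
  plus a deterministic mean, and their covariances, rescaled by gamma^2, converge
  to the kernel kbar_n: conditioning on X_(T_j) subtracts from the covariance of
  the increments at T_n a product of two first order increments, whose limit is
  kbar's correction by alphabar_j. Three facts then give the principle.

  (i) The rate of h is the supremum over finite lists l of pairs (c, t) of
  sum c (h t - x_n) - (1/2) sum sum c c' kbar_n(t, t'): charges are approximated
  by lists, and maximizing lists are Cauchy for the norm of the RKHS.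

  (ii) Moduli of continuity are exponentially tight. A symmetrization of the
  Gaussian vector (D, D') on the product space gives
  P(max D > eta) P(max D <= s) <= 2 exp(-(eta - 2 s)^2 / (16 sigma^2)) whatever
  the number of coordinates; the second factor tends to 1 because the paths are
  continuous and pinned at T_n.

  (iii) Exponential Markov inequalities for half-spaces together with (ii) give
  compactness and the upper bound; a Cameron-Martin tilt gives the lower bound. *)
Require Import Defs.
From HB Require Import structures.
From mathcomp Require Import all_boot all_order all_algebra.
From mathcomp Require Import all_classical all_reals all_analysis.
From mathcomp Require Import measurable_realfun lebesgue_integral_under.
From mathcomp Require Import ring lra.

Set Implicit Arguments.
Unset Strict Implicit.
Unset Printing Implicit Defensive.

Import Order.TTheory GRing.Theory Num.Theory.
Import numFieldNormedType.Exports.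

Local Open Scope classical_set_scope.
Local Open Scope ring_scope.

(** * Centered Gaussian variables *)

(** The definition of a Gaussian process only provides one-dimensional laws of linear combinations,
    possibly degenerate and with unspecified parameters. A centered normal variable is therefore
    described by the Cameron-Martin identity, which keeps its meaning for variance 0.
    Differentiating it gives Stein's identity, then an ODE for the characteristic function; the
    joint laws that the symmetrization compares are recovered from trigonometric moments. The
    obstacle is exponential tightness: the limit kernel is merely continuous and the covariances
    converge without a rate, so chaining and moment criteria have nothing to act on. What remains is
    a variance of increments that is small uniformly over close times, and a bound free of the
    number of coordinates extends this to all rational times at once. Lists of weighted times are
    formal linear combinations: conditioning, increments and tilts all become substitutions into
    lists or concatenations, and the Gaussian law of a list is established once. *)

Section gaussian_law.
Context (R : realType).
Local Notation mu := (@lebesgue_measure R).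

(** The Radon-Nikodym derivative and the explicit density have the same integral over every
    measurable set, hence agree almost everywhere. *)
Lemma ge0_integral_normal_prob (m s : R) (f : R -> \bar R) :
  s != 0 -> measurable_fun [set: R] f -> (forall x, (0 <= f x)%E) ->
  (\int[normal_prob m s]_x f x = \int[mu]_x (f x * (normal_pdf m s x)%:E))%E.
Proof.
move=> s0 mf f0.
rewrite -(Radon_Nikodym_SigmaFinite.change_of_variables
  (normal_prob_dominates m s) f0)//.
apply: ae_eq_integral => //.
- apply: emeasurable_funM => //; apply: (measurable_int mu).
  apply: Radon_Nikodym_SigmaFinite.f_integrable.
  exact: normal_prob_dominates.
- apply: emeasurable_funM => //=; apply/measurableT_comp => //=.
  exact: measurable_normal_pdf.
apply: ae_eqe_mul2l => /=.
apply: integral_ae_eq => //=.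
- apply: Radon_Nikodym_SigmaFinite.f_integrable.
  exact: normal_prob_dominates.
- by apply/measurableT_comp => //; exact: measurable_normal_pdf.
- move=> E E01 mE; rewrite -Radon_Nikodym_SigmaFinite.f_integral//.
  exact: normal_prob_dominates.
Qed.

Lemma ge0_integral_shift (a : R) (g : R -> R) :
  continuous g -> (forall x, 0 <= g x) ->
  (\int[mu]_x (g (x + a)%R)%:E = \int[mu]_x (g x)%:E)%E.
Proof.
move=> cg g0.
have dF : (fun x : R => x + a)^`()%classic = cst 1.
  apply/funext => x; rewrite derive1E deriveD// derive_id derive_cst.
  by rewrite addr0.
rewrite [RHS](increasing_ge0_integration_by_substitutionT (F := fun x => x + a)) //.
- by apply: eq_integral => x _; rewrite dF /= mulr1.
- by move=> x y; rewrite ltrD2r.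
- by rewrite dF => x; exact: cvg_cst.
- by rewrite dF; exact: is_cvg_cst.
- by rewrite dF; exact: is_cvg_cst.
- exact: cvg_addrr_Ny.
- exact: cvg_addrr.
Qed.

(** Completing the square: tilting by [h] translates the mean by [h * s ^+ 2]. *)
Lemma normal_pdf_tilt (m s h x : R) : s != 0 ->
  expR (h * x) * normal_pdf m s x
  = expR (h * m + h ^+ 2 * s ^+ 2 / 2) * normal_pdf m s (x - h * s ^+ 2).
Proof.
move=> s0; rewrite !normal_pdfE// /normal_fun mulrCA [RHS]mulrCA; congr *%R.
by rewrite -!expRD; congr expR; field.
Qed.

(** The Dirac case and the density case obey one formula: when [s = 0] the shift vanishes and only
    the factor [expR (h * m)] remains. *)
Lemma gaussian_law_tilt (nu : {measure set (measurableTypeR R) -> \bar R}) (m s h : R)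
    (g : R -> R) :
  (forall A : set R, measurable A -> nu A = gaussian_law m s A) ->
  continuous g -> (forall x, 0 <= g x) ->
  (\int[nu]_x (g x * expR (h * x))%:E
   = (expR (h * m + h ^+ 2 * s ^+ 2 / 2))%:E
     * \int[nu]_x (g (x + h * s ^+ 2)%R)%:E)%E.
Proof.
move=> nuE cg g0.
have mg : measurable_fun [set: R] g by exact: continuous_measurable_fun.
have mgs a : measurable_fun [set: R] (fun x => g (x + a)).
  by apply: measurableT_comp => //; exact: measurable_funD.
have [s0|s0] := eqVneq s 0.
  have nuD (f : R -> \bar R) : measurable_fun [set: R] f -> (\int[nu]_x f x = f m)%E.
    move=> mf; rewrite (eq_measure_integral (@dirac _ (measurableTypeR R) m R)); last first.
      by move=> A mA _; rewrite nuE// /gaussian_law s0 eqxx.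
    by rewrite integral_dirac// diracT mul1e.
  rewrite !nuD; last 2 first.
  - exact/measurable_EFinP.
  - apply/measurable_EFinP/measurable_funM => //.
    by apply: measurableT_comp => //; exact: measurable_funM.
  by rewrite s0 expr0n/= !mulr0 mul0r !addr0 -EFinM mulrC.
have nuN (f : R -> \bar R) : measurable_fun [set: R] f -> (forall x, (0 <= f x)%E) ->
    (\int[nu]_x f x = \int[mu]_x (f x * (normal_pdf m s x)%:E))%E.
  move=> mf f0; rewrite -ge0_integral_normal_prob//.
  rewrite [LHS](eq_measure_integral (normal_prob m s))// => A mA _.
  by rewrite nuE// /gaussian_law (negbTE s0).
rewrite !nuN; last 4 first.
- exact/measurable_EFinP.
- by move=> x; rewrite lee_fin.
- apply/measurable_EFinP/measurable_funM => //.
  by apply: measurableT_comp => //; exact: measurable_funM.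
- by move=> x; rewrite lee_fin mulr_ge0// expR_ge0.
rewrite -ge0_integralZl//=; last 2 first.
- apply: emeasurable_funM; apply/measurable_EFinP; first exact: mgs.
  exact: measurable_normal_pdf.
- by move=> x _; rewrite mule_ge0// lee_fin// normal_pdf_ge0.
rewrite -[LHS](@ge0_integral_shift (h * s ^+ 2)
  (fun x => g x * expR (h * x) * normal_pdf m s x)); last 2 first.
- move=> x; apply: cvgM; last exact: continuous_normal_pdf.
  apply: cvgM; first exact: cg.
  apply: (@continuous_comp _ _ _ ( *%R h) expR); last exact: continuous_expR.
  exact: mulrl_continuous.
- by move=> x; rewrite !mulr_ge0 ?expR_ge0 ?normal_pdf_ge0.
apply: eq_integral => x _; rewrite -!EFinM; congr EFin.
by rewrite -mulrA normal_pdf_tilt// addrK; ring.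
Qed.

End gaussian_law.

Section centered_normal.
Context d (T : measurableType d) (R : realType) (P : probability T R).

(* [Y] has law N(0, v), expressed through the one-dimensional Cameron-Martin
   formula; unlike a density, this makes sense for [v = 0] as well. *)
Definition centered_normal (Y : T -> R) (v : R) : Prop :=
  [/\ measurable_fun setT Y, 0 <= v &
    forall (h : R) (g : R -> R), continuous g -> (forall x, 0 <= g x) ->
    (\int[P]_w (g (Y w) * expR (h * Y w))%:E
     = (expR (h ^+ 2 * v / 2))%:E * \int[P]_w (g (Y w + h * v)%R)%:E)%E].

Lemma bounded_integrable (f : T -> R) (M : R) :
  measurable_fun setT f -> (forall w, `|f w| <= M) ->
  P.-integrable setT (EFin \o f).
Proof.
move=> mf fM; apply: measurable_bounded_integrable => //.
  by rewrite (le_lt_trans (probability_le1 _ _))// ltry.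
exists M; split; first exact: num_real.
by move=> x Mx w _; exact: le_trans (fM w) (ltW Mx).
Qed.

Lemma Rintegral_cst_prob (r : R) : \int[P]_w r = r.
Proof. by rewrite Rintegral_cst//= [X in fine X]probability_setT /= mulr1. Qed.

Lemma dominated_integrable (f g : T -> R) :
  measurable_fun setT f -> P.-integrable setT (EFin \o g) ->
  (forall w, `|f w| <= g w) -> P.-integrable setT (EFin \o f).
Proof.
move=> mf ig fg; apply: le_integrable ig => //; first exact/measurable_EFinP.
by move=> w _ /=; rewrite lee_fin (le_trans (fg w))// ler_norm.
Qed.

(** The tilt formula is explicit, so only the mean [m] has to be removed. Integrating
    [1 + h * Y <= expR (h * Y)] against the zero mean of [Y] gives
    [0 <= h * m + h ^+ 2 * s ^+ 2 / 2] for every [h], which forces [m = 0]. *)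
Lemma centered_normal_of_law (Y : T -> R) (m s : R) :
  measurable_fun setT Y -> (\int[P]_w (Y w)%:E = 0)%E ->
  (forall A : set R, measurable A -> P (Y @^-1` A) = gaussian_law m s A) ->
  centered_normal Y (s ^+ 2).
Proof.
move=> mY Y0 law.
have mY' : measurable_fun setT (Y : T -> measurableTypeR R) by exact: mY.
pose mix := isMeasurableFun.Build _ _ _ _ _ mY'.
pose Yf : {mfun T >-> measurableTypeR R} := HB.pack (Y : T -> measurableTypeR R) mix.
pose nu : {measure set (measurableTypeR R) -> \bar R} := distribution P Yf.
have push (f : R -> R) : continuous f -> (forall x, 0 <= f x) ->
    (\int[nu]_x (f x)%:E = \int[P]_w (f (Y w))%:E)%E.
  move=> cf f0.
  rewrite ge0_integral_distribution//.
  by apply/measurable_EFinP; exact: continuous_measurable_fun.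
have tilt (h : R) (g : R -> R) : continuous g -> (forall x, 0 <= g x) ->
    (\int[P]_w (g (Y w) * expR (h * Y w))%:E
     = (expR (h * m + h ^+ 2 * s ^+ 2 / 2))%:E
       * \int[P]_w (g (Y w + h * s ^+ 2)%R)%:E)%E.
  move=> cg g0.
  rewrite -(push (fun x => g x * expR (h * x)))//; last 2 first.
  - move=> x; apply: cvgM; first exact: cg.
    apply: (@continuous_comp _ _ _ ( *%R h) expR); last exact: continuous_expR.
    exact: mulrl_continuous.
  - by move=> x; rewrite mulr_ge0// expR_ge0.
  rewrite -(push (fun x => g (x + h * s ^+ 2)))//; last first.
    move=> x; apply: (@continuous_comp _ _ _ (fun x => x + h * s ^+ 2) g).
      by apply: cvgD; [exact: cvg_id|exact: cvg_cst].
    exact: cg.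
  exact: (@gaussian_law_tilt _ nu _ _ _ _ law).
have lap h : (\int[P]_w (expR (h * Y w))%:E
    = (expR (h * m + h ^+ 2 * s ^+ 2 / 2))%:E)%E.
  have := tilt h (cst 1) (fun=> cvg_cst _) (fun=> ler01).
  rewrite /= integral_cst//= probability_setT mule1 mule1 => <-.
  by apply: eq_integral => w _; rewrite mul1r.
have iexp h : P.-integrable setT (fun w => (expR (h * Y w))%:E).
  apply/integrableP; split.
    apply/measurable_EFinP/measurableT_comp => //.
    exact: measurable_funM.
  under eq_integral do rewrite /= ger0_norm ?expR_ge0//.
  by rewrite lap ltry.
have iY : P.-integrable setT (EFin \o Y).
  apply: (@dominated_integrable _ (fun w => expR (1 * Y w) + expR (-1 * Y w)))=> //.
    by rewrite /comp; under eq_fun do rewrite EFinD; exact: integrableD.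
  move=> w; rewrite mul1r mulN1r.
  have [Yw|Yw] := leP 0 (Y w).
    rewrite ger0_norm//; have := expR_ge1Dx (Y w); have := expR_ge0 (- Y w).
    by lra.
  rewrite ltr0_norm//; have := expR_ge1Dx (- Y w); have := expR_ge0 (Y w).
  by lra.
have m0 h : 0 <= h * m + h ^+ 2 * s ^+ 2 / 2.
  rewrite -(ler_expR 0) expR0 -lee_fin -lap.
  have -> : (1%:E = \int[P]_w (1 + h * Y w)%:E)%E.
    rewrite (eq_integral (fun w => 1 + h%:E * (Y w)%:E)%E)//.
    rewrite integralD//=; last 2 first.
    - exact: finite_measure_integrable_cst.
    - exact: integrableZl.
    rewrite integral_cst//= probability_setT mule1 integralZl//.
    by rewrite Y0 mule0 adde0.
  apply: le_integral => //.
    rewrite /=; under eq_fun do rewrite EFinD EFinM.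
    apply: integrableD => //.
    - exact: finite_measure_integrable_cst.
    - exact: integrableZl.
  by move=> w _; rewrite lee_fin expR_ge1Dx.
have mE : m = 0.
  apply/eqP; apply: contraT => mn0.
  have v0 : 0 < 1 + s ^+ 2 by rewrite ltr_pwDl// sqr_ge0.
  (* A value opposite in sign to [m] and small enough for the linear term to win; the 1 keeps the
     denominator positive when [s = 0]. *)
  have := m0 (- m / (1 + s ^+ 2)).
  have -> : - m / (1 + s ^+ 2) * m + (- m / (1 + s ^+ 2)) ^+ 2 * s ^+ 2 / 2
     = - (m ^+ 2 * (2 + s ^+ 2) / (2 * (1 + s ^+ 2) ^+ 2)).
    by field; rewrite gt_eqF.
  have m2 : 0 < m ^+ 2 by rewrite exprn_even_gt0.
  have v2 : 0 < 2 + s ^+ 2 by rewrite ltr_pwDl// sqr_ge0.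
  by rewrite oppr_ge0 leNgt divr_gt0// mulr_gt0// exprn_gt0.
split => //; first exact: sqr_ge0.
by move=> h g cg g0; rewrite tilt// mE mulr0 add0r.
Qed.

End centered_normal.

Section derive_expectation.
Context d (T : measurableType d) (R : realType) (P : probability T R).

Lemma is_derive_Rintegral (f f' : R -> T -> R) (G : T -> R) (a : R) :
  (forall x, `|x - a| < 1 -> P.-integrable setT (EFin \o f x)) ->
  (forall (x : R) w, is_derive x (1 : R) (f ^~ w) (f' x w)) ->
  P.-integrable setT (EFin \o G) ->
  (forall x w, `|x - a| < 1 -> `|f' x w| <= G w) ->
  is_derive a (1 : R) (fun x => \int[P]_w f x w) (\int[P]_w f' a w).
Proof.
move=> fi fd Gi fG.
have dfE x w : partial1of2 f x w = f' x w.
  by rewrite /partial1of2 derive1E derive_val.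
have itv x : `]a - 1, a + 1[%classic x -> `|x - a| < 1.
  by rewrite /= in_itv/= ltr_norml => /andP[? ?]; apply/andP; split; lra.
have aI : `]a - 1, a + 1[%classic a.
  by rewrite /= in_itv/=; apply/andP; split; lra.
have d1 x w : `]a - 1, a + 1[%classic x -> setT w -> derivable (f ^~ w) x 1.
  by move=> _ _; exact: ex_derive.
have fi' x : `]a - 1, a + 1[%classic x -> P.-integrable setT (EFin \o f x).
  by move/itv; exact: fi.
have G0 w : 0 <= G w.
  by apply: le_trans (fG a w _); rewrite ?normr_ge0// subrr normr0.
have fG' x w : `]a - 1, a + 1[%classic x -> setT w ->
    `|partial1of2 f x w| <= G w.
  by move=> /itv ? _; rewrite dfE; exact: fG.
split; first exact: (derivable_under_integral measurableT aI fi' d1 G0 Gi fG').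
rewrite -derive1E.
rewrite (differentiation_under_integral measurableT aI fi' d1 G0 Gi fG').
by apply: eq_Rintegral => w _; exact: dfE.
Qed.

End derive_expectation.

(** * Moments and characteristic function from the Cameron-Martin identity *)

Section centered_normal_theory.
Context d (T : measurableType d) (R : realType) (P : probability T R).
Variables (Y : T -> R) (v : R).
Hypothesis nY : centered_normal P Y v.

Let mY : measurable_fun setT Y. Proof. by case: nY. Qed.
Let v0 : 0 <= v. Proof. by case: nY. Qed.

Local Notation "''E' f" := (\int[P]_w f w) (at level 10, f at level 8).

Lemma centered_normal_expE (h : R) :
  (\int[P]_w (expR (h * Y w))%:E = (expR (h ^+ 2 * v / 2))%:E)%E.
Proof.
have [_ _ /(_ h (cst 1) (fun=> cvg_cst _) (fun=> ler01))] := nY.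
rewrite /= integral_cst//= probability_setT mule1 mule1 => <-.
by apply: eq_integral => w _; rewrite mul1r.
Qed.

Lemma integrable_centered_normal_exp (h : R) :
  P.-integrable setT (EFin \o (fun w => expR (h * Y w))).
Proof.
apply/integrableP; split.
  by apply/measurable_EFinP/measurableT_comp => //; exact: measurable_funM.
under eq_integral do rewrite /= ger0_norm ?expR_ge0//.
by rewrite centered_normal_expE ltry.
Qed.

Lemma Rintegral_centered_normal_exp (h : R) :
  \int[P]_w expR (h * Y w) = expR (h ^+ 2 * v / 2).
Proof. by rewrite /Rintegral centered_normal_expE. Qed.

(** One integrable function that dominates [Y], its square and every derivative taken under the
    expectation below, through [normr_exp]. *)
Let G w := expR (2 * Y w) + expR (-2 * Y w).

Let integrable_G : P.-integrable setT (EFin \o G).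
Proof.
rewrite /comp /G; under eq_fun do rewrite EFinD.
by apply: integrableD => //; exact: integrable_centered_normal_exp.
Qed.

Let normr_exp (y : R) : `|y| * expR `|y| <= expR (2 * y) + expR (-2 * y).
Proof.
wlog y0 : y / 0 <= y.
  move=> H; have [/H//|y0] := leP 0 y.
  have := H (- y); rewrite normrN oppr_ge0 => /(_ (ltW y0)).
  by rewrite !(mulrN, mulNr, opprK) addrC.
rewrite ger0_norm// (le_trans (y := expR (2 * y)))//.
  rewrite (_ : 2 * y = y + y); last by ring.
  rewrite expRD ler_pM2r ?expR_gt0//.
  by apply: le_trans (expR_ge1Dx y); rewrite ler_wpDl.
by rewrite lerDl expR_ge0.
Qed.

Let normr_G w : `|Y w| <= G w.
Proof.
apply: le_trans (normr_exp (Y w)); rewrite ler_peMr//.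
by rewrite -expR0 ler_expR.
Qed.

Let sqr_G w : Y w ^+ 2 <= G w.
Proof.
apply: le_trans (normr_exp (Y w)).
rewrite -real_normK ?num_real// expr2 ler_wpM2l//.
by apply: le_trans (expR_ge1Dx _); rewrite ler_wpDl.
Qed.

Lemma integrable_centered_normal : P.-integrable setT (EFin \o Y).
Proof. exact: dominated_integrable integrable_G normr_G. Qed.

Lemma integrable_centered_normal_sqr :
  P.-integrable setT (EFin \o (fun w => Y w ^+ 2)).
Proof.
apply: dominated_integrable integrable_G _; first exact: measurable_funX.
by move=> w; rewrite ger0_norm ?sqr_ge0.
Qed.

(** [centered_normal] speaks of nonnegative functions: it is applied to [phi + M], and the
    contribution of the constant [M], known from the Laplace transform, is subtracted. *)
Lemma tilt_bounded (h : R) (phi : R -> R) (M : R) :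
  continuous phi -> (forall x, `|phi x| <= M) ->
  \int[P]_w (phi (Y w) * expR (h * Y w))
  = expR (h ^+ 2 * v / 2) * \int[P]_w phi (Y w + h * v).
Proof.
move=> cphi phiM.
have mphi : measurable_fun [set: R] phi by exact: continuous_measurable_fun.
have iE := integrable_centered_normal_exp h.
have mE := measurable_int _ iE.
have iphiE : P.-integrable setT (EFin \o (fun w => phi (Y w) * expR (h * Y w))).
  apply: (@dominated_integrable _ _ _ _ _ (fun w => M * expR (h * Y w))).
  - apply: measurable_funM; first exact: measurableT_comp.
    exact/measurable_EFinP.
  - exact: (integrableZl measurableT M iE).
  - by move=> w; rewrite normrM [`|expR _|]ger0_norm ?expR_ge0// ler_wpM2r// expR_ge0.
have iphi : P.-integrable setT (EFin \o (fun w => phi (Y w + h * v))).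
  apply: (@bounded_integrable _ _ _ _ _ M) => //.
  by apply: measurableT_comp => //; exact: measurable_funD.
have [_ _ /(_ h (fun x => phi x + M))] := nY.
have cphiM : continuous (fun x => phi x + M).
  by move=> x; apply: cvgD; [exact: cphi|exact: cvg_cst].
have phiM0 x : 0 <= phi x + M.
  by have := phiM x; rewrite ler_norml => /andP[? _]; lra.
move=> /(_ cphiM phiM0) /(congr1 fine).
rewrite fineM//; last first.
  apply: integrable_fin_num => //.
  rewrite /=; under eq_fun do rewrite EFinD.
  by apply: integrableD => //; exact: finite_measure_integrable_cst.
rewrite /= -!/(Rintegral _ _ _).
under eq_Rintegral do rewrite mulrDl.
have iM : P.-integrable setT (EFin \o (fun=> M)).
  exact: finite_measure_integrable_cst.
rewrite (RintegralD measurableT iphiE (integrableZl measurableT M iE)).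
rewrite (RintegralD measurableT iphi iM).
rewrite RintegralZl// Rintegral_centered_normal_exp.
rewrite Rintegral_cst_prob mulrDr [M * _]mulrC.
by move/addIr.
Qed.

Let continuous_cosM (u : R) : continuous (fun x => cos (u * x)).
Proof.
move=> x; apply: (@continuous_comp _ _ _ ( *%R u) cos).
  exact: mulrl_continuous.
exact: continuous_cos.
Qed.

Let continuous_sinM (u : R) : continuous (fun x => sin (u * x)).
Proof.
move=> x; apply: (@continuous_comp _ _ _ ( *%R u) sin).
  exact: mulrl_continuous.
exact: continuous_sin.
Qed.

Let measurable_cosY u : measurable_fun setT (fun w => cos (u * Y w)).
Proof.
apply: (measurableT_comp (f := fun x => cos (u * x))) => //.
exact: continuous_measurable_fun.
Qed.

Let measurable_sinY u : measurable_fun setT (fun w => sin (u * Y w)).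
Proof.
apply: (measurableT_comp (f := fun x => sin (u * x))) => //.
exact: continuous_measurable_fun.
Qed.

Let integrable_cosY u : P.-integrable setT (EFin \o (fun w => cos (u * Y w))).
Proof.
by apply: (@bounded_integrable _ _ _ _ _ 1) => // w; exact: cos_max.
Qed.

Let integrable_sinY u : P.-integrable setT (EFin \o (fun w => sin (u * Y w))).
Proof.
by apply: (@bounded_integrable _ _ _ _ _ 1) => // w; exact: sin_max.
Qed.

(** [fc] and [fs] are the real and imaginary parts of the characteristic function, kept apart to
    stay within real analysis. *)
Let fc (u : R) := \int[P]_w cos (u * Y w).
Let fs (u : R) := \int[P]_w sin (u * Y w).

Let G_mul (x y : R) : `|x| <= 1 -> `|y * x| <= `|y|.
Proof. by move=> x1; rewrite normrM ler_piMr. Qed.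

Let is_derive_fc (u : R) : is_derive u (1 : R) fc
    (- (\int[P]_w (Y w * sin (u * Y w)))).
Proof.
have -> : - (\int[P]_w (Y w * sin (u * Y w)))
    = \int[P]_w (- sin (u * Y w) * Y w).
  rewrite -mulN1r -RintegralZl//.
    by apply: eq_Rintegral => w _; ring.
  apply: dominated_integrable integrable_G _; first exact: measurable_funM.
  move=> w; apply: le_trans (normr_G w); apply: G_mul => //; exact: sin_max.
apply: (is_derive_Rintegral (f' := fun x w => - sin (x * Y w) * Y w) _ _
  integrable_G) => //.
- move=> x w; rewrite (_ : (fun _ => _) = cos \o (fun x => x * Y w))//.
  apply: is_derive_eq; rewrite /GRing.scale/=; ring.
- move=> x w _; apply: le_trans (normr_G w); rewrite mulrC mulrN normrN.
  apply: G_mul => //; exact: sin_max.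
Qed.

Let is_derive_fs (u : R) : is_derive u (1 : R) fs (\int[P]_w (Y w * cos (u * Y w))).
Proof.
apply: (is_derive_Rintegral (f' := fun x w => Y w * cos (x * Y w)) _ _
  integrable_G) => //.
- move=> x w; rewrite (_ : (fun _ => _) = sin \o (fun x => x * Y w))//.
  apply: is_derive_eq; rewrite /GRing.scale/=; ring.
- move=> x w _; apply: le_trans (normr_G w).
  apply: G_mul => //; exact: cos_max.
Qed.

(** To be compared with the derivative at 0 of the right-hand side of [tilt_bounded]: the equality
    of the two is Stein's identity. *)
Let is_derive_tilt (phi : R -> R) (M : R) : M <= 1 ->
  continuous phi -> (forall x, `|phi x| <= M) ->
  is_derive (0 : R) (1 : R) (fun h => \int[P]_w (phi (Y w) * expR (h * Y w)))
    (\int[P]_w (Y w * phi (Y w))).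
Proof.
move=> M1 cphi phiM.
have mphi : measurable_fun [set: R] phi by exact: continuous_measurable_fun.
have mphiY : measurable_fun setT (fun w => phi (Y w)) by exact: measurableT_comp.
have -> : \int[P]_w (Y w * phi (Y w))
    = \int[P]_w (phi (Y w) * (Y w * expR (0 * Y w))).
  by apply: eq_Rintegral => w _; rewrite mul0r expR0 mulr1 mulrC.
apply: (is_derive_Rintegral
  (f' := fun x w => phi (Y w) * (Y w * expR (x * Y w))) _ _ integrable_G) => //.
- move=> x _; apply: dominated_integrable (integrable_centered_normal_exp x) _.
    apply: measurable_funM => //; apply: measurableT_comp => //.
    exact: measurable_funM.
  move=> w; rewrite mulrC; apply: (le_trans (G_mul _ _)).
    exact: le_trans (phiM _) M1.
  by rewrite ger0_norm// expR_ge0.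
- move=> x w.
  rewrite (_ : (fun _ => _) = (phi (Y w)) \*: (expR \o (fun x => x * Y w)))//.
  by apply: is_derive_eq; rewrite /GRing.scale/=; ring.
- move=> x w; rewrite subr0 => x1; apply: le_trans (normr_exp (Y w)).
  rewrite mulrC; apply: (le_trans (G_mul _ _)).
    exact: le_trans (phiM _) M1.
  rewrite normrM ler_wpM2l// ger0_norm ?expR_ge0// ler_expR.
  by rewrite (le_trans (ler_norm _))// normrM ler_piMl// ltW.
Qed.

Let cosYD u h : \int[P]_w cos (u * (Y w + h))
  = fc u * cos (u * h) - fs u * sin (u * h).
Proof.
under eq_Rintegral do rewrite mulrDr cosD.
rewrite RintegralB//; last 2 first.
- exact: (integrableZr measurableT (cos (u * h)) (integrable_cosY u)).
- exact: (integrableZr measurableT (sin (u * h)) (integrable_sinY u)).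
by rewrite !RintegralZr.
Qed.

Let sinYD u h : \int[P]_w sin (u * (Y w + h))
  = fs u * cos (u * h) + fc u * sin (u * h).
Proof.
under eq_Rintegral do rewrite mulrDr sinD.
rewrite RintegralD//; last 2 first.
- exact: (integrableZr measurableT (cos (u * h)) (integrable_sinY u)).
- exact: (integrableZr measurableT (sin (u * h)) (integrable_cosY u)).
by rewrite !RintegralZr.
Qed.

(** Both sides of [tilt_bounded] are differentiated at [h = 0], the addition formula exposing the
    dependence on the shift [h * v]. Together with [is_derive_fc] this closes into a linear ODE for
    [fc]. *)
Let stein_sin u : \int[P]_w (Y w * sin (u * Y w)) = u * v * fc u.
Proof.
have [_ <-] := is_derive_tilt (lexx 1) (@continuous_sinM u) (fun x => sin_max (u * x)).
under eq_fun do
  rewrite (tilt_bounded _ (@continuous_sinM u) (fun x => sin_max (u * x))) sinYD.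
have D : is_derive (0 : R) (1 : R) ((expR \o (fun h : R => h ^+ 2 * v / 2)) *
   (fs u \*: (cos \o (fun h => u * (h * v))) + fc u \*: (sin \o (fun h => u * (h * v)))))
   (u * v * fc u).
  apply: is_derive_eq.
  rewrite /GRing.scale/= !fctE/= /GRing.scale/= !(mul0r, mulr0, expr0n, expR0, sin0, cos0)/=.
  by ring.
by have [_ D2] := D; exact: D2.
Qed.

Let stein_cos u : \int[P]_w (Y w * cos (u * Y w)) = - (u * v * fs u).
Proof.
have [_ <-] := is_derive_tilt (lexx 1) (@continuous_cosM u) (fun x => cos_max (u * x)).
under eq_fun do
  rewrite (tilt_bounded _ (@continuous_cosM u) (fun x => cos_max (u * x))) cosYD.
have D : is_derive (0 : R) (1 : R) ((expR \o (fun h : R => h ^+ 2 * v / 2)) *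
   (fc u \*: (cos \o (fun h => u * (h * v))) - fs u \*: (sin \o (fun h => u * (h * v)))))
   (- (u * v * fs u)).
  apply: is_derive_eq.
  rewrite /GRing.scale/= !fctE/= /GRing.scale/= !(mul0r, mulr0, expr0n, expR0, sin0, cos0)/=.
  by ring.
by have [_ D2] := D; exact: D2.
Qed.

(** The product of [f] with the integrating factor [expR (h ^+ 2 * v / 2)] has zero derivative. *)
Let ode (f : R -> R) : (forall u, is_derive u (1 : R) f (- (u * v * f u))) ->
  forall u, f u = f 0 * expR (- (u ^+ 2 * v / 2)).
Proof.
move=> df u.
pose g : R -> R := f * (expR \o (fun h : R => h ^+ 2 * v / 2)).
have gc : g u = g 0.
  apply: is_derive_0_is_cst => x.
  apply: is_derive_eq; rewrite /GRing.scale/= /GRing.scale/=.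
  by field.
move: gc; rewrite /g !fctE/= expr0n/= !mul0r expR0 mulr1 => <-.
by rewrite -[RHS]mulrA -expRD subrr expR0 mulr1.
Qed.

Lemma expectation_cos u : \int[P]_w cos (u * Y w) = expR (- (u ^+ 2 * v / 2)).
Proof.
have D x : is_derive x (1 : R) fc (- (x * v * fc x)).
  by rewrite -stein_sin; exact: is_derive_fc.
rewrite -/(fc u) (ode D) /fc; under eq_Rintegral do rewrite mul0r cos0.
by rewrite Rintegral_cst_prob mul1r.
Qed.

Lemma expectation_sin u : \int[P]_w sin (u * Y w) = 0.
Proof.
have D x : is_derive x (1 : R) fs (- (x * v * fs x)).
  by rewrite -stein_cos; exact: is_derive_fs.
rewrite -/(fs u) (ode D) /fs; under eq_Rintegral do rewrite mul0r sin0.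
by rewrite Rintegral_cst_prob mul0r.
Qed.

Lemma Rintegral_centered_normal : \int[P]_w Y w = 0.
Proof.
rewrite (@eq_Rintegral _ _ _ P _ (fun w => Y w * cos (0 * Y w))).
  by rewrite stein_cos !mul0r oppr0.
by move=> w _; rewrite mul0r cos0 mulr1.
Qed.

(** The expectation of [Y * sin (u * Y)] equals [u * v * expR (- (u ^+ 2 * v / 2))] by Stein's
    identity; the variance appears when both forms are differentiated at [u = 0]. *)
Lemma Rintegral_centered_normal_sqr : \int[P]_w Y w ^+ 2 = v.
Proof.
have D1 : is_derive (0 : R) (1 : R) (fun u => \int[P]_w (Y w * sin (u * Y w)))
    (\int[P]_w (Y w * (cos (0 * Y w) * Y w))).
  apply: (is_derive_Rintegral (f' := fun x w => Y w * (cos (x * Y w) * Y w)) _ _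
    integrable_G) => //.
  - move=> x _; apply: dominated_integrable integrable_G _.
      exact: measurable_funM.
    by move=> w; apply: le_trans (normr_G w); apply: G_mul; exact: sin_max.
  - move=> x w; rewrite (_ : (fun _ => _) = Y w \*: (sin \o (fun x => x * Y w)))//.
    by apply: is_derive_eq; rewrite /GRing.scale/=; ring.
  - move=> x w _; apply: le_trans (sqr_G w).
    rewrite mulrCA mulrC; apply: (le_trans (G_mul _ _)); first exact: cos_max.
    by rewrite -expr2 ger0_norm ?sqr_ge0.
rewrite (@eq_Rintegral _ _ _ P _ (fun w => Y w * (cos (0 * Y w) * Y w))); last first.
  by move=> w _; rewrite mul0r cos0 mul1r.
have [_ <-] := D1.
under eq_fun do rewrite stein_sin /fc expectation_cos.
have D : is_derive (0 : R) (1 : R) ((fun u : R => u * v) *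
   (expR \o (fun u : R => - (u ^+ 2 * v / 2)))) v.
  apply: is_derive_eq.
  rewrite /GRing.scale/= /GRing.scale/= !(mul0r, mulr0, expr0n, expR0, oppr0)/=.
  by ring.
by have [_ D2] := D; exact: D2.
Qed.

Lemma centered_normal_markov (h x : R) : 0 <= h ->
  (P [set w | (x <= Y w)%R] <= (expR (h ^+ 2 * v / 2 - h * x))%:E)%E.
Proof.
move=> h0.
have mA : measurable [set w | (x <= Y w)%R].
  rewrite (_ : [set _ | _] = Y @^-1` `[x, +oo[%classic); last first.
    by apply/seteqP; split => w /=; rewrite in_itv/= andbT.
  by rewrite -[X in measurable X]setTI; exact: mY.
have : (P [set w | (x <= Y w)%R] * (expR (h * x))%:E <= \int[P]_w (expR (h * Y w))%:E)%E.
  rewrite muleC -integral_cst//.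
  apply: (@le_trans _ _ (\int[P]_(w in [set w | (x <= Y w)%R]) (expR (h * Y w))%:E)%E).
    apply: ge0_le_integral => //=.
    - apply/measurable_EFinP/measurableT_comp => //.
      apply: measurable_funM => //.
      exact: measurable_funS mY.
    - by move=> w /= xY; rewrite lee_fin ler_expR ler_wpM2l.
  apply: ge0_subset_integral => //.
  by apply/measurable_EFinP/measurableT_comp => //; exact: measurable_funM.
rewrite centered_normal_expE -lee_pdivlMr ?expR_gt0// => /le_trans; apply.
by rewrite -EFinM lee_fin -expRN -expRD.
Qed.

Lemma centered_normal_tail (x s2 : R) : v <= s2 -> 0 < s2 -> 0 <= x ->
  (P [set w | (x <= Y w)%R] <= (expR (- (x ^+ 2 / (2 * s2))))%:E)%E.
Proof.
(* [x / s2] is the exponent that optimizes the Markov bound for variance [s2]. *)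
move=> vs s20 x0; have h0 : 0 <= x / s2 by rewrite divr_ge0// ltW.
rewrite (le_trans (centered_normal_markov x h0))// lee_fin ler_expR.
have -> : - (x ^+ 2 / (2 * s2)) = (x / s2) ^+ 2 * s2 / 2 - x / s2 * x.
  by field; rewrite gt_eqF.
by rewrite lerD2r ler_wpM2r ?invr_ge0// ler_wpM2l// sqr_ge0.
Qed.

End centered_normal_theory.

(** * Uniqueness of the law and concentration *)

Section step_approximation.
Context (R : realType).

(* The cubic [y (3 - y^2) / 2] maps [-1, 1] to itself, is odd, and its iterates
   converge pointwise to the sign function. *)
Fixpoint sg_approx (k : nat) (y : R) : R :=
  if k is k'.+1 then sg_approx k' y * (3 - sg_approx k' y ^+ 2) / 2 else y.

Lemma sg_approxN k y : sg_approx k (- y) = - sg_approx k y.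
Proof. by elim: k => //= k ->; rewrite sqrrN; ring. Qed.

(** With [s] the current iterate, the gap [1 - s] is multiplied by
    [(1 - s) * (2 + s) / 2 <= 1 - s / 2]. Since iterates stay above [y], the contraction factor is
    at most [1 - y / 2] at every step. *)
Lemma sg_approx_bound k (y : R) : 0 < y <= 1 ->
  [/\ y <= sg_approx k y, sg_approx k y <= 1
    & 1 - sg_approx k y <= (1 - y / 2) ^+ k].
Proof.
move=> /andP[y0 y1]; elim: k => [|k [a b c]] /=.
  by split => //; rewrite expr0; lra.
set s := sg_approx k y in a b c *.
have s0 : 0 < s by exact: lt_le_trans a.
have e1 : 1 - s * (3 - s ^+ 2) / 2 = (1 - s) * ((1 - s) * (2 + s) / 2) by field.
have e2 : s * (3 - s ^+ 2) / 2 = s + s * ((1 - s) * (1 + s) / 2) by field.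
split.
- by rewrite e2 (le_trans a)// lerDl mulr_ge0 ?divr_ge0 ?mulr_ge0 ?subr_ge0//; lra.
- by rewrite -subr_ge0 e1 mulr_ge0 ?divr_ge0 ?mulr_ge0 ?subr_ge0//; lra.
- rewrite e1 exprSr ler_pM ?subr_ge0// ?divr_ge0 ?mulr_ge0 ?subr_ge0//; first lra.
  by nra.
Qed.

Lemma sg_approx_normr k (y : R) : `|y| <= 1 -> `|sg_approx k y| <= 1.
Proof.
wlog y0 : y / 0 <= y.
  move=> H; have [/H//|y0] := leP 0 y.
  by rewrite -normrN => /H; rewrite oppr_ge0 sg_approxN normrN; apply; exact: ltW.
rewrite ger0_norm// => y1; have [->|y0'] := eqVneq y 0.
  have -> : sg_approx k 0 = 0 by elim: k => //= k ->; rewrite !mul0r.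
  by rewrite normr0.
have yp : 0 < y by rewrite lt_neqAle eq_sym y0'.
have [|a b _] := @sg_approx_bound k y; first by rewrite yp.
by rewrite ger0_norm// (le_trans y0 a).
Qed.

Lemma cvg_sg_approx (y : R) : `|y| <= 1 ->
  (fun k => sg_approx k y) @ \oo --> Num.sg y.
Proof.
wlog y0 : y / 0 <= y.
  move=> H; have [/H//|y0] := leP 0 y.
  have -> : (fun k => sg_approx k y) = - (fun k => sg_approx k (- y)).
    by apply/funext => k; rewrite fctE sg_approxN opprK.
  rewrite -normrN => /H; rewrite oppr_ge0 => /(_ (ltW y0)).
  by rewrite sgrN => /cvgN; rewrite opprK.
rewrite ger0_norm// => y1; have [->|y0'] := eqVneq y 0.
  rewrite sgr0; under eq_fun => k.
    have -> : sg_approx k 0 = 0 by elim: k => //= k ->; rewrite !mul0r.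
    over.
  exact: cvg_cst.
have yp : 0 < y by rewrite lt_neqAle eq_sym y0'.
rewrite gtr0_sg//.
apply: (@squeeze_cvgr _ _ _ _ (fun k => 1 - (1 - y / 2) ^+ k) (cst 1)).
- apply: nearW => k.
  have [|a b c] := @sg_approx_bound k y; first by rewrite yp.
  by rewrite /= b andbT; lra.
- rewrite -[X in _ --> X]subr0; apply: cvgB; first exact: cvg_cst.
  by apply: cvg_expr; rewrite ger0_norm; lra.
- exact: cvg_cst.
Qed.

(** Dilation pushes the nonzero zeros of the sine away: as soon as the dilated argument is smaller
    than [pi] in absolute value, the sine has the sign of [y]. A non-periodic function is thus
    reached from periodic ones. *)
Lemma cvg_sg_sin (y : R) :
  (fun m : nat => Num.sg (sin (m.+1%:R^-1 * y))) @ \oo --> Num.sg y.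
Proof.
wlog y0 : y / 0 <= y.
  move=> H; have [/H//|y0] := leP 0 y.
  have -> : (fun m : nat => Num.sg (sin (m.+1%:R^-1 * y)))
      = - (fun m : nat => Num.sg (sin (m.+1%:R^-1 * - y))).
    by apply/funext => k; rewrite fctE mulrN sinN sgrN opprK.
  have := H (- y); rewrite oppr_ge0 => /(_ (ltW y0)).
  by rewrite sgrN => /cvgN; rewrite opprK.
have [->|y0'] := eqVneq y 0.
  by rewrite sgr0; under eq_fun do rewrite mulr0 sin0 sgr0; exact: cvg_cst.
have yp : 0 < y by rewrite lt_neqAle eq_sym y0'.
rewrite gtr0_sg//.
apply: cvg_near_cst; near=> m; rewrite gtr0_sg// sin_gt0_pi//.
apply/andP; split; first by rewrite mulr_gt0.
rewrite mulrC ltr_pdivrMr// mulrC -ltr_pdivrMr ?pi_gt0//.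
apply: (@lt_le_trans _ _ m%:R); last by rewrite ler_nat.
by near: m; exact: nbhs_infty_gtr.
Unshelve. all: by end_near. Qed.

End step_approximation.

Definition half_line {R : realType} (b : bool) (x : R) : set R :=
  [set y | if b then x < y else x <= y].

Lemma measurable_half_line {R : realType} b (x : R) : measurable (half_line b x).
Proof.
rewrite /half_line; case: b.
  rewrite (_ : [set y | _] = `]x, +oo[%classic)//.
  by apply/seteqP; split => y /=; rewrite in_itv/= andbT.
rewrite (_ : [set y | _] = `[x, +oo[%classic)//.
by apply/seteqP; split => y /=; rewrite in_itv/= andbT.
Qed.

Lemma cvg_Rintegral_bounded d (T : measurableType d) (R : realType)
    (P : probability T R) (f_ : nat -> T -> R) (f : T -> R) (M : R) :
  (forall n, measurable_fun setT (f_ n)) ->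
  (forall w, f_ ^~ w @ \oo --> f w) -> (forall n w, `|f_ n w| <= M) ->
  (fun n => \int[P]_w f_ n w) @ \oo --> \int[P]_w f w.
Proof.
move=> mf_ ff fM; apply: fine_cvg; rewrite fineK; last first.
  apply: integrable_fin_num => //; apply: (@bounded_integrable _ _ _ _ _ M).
    by apply: (measurable_fun_cvg (h := f_)) => // w _; exact: ff.
  move=> w; have h : (fun n => `|f_ n w|) @ \oo --> `|f w|.
    by apply: cvg_norm; exact: ff.
  rewrite -(cvg_lim _ h)//; apply: limr_le; first exact: cvgP h.
  by apply: nearW => n; exact: fM.
apply: (@dominated_cvg _ _ _ _ _ measurableT (fun n w => (f_ n w)%:E)
    (fun w => (f w)%:E) (cst M%:E)) => //.
- by move=> n; exact/measurable_EFinP.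
- by move=> w _; apply/cvg_EFin; [exact: nearW|exact: ff].
- exact: finite_measure_integrable_cst.
- by move=> n w _; rewrite lee_fin.
Qed.

(** * Trigonometric moments determine orthant probabilities *)

Section uniqueness.
Context d (T : measurableType d) (R : realType) (P : probability T R).
Variables (N : nat) (W1 W2 : 'I_N -> T -> R).
Hypothesis mW1 : forall i, measurable_fun setT (W1 i).
Hypothesis mW2 : forall i, measurable_fun setT (W2 i).

Let L (W : 'I_N -> T -> R) (c : 'I_N -> R) w := \sum_(i < N) c i * W i w.

(** The measures of densities [phi1] and [phi2], transported by [W1] and [W2], have the same Fourier
    transform. Carrying densities along allows indicators to be inserted one coordinate at a
    time. *)
Definition same_trig (phi1 phi2 : T -> R) : Prop :=
  [/\ measurable_fun setT phi1, measurable_fun setT phi2,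
    exists M : R, forall w, `|phi1 w| <= M /\ `|phi2 w| <= M &
    forall c, \int[P]_w (phi1 w * cos (L W1 c w)) = \int[P]_w (phi2 w * cos (L W2 c w))
      /\ \int[P]_w (phi1 w * sin (L W1 c w)) = \int[P]_w (phi2 w * sin (L W2 c w))].

(** The functions that may be inserted in any single coordinate. They form an algebra closed under
    bounded pointwise limits, which leads from sines to indicators of half-lines without Fourier
    inversion. *)
Definition trig_multiplier (g : R -> R) : Prop :=
  [/\ measurable_fun setT g, exists M : R, forall y, `|g y| <= M &
   forall i phi1 phi2, same_trig phi1 phi2 ->
     same_trig (fun w => phi1 w * g (W1 i w)) (fun w => phi2 w * g (W2 i w))].

Let mL W c : (forall i, measurable_fun setT (W i)) -> measurable_fun setT (L W c).
Proof.
by move=> mW; apply: measurable_sum => i; apply: measurable_funM.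
Qed.

Let bounded_mul (f g : T -> R) (M M' : R) : (forall w, `|f w| <= M) ->
  (forall w, `|g w| <= M') -> forall w, `|f w * g w| <= M * M'.
Proof. by move=> a b w; rewrite normrM ler_pM. Qed.

Let integrable_trig (phi psi : T -> R) (M : R) : measurable_fun setT phi ->
  (forall w, `|phi w| <= M) -> measurable_fun setT psi ->
  (forall w, `|psi w| <= 1) -> P.-integrable setT (EFin \o (fun w => phi w * psi w)).
Proof.
move=> mphi phiM mpsi psi1; apply: (@bounded_integrable _ _ _ _ _ (M * 1)).
  exact: measurable_funM.
exact: bounded_mul.
Qed.

Let mcos (f : T -> R) : measurable_fun setT f -> measurable_fun setT (fun w => cos (f w)).
Proof.
move=> mf; apply: measurableT_comp mf; exact: (continuous_measurable_fun (@continuous_cos R)).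
Qed.

Let msin (f : T -> R) : measurable_fun setT f -> measurable_fun setT (fun w => sin (f w)).
Proof.
move=> mf; apply: measurableT_comp mf; exact: (continuous_measurable_fun (@continuous_sin R)).
Qed.

Lemma same_trigD phi1 phi2 psi1 psi2 : same_trig phi1 phi2 -> same_trig psi1 psi2 ->
  same_trig (fun w => phi1 w + psi1 w) (fun w => phi2 w + psi2 w).
Proof.
move=> [m1 m2 [M b] e] [m1' m2' [M' b'] e']; split; try exact: measurable_funD.
  by exists (M + M') => w; have [? ?] := b w; have [? ?] := b' w;
    split; rewrite (le_trans (ler_normD _ _))// lerD.
have b1 w : `|phi1 w| <= M by case: (b w).
have b2 w : `|phi2 w| <= M by case: (b w).
have b1' w : `|psi1 w| <= M' by case: (b' w).
have b2' w : `|psi2 w| <= M' by case: (b' w).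
have D (f : T -> R) (mf : measurable_fun setT f) (f1 : forall w, `|f w| <= 1) :=
  (RintegralD measurableT (integrable_trig m1 b1 mf f1) (integrable_trig m1' b1' mf f1),
  RintegralD measurableT (integrable_trig m2 b2 mf f1) (integrable_trig m2' b2' mf f1)).
move=> c; have [ec es] := e c; have [ec' es'] := e' c.
have C1 := D _ (mcos (mL c mW1)) (fun w => cos_max _).
have C2 := D _ (mcos (mL c mW2)) (fun w => cos_max _).
have S1 := D _ (msin (mL c mW1)) (fun w => sin_max _).
have S2 := D _ (msin (mL c mW2)) (fun w => sin_max _).
by split; under eq_Rintegral do rewrite mulrDl; rewrite ?(C1, S1) ?ec ?es ?ec' ?es';
  rewrite -?(C2, S2); apply: eq_Rintegral => w _; rewrite mulrDl.
Qed.

Lemma same_trigZ phi1 phi2 (a : R) : same_trig phi1 phi2 ->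
  same_trig (fun w => a * phi1 w) (fun w => a * phi2 w).
Proof.
move=> [m1 m2 [M b] e]; split; try exact: measurable_funM.
  by exists (`|a| * M) => w; have [? ?] := b w; rewrite !normrM !ler_wpM2l.
have b1 w : `|phi1 w| <= M by case: (b w).
have b2 w : `|phi2 w| <= M by case: (b w).
have D (f : T -> R) (mf : measurable_fun setT f) (f1 : forall w, `|f w| <= 1) :=
  (RintegralZl a measurableT (integrable_trig m1 b1 mf f1),
   RintegralZl a measurableT (integrable_trig m2 b2 mf f1)).
move=> c; have [ec es] := e c.
have C1 := D _ (mcos (mL c mW1)) (fun w => cos_max _).
have C2 := D _ (mcos (mL c mW2)) (fun w => cos_max _).
have S1 := D _ (msin (mL c mW1)) (fun w => sin_max _).
have S2 := D _ (msin (mL c mW2)) (fun w => sin_max _).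
by split; under eq_Rintegral do rewrite -mulrA; rewrite ?(C1, S1) ?ec ?es;
  rewrite -?(C2, S2); apply: eq_Rintegral => w _; rewrite mulrA.
Qed.

Let addc (c : 'I_N -> R) i (a : R) : 'I_N -> R := fun j => c j + (if j == i then a else 0).

Let L_addc W c i a w : L W (addc c i a) w = L W c w + a * W i w.
Proof.
rewrite /L /addc; under eq_bigr do rewrite mulrDl.
rewrite big_split/=; congr (_ + _); rewrite (bigD1 i)//= eqxx big1 ?addr0//.
by move=> j /negbTE ->; rewrite mul0r.
Qed.

(** Product-to-sum formulas: a factor [sin (a * W i)] or [cos (a * W i)] only moves the coefficient
    vector by [a] or [- a] in coordinate [i]. *)
Lemma same_trig_sincos i a phi1 phi2 : same_trig phi1 phi2 ->
  same_trig (fun w => phi1 w * sin (a * W1 i w)) (fun w => phi2 w * sin (a * W2 i w))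
  /\ same_trig (fun w => phi1 w * cos (a * W1 i w)) (fun w => phi2 w * cos (a * W2 i w)).
Proof.
move=> [m1 m2 [M b] e].
have b1 w : `|phi1 w| <= M by case: (b w).
have b2 w : `|phi2 w| <= M by case: (b w).
have maW (W : 'I_N -> T -> R) : (forall i, measurable_fun setT (W i)) ->
    measurable_fun setT (fun w => a * W i w) by move=> ?; exact: measurable_funM.
have ms1 := msin (maW _ mW1); have ms2 := msin (maW _ mW2).
have mc1 := mcos (maW _ mW1); have mc2 := mcos (maW _ mW2).
have bb (phi psi : T -> R) : (forall w, `|phi w| <= M) ->
    (forall w, `|psi w| <= 1) -> forall w, `|phi w * psi w| <= M.
  by move=> ? ? w; rewrite normrM -[M]mulr1 ler_pM.
have D (phi : T -> R) W (m : measurable_fun setT phi) (bphi : forall w, `|phi w| <= M)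
    (mW : forall i, measurable_fun setT (W i)) c :
  [/\ \int[P]_w (phi w * sin (a * W i w) * cos (L W c w))
      = (\int[P]_w (phi w * sin (L W (addc c i a) w))
         - (\int[P]_w (phi w * sin (L W (addc c i (- a)) w)))) / 2,
     \int[P]_w (phi w * sin (a * W i w) * sin (L W c w))
      = (\int[P]_w (phi w * cos (L W (addc c i (- a)) w))
         - (\int[P]_w (phi w * cos (L W (addc c i a) w)))) / 2,
     \int[P]_w (phi w * cos (a * W i w) * cos (L W c w))
      = (\int[P]_w (phi w * cos (L W (addc c i a) w))
         + (\int[P]_w (phi w * cos (L W (addc c i (- a)) w)))) / 2 &
     \int[P]_w (phi w * cos (a * W i w) * sin (L W c w))
      = (\int[P]_w (phi w * sin (L W (addc c i a) w))
         + (\int[P]_w (phi w * sin (L W (addc c i (- a)) w)))) / 2].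
  have IC c' := integrable_trig m bphi (mcos (mL c' mW)) (fun w => cos_max _).
  have IS c' := integrable_trig m bphi (msin (mL c' mW)) (fun w => sin_max _).
  have IDC := integrableD measurableT (IC (addc c i a)) (IC (addc c i (- a))).
  have IDS := integrableD measurableT (IS (addc c i a)) (IS (addc c i (- a))).
  have IBC := integrableB measurableT (IC (addc c i (- a))) (IC (addc c i a)).
  have IBS := integrableB measurableT (IS (addc c i a)) (IS (addc c i (- a))).
  split.
  - rewrite -(RintegralB measurableT (IS _) (IS _)).
    rewrite -(RintegralZr _ measurableT IBS); apply: eq_Rintegral => w _.
    by rewrite !L_addc !sinD !mulNr sinN cosN; field.
  - rewrite -(RintegralB measurableT (IC _) (IC _)).
    rewrite -(RintegralZr _ measurableT IBC); apply: eq_Rintegral => w _.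
    by rewrite !L_addc !cosD !mulNr sinN cosN; field.
  - rewrite -(RintegralD measurableT (IC _) (IC _)).
    rewrite -(RintegralZr _ measurableT IDC); apply: eq_Rintegral => w _.
    by rewrite !L_addc !cosD !mulNr sinN cosN; field.
  - rewrite -(RintegralD measurableT (IS _) (IS _)).
    rewrite -(RintegralZr _ measurableT IDS); apply: eq_Rintegral => w _.
    by rewrite !L_addc !sinD !mulNr sinN cosN; field.
split; split; try exact: measurable_funM.
- exists M => w; split; [apply: (bb phi1 (fun w => sin (a * W1 i w)))
    |apply: (bb phi2 (fun w => sin (a * W2 i w)))] => // ?; exact: sin_max.
- move=> c; have [-> -> _ _] := D _ _ m1 b1 mW1 c; have [-> -> _ _] := D _ _ m2 b2 mW2 c.
  have [-> ->] := e (addc c i a); by have [-> ->] := e (addc c i (- a)).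
- exists M => w; split; [apply: (bb phi1 (fun w => cos (a * W1 i w)))
    |apply: (bb phi2 (fun w => cos (a * W2 i w)))] => // ?; exact: cos_max.
- move=> c; have [_ _ -> ->] := D _ _ m1 b1 mW1 c; have [_ _ -> ->] := D _ _ m2 b2 mW2 c.
  have [-> ->] := e (addc c i a); by have [-> ->] := e (addc c i (- a)).
Qed.

Lemma trig_multiplier_shift_sin (a x : R) :
  trig_multiplier (fun y => sin (a * (y - x))).
Proof.
split.
- apply: (measurableT_comp (continuous_measurable_fun (@continuous_sin R))).
  by apply: measurable_funM => //; exact: measurable_funB.
- by exists 1 => y; exact: sin_max.
move=> i phi1 phi2 /(same_trig_sincos i a)[s c].
have := same_trigD (same_trigZ (cos (a * x)) s) (same_trigZ (- sin (a * x)) c).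
congr same_trig; apply/funext => w; rewrite mulrBr sinB; ring.
Qed.

Lemma trig_multiplierM g1 g2 : trig_multiplier g1 -> trig_multiplier g2 ->
  trig_multiplier (fun y => g1 y * g2 y).
Proof.
move=> [m1 [M1 b1] h1] [m2 [M2 b2] h2]; split; first exact: measurable_funM.
  by exists (M1 * M2) => y; rewrite normrM ler_pM.
move=> i phi1 phi2 /(h1 i)/(h2 i).
by congr same_trig; apply/funext => w; rewrite mulrA.
Qed.

Lemma trig_multiplierD g1 g2 : trig_multiplier g1 -> trig_multiplier g2 ->
  trig_multiplier (fun y => g1 y + g2 y).
Proof.
move=> [m1 [M1 b1] h1] [m2 [M2 b2] h2]; split; first exact: measurable_funD.
  by exists (M1 + M2) => y; rewrite (le_trans (ler_normD _ _))// lerD.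
move=> i phi1 phi2 s; have := same_trigD (h1 i _ _ s) (h2 i _ _ s).
by congr same_trig; apply/funext => w; rewrite mulrDr.
Qed.

Lemma trig_multiplier_cst a : trig_multiplier (cst a).
Proof.
split=> //; first by exists `|a|.
by move=> i phi1 phi2 /(same_trigZ a); congr same_trig; apply/funext => w;
  rewrite mulrC.
Qed.

Lemma trig_multiplierZ a g : trig_multiplier g -> trig_multiplier (fun y => a * g y).
Proof. exact: trig_multiplierM (trig_multiplier_cst a). Qed.

Lemma trig_multiplier_cvg (g_ : nat -> R -> R) (g : R -> R) (M : R) :
  (forall n, trig_multiplier (g_ n)) -> (forall n y, `|g_ n y| <= M) ->
  (forall y, g_ ^~ y @ \oo --> g y) -> trig_multiplier g.
Proof.
move=> hg gM gg.
have mg : measurable_fun [set: R] g.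
  by apply: (measurable_fun_cvg (h := g_)) => [n|y _]; [case: (hg n)|exact: gg].
have gM' y : `|g y| <= M.
  have h : (fun n => `|g_ n y|) @ \oo --> `|g y| by apply: cvg_norm; exact: gg.
  rewrite -(cvg_lim _ h)//; apply: limr_le; first exact: cvgP h.
  exact: nearW.
split => //; first by exists M.
move=> i phi1 phi2 s; have [m1 m2 [K b] _] := s.
have b1 w : `|phi1 w| <= K by case: (b w).
have b2 w : `|phi2 w| <= K by case: (b w).
have mgW (W : 'I_N -> T -> R) (h : R -> R) : (forall i, measurable_fun setT (W i)) ->
    measurable_fun [set: R] h -> measurable_fun setT (fun w => h (W i w)).
  by move=> mW mh; apply: measurableT_comp mh _.
have lim (phi psi : T -> R) W : measurable_fun setT phi ->
    (forall w, `|phi w| <= K) -> (forall i, measurable_fun setT (W i)) ->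
    measurable_fun setT psi -> (forall w, `|psi w| <= 1) ->
    (fun n => \int[P]_w (phi w * g_ n (W i w) * psi w)) @ \oo
    --> \int[P]_w (phi w * g (W i w) * psi w).
  move=> mphi bphi mW mpsi bpsi; apply: (@cvg_Rintegral_bounded _ _ _ _ _ _ (K * M * 1)).
  - move=> n; apply: measurable_funM => //; apply: measurable_funM => //.
    by apply: (mgW W (g_ n)) => //; case: (hg n).
  - move=> w; apply: cvgM; last exact: cvg_cst.
    by apply: cvgM; [exact: cvg_cst|exact: gg].
  - move=> n w; rewrite !normrM ler_pM// ler_pM//.
split.
- by apply: measurable_funM => //; exact: (mgW W1 g).
- by apply: measurable_funM => //; exact: (mgW W2 g).
- by exists (K * M) => w; rewrite !normrM !ler_pM.
move=> c.
have hs n := let: And4 _ _ _ h := (let: And3 _ _ h' := hg n in h' i phi1 phi2 s) in h c.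
split.
- have e1 := lim phi1 _ W1 m1 b1 mW1 (mcos (mL c mW1)) (fun w => cos_max _).
  have e2 := lim phi2 _ W2 m2 b2 mW2 (mcos (mL c mW2)) (fun w => cos_max _).
  apply: (cvg_unique _ e1) => //; apply: cvg_trans e2.
  by apply: near_eq_cvg; apply: nearW => n; case: (hs n).
- have e1 := lim phi1 _ W1 m1 b1 mW1 (msin (mL c mW1)) (fun w => sin_max _).
  have e2 := lim phi2 _ W2 m2 b2 mW2 (msin (mL c mW2)) (fun w => sin_max _).
  apply: (cvg_unique _ e1) => //; apply: cvg_trans e2.
  by apply: near_eq_cvg; apply: nearW => n; case: (hs n).
Qed.

(** Two nested limits: the cubic iterates turn a sine into its sign, which is still periodic, and
    the dilation then turns the sign of the sine into the sign of [y - x]. *)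
Lemma trig_multiplier_sg (x : R) : trig_multiplier (fun y => Num.sg (y - x)).
Proof.
have sg1 (z : R) : `|Num.sg z| <= 1 by rewrite normr_sg; case: eqP; rewrite ?ler01 ?lexx.
apply: (@trig_multiplier_cvg (fun m y => Num.sg (sin (m.+1%:R^-1 * (y - x)))) _ 1).
- move=> m; apply: (@trig_multiplier_cvg
    (fun k y => sg_approx k (sin (m.+1%:R^-1 * (y - x)))) _ 1).
  + elim=> [|k ih] /=; first exact: trig_multiplier_shift_sin.
    have sq := trig_multiplierZ (- 1) (trig_multiplierM ih ih).
    have := trig_multiplierZ (2^-1)
      (trig_multiplierM ih (trig_multiplierD (trig_multiplier_cst 3) sq)).
    by congr trig_multiplier; apply/funext => y /=; rewrite mulN1r expr2 mulrC.
  + by move=> k y; apply: sg_approx_normr; exact: sin_max.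
  + by move=> y; apply: cvg_sg_approx; exact: sin_max.
- by move=> m y.
- by move=> y; exact: cvg_sg_sin.
Qed.

(** With [s] the sign of [y - x], the open half-line has indicator [(s + s ^+ 2) / 2] and the closed
    one [1 + (s - s ^+ 2) / 2]. *)
Lemma trig_multiplier_half_line b x : trig_multiplier (\1_(half_line b x)).
Proof.
have sg2 := trig_multiplierM (trig_multiplier_sg x) (trig_multiplier_sg x).
case: b.
- have := trig_multiplierZ 2^-1 (trig_multiplierD (trig_multiplier_sg x) sg2).
  congr trig_multiplier; apply/funext => y; rewrite indicE /half_line.
  have [yx|yx|->] := ltgtP x y.
  + by rewrite mem_set//= gtr0_sg ?subr_gt0// mulr1; field.
  + rewrite memNset//=; first by rewrite ltr0_sg ?subr_lt0//; ring.
    by apply/negP; rewrite -leNgt ltW.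
  + by rewrite memNset/= ?ltxx// subrr sgr0; ring.
- have := trig_multiplierD (trig_multiplier_cst 1) (trig_multiplierZ 2^-1
    (trig_multiplierD (trig_multiplier_sg x) (trig_multiplierZ (-1) sg2))).
  congr trig_multiplier; apply/funext => y; rewrite indicE /half_line.
  have [yx|yx|->] := ltgtP x y.
  + by rewrite mem_set/= ?ltW// gtr0_sg ?subr_gt0// mulr1; field.
  + rewrite memNset//=; first by rewrite ltr0_sg ?subr_lt0//; field.
    by apply/negP; rewrite -ltNge.
  + by rewrite mem_set/= ?lexx// subrr sgr0; ring.
Qed.

(* A Cramer-Wold statement: the joint law of a family is determined, on
   orthants, by the trigonometric moments of its linear combinations. *)
Theorem same_orthant_probability (b : 'I_N -> bool) (x : 'I_N -> R) :
  same_trig (cst 1) (cst 1) ->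
  P [set w | forall i, half_line (b i) (x i) (W1 i w)]
  = P [set w | forall i, half_line (b i) (x i) (W2 i w)].
Proof.
move=> h1.
(* Once the indicators of all coordinates are inserted, the moment of frequency 0 is the probability
   of the orthant. *)
pose phi (W : 'I_N -> T -> R) (r : seq 'I_N) w : R :=
  \prod_(i <- r) \1_(half_line (b i) (x i)) (W i w).
have st r : same_trig (phi W1 r) (phi W2 r).
  elim: r => [|i r ih].
    by move: h1; congr same_trig; apply/funext => w; rewrite /phi big_nil.
  have [_ _ /(_ i _ _ ih)] := trig_multiplier_half_line (b i) (x i).
  by congr same_trig; apply/funext => w; rewrite /phi big_cons mulrC.
have phiE W : phi W (index_enum 'I_N)
    = \1_([set w | forall i, half_line (b i) (x i) (W i w)]).
  apply/funext => w; rewrite indicE /phi.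
  have [h|h] := pselect (forall i, half_line (b i) (x i) (W i w)).
    by rewrite mem_set// big1// => i _; rewrite indicE mem_set.
  rewrite memNset//; move/existsNP : h => [i hi].
  by rewrite (bigD1 i)//= indicE memNset// mul0r.
have [_ _ _ /(_ (fun=> 0))[+ _]] := st (index_enum 'I_N).
have L0 W w : L W (fun=> 0) w = 0 by rewrite /L big1// => i _; rewrite mul0r.
under eq_Rintegral do rewrite L0 cos0 mulr1.
under [in X in _ = X -> _]eq_Rintegral do rewrite L0 cos0 mulr1.
rewrite !phiE.
have mA (W : 'I_N -> T -> R) : (forall i, measurable_fun setT (W i)) ->
    measurable [set w | forall i, half_line (b i) (x i) (W i w)].
  move=> mW; rewrite (_ : [set _ | _]
    = \bigcap_(i in [set: 'I_N]) (W i @^-1` half_line (b i) (x i))); last first.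
    by apply/seteqP; split => w /= H i; [move=> _|]; exact: H.
  apply: fin_bigcap_measurable => // i _; rewrite -[X in measurable X]setTI.
  by apply: mW => //; exact: measurable_half_line.
rewrite /Rintegral !integral_indic ?setIT//; try exact: mA.
move=> /eqP; rewrite -eqe !fineK; first by move/eqP.
- by rewrite fin_num_measure//; exact: mA.
- by rewrite fin_num_measure//; exact: mA.
Qed.

End uniqueness.

Lemma measure_bigsetU_le d (T : measurableType d) (R : realType)
    (mu : {measure set T -> \bar R}) (I : Type) (r : seq I) (A : I -> set T) :
  (forall i, measurable (A i)) ->
  (mu (\big[setU/set0]_(i <- r) A i) <= \sum_(i <- r) mu (A i))%E.
Proof.
move=> mA; elim: r => [|i r ih]; first by rewrite !big_nil measure0.
rewrite !big_cons; apply: (le_trans (measureU2 _ _ _)) => //.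
  by apply: bigsetU_measurable => j _.
by rewrite leeD2l.
Qed.

Section product_expectation.
Context d (T : measurableType d) (R : realType) (P : probability T R).

Lemma Rintegral_prodM (f g : T -> R) (M M' : R) :
  measurable_fun setT f -> (forall w, `|f w| <= M) ->
  measurable_fun setT g -> (forall w, `|g w| <= M') ->
  \int[(P \x P)%E]_z (f z.1 * g z.2) = (\int[P]_w f w) * (\int[P]_w g w).
Proof.
move=> mf fM mg gM.
have mf1 : measurable_fun setT (fun z : T * T => f z.1).
  by apply: (measurableT_comp mf); exact: measurable_fst.
have mg2 : measurable_fun setT (fun z : T * T => g z.2).
  by apply: (measurableT_comp mg); exact: measurable_snd.
have ifg : (P \x P)%E.-integrable setT (fun z : T * T => (f z.1 * g z.2)%:E).
  apply: (@bounded_integrable _ _ _ _ (fun z => f z.1 * g z.2) (M * M')).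
    exact: measurable_funM.
  by move=> z; rewrite normrM ler_pM.
have jf : P.-integrable setT (EFin \o f) by exact: bounded_integrable mf fM.
have jg : P.-integrable setT (EFin \o g) by exact: bounded_integrable mg gM.
rewrite {1}/Rintegral -(integral12_prod_meas1 ifg) /fubini_F /=.
under eq_integral.
  move=> x _; under eq_integral do rewrite EFinM.
  rewrite integralZl//.
  have -> : (\int[P]_y (g y)%:E = (\int[P]_w g w)%:E)%E.
    by rewrite fineK//; exact: integrable_fin_num.
  over.
rewrite /= integralZr// fineM//; first exact: integrable_fin_num.
Qed.

End product_expectation.

(** * Dimension-free Gaussian concentration *)

Section concentration.
Context d (T : measurableType d) (R : realType) (P : probability T R).
Variables (N : nat) (D : 'I_N -> T -> R) (Q : 'I_N -> 'I_N -> R).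

Let comb (c : 'I_N -> R) w := \sum_(i < N) c i * D i w.
Let var (c : 'I_N -> R) := \sum_(i < N) \sum_(j < N) c i * c j * Q i j.

Hypothesis mD : forall i, measurable_fun setT (D i).
Hypothesis gaussD : forall c, centered_normal P (comb c) (var c).

Let P2 : probability (T * T)%type R := (P \x P)%E.

Let mcomb c : measurable_fun setT (comb c).
Proof. by apply: measurable_sum => i; exact: measurable_funM. Qed.

Let mcos (f : T -> R) : measurable_fun setT f -> measurable_fun setT (fun w => cos (f w)).
Proof.
by move=> mf; apply: measurableT_comp mf; exact: (continuous_measurable_fun (@continuous_cos R)).
Qed.

Let msin (f : T -> R) : measurable_fun setT f -> measurable_fun setT (fun w => sin (f w)).
Proof.
by move=> mf; apply: measurableT_comp mf; exact: (continuous_measurable_fun (@continuous_sin R)).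
Qed.

Let E2_trig a b :
  \int[P2]_z cos (comb a z.1 + comb b z.2) = expR (- ((var a + var b) / 2)) /\
  \int[P2]_z sin (comb a z.1 + comb b z.2) = 0.
Proof.
have Ec c : \int[P]_w cos (comb c w) = expR (- (var c / 2)).
  have := expectation_cos (gaussD c) 1; rewrite expr1n mul1r => <-.
  by apply: eq_Rintegral => w _; rewrite mul1r.
have Es c : \int[P]_w sin (comb c w) = 0.
  rewrite -(expectation_sin (gaussD c) 1).
  by apply: eq_Rintegral => w _; rewrite mul1r.
have mc c := mcos (mcomb c); have ms c := msin (mcomb c).
have bc c w : `|cos (comb c w)| <= 1 := cos_max _.
have bs c w : `|sin (comb c w)| <= 1 := sin_max _.
have ip (f g : T -> R) : measurable_fun setT f -> (forall w, `|f w| <= 1) ->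
  measurable_fun setT g -> (forall w, `|g w| <= 1) ->
  P2.-integrable setT (EFin \o (fun z => f z.1 * g z.2)).
  move=> mf f1 mg g1; apply: (@bounded_integrable _ _ _ _ _ (1 * 1)).
    apply: measurable_funM.
      by apply: (measurableT_comp mf); exact: measurable_fst.
    by apply: (measurableT_comp mg); exact: measurable_snd.
  by move=> z; rewrite normrM ler_pM.
split.
- under eq_Rintegral do rewrite cosD.
  rewrite (RintegralB measurableT (ip _ _ (mc a) (bc a) (mc b) (bc b))
    (ip _ _ (ms a) (bs a) (ms b) (bs b))).
  rewrite (Rintegral_prodM P (mc a) (bc a) (mc b) (bc b)).
  rewrite (Rintegral_prodM P (ms a) (bs a) (ms b) (bs b)).
  by rewrite !Ec !Es mul0r subr0 -expRD; congr expR; field.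
- under eq_Rintegral do rewrite sinD.
  rewrite (RintegralD measurableT (ip _ _ (ms a) (bs a) (mc b) (bc b))
    (ip _ _ (mc a) (bc a) (ms b) (bs b))).
  rewrite (Rintegral_prodM P (ms a) (bs a) (mc b) (bc b)).
  rewrite (Rintegral_prodM P (mc a) (bc a) (ms b) (bs b)).
  by rewrite !Es mul0r mulr0 addr0.
Qed.

Let r2 : R := (Num.sqrt 2)^-1.

Let r2_sqr : r2 ^+ 2 = 2^-1.
Proof. by rewrite exprVn sqr_sqrtr. Qed.

Let r2_gt0 : 0 < r2. Proof. by rewrite invr_gt0 sqrtr_gt0. Qed.

(* The half-lines are open for [j < i]: ties go to the smallest index, so that
   the events [first_max u i] are disjoint. *)
Let first_max (u : 'I_N -> R) (i : 'I_N) :=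
  forall j : 'I_N, half_line (j < i)%N 0 (u i - u j).

Let first_max_ge u i : first_max u i -> forall j, u j <= u i.
Proof.
by move=> h j; have := h j; rewrite /half_line/=; case: ifP; rewrite ?subr_gt0 ?subr_ge0// => _ /ltW.
Qed.

Let exists_first_max u (i0 : 'I_N) : exists i, first_max u i.
Proof.
pose p i := [forall j, u j <= u i].
have p0 : p [arg max_(i > i0) u i]%O.
  by case: arg_maxP => // i _ h; apply/forallP => j; exact: h.
case: (arg_minnP (fun i : 'I_N => i : nat) p0) => i /forallP hi imin.
exists i => j; rewrite /half_line/=; case: ifP => ji; last by rewrite subr_ge0.
rewrite subr_gt0 lt_neqAle hi andbT; apply/eqP => e.
have : p j by apply/forallP => k; rewrite e.
by move=> /imin; rewrite leqNgt ji.
Qed.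

Let first_max_inj u i j : first_max u i -> first_max u j -> i = j.
Proof.
move=> hi hj; apply: ord_inj.
have gt k l : first_max u k -> first_max u l -> ~~ (k < l)%N.
  move=> hk hl; apply/negP => kl.
  have := hl k; rewrite /half_line/= kl subr_gt0 ltNge.
  by rewrite (first_max_ge hk l).
by apply/eqP; rewrite eqn_leq leqNgt gt//= leqNgt gt.
Qed.

Let D1 i (z : T * T) := r2 * (D i z.1 + D i z.2).
Let D1' i (z : T * T) := r2 * (D i z.2 - D i z.1).

Let mD_fst i : measurable_fun setT (fun z : T * T => D i z.1).
Proof. by apply: (measurableT_comp (mD i)); exact: measurable_fst. Qed.

Let mD_snd i : measurable_fun setT (fun z : T * T => D i z.2).
Proof. by apply: (measurableT_comp (mD i)); exact: measurable_snd. Qed.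

Let mA i : measurable [set w | first_max (D^~ w) i].
Proof.
rewrite (_ : [set _ | _] = \bigcap_(j in [set: 'I_N])
    ((fun w => D i w - D j w) @^-1` half_line (j < i)%N 0)); last first.
  by apply/seteqP; split => w /= H j; [move=> _|]; exact: H.
apply: fin_bigcap_measurable => // j _; rewrite -[X in measurable X]setTI.
have mB : measurable_fun setT (fun w => D i w - D j w) by exact: measurable_funB.
by apply: mB => //; exact: measurable_half_line.
Qed.

(** Being the first maximum is an orthant condition on the differences with coordinate [i]. The
    difference of [i] with itself carries no information, so slot [i] is reused for the second
    vector: families of [N] coordinates suffice, and [same_orthant_probability] applies. *)
Let rotation (i : 'I_N) (x : R) :
  P2 [set z | first_max (D1^~ z) i /\ x <= D1' i z]
  = (P [set w | first_max (D^~ w) i] * P [set w | (x <= D i w)%R])%E.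
Proof.
pose W1 j z := if j == i then D1' i z else D1 i z - D1 j z.
pose W2 j (z : T * T) := if j == i then D i z.2 else D i z.1 - D j z.1.
pose th j := if j == i then x else 0.
pose b (j : 'I_N) := (j < i)%N.
have mW1 j : measurable_fun setT (W1 j).
  rewrite /W1; case: eqP => _.
    by apply: measurable_funM => //; exact: measurable_funB.
  by apply: measurable_funB; apply: measurable_funM => //; exact: measurable_funD.
have mW2 j : measurable_fun setT (W2 j).
  by rewrite /W2; case: eqP => _ //; exact: measurable_funB.
have st : same_trig P2 W1 W2 (cst 1) (cst 1).
  split => //; first by exists 1 => w; rewrite normr1.
  move=> c.
  (* [a] collects the coefficients carried by the first vector and [e] those carried by the second.
     The rotation replaces the pair by [r2 * (a - e)] on the first copy and [r2 * (a + e)] on the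
     second. *)
  pose a j : R := (if j == i then \sum_(k < N | k != i) c k else - c j).
  pose e j : R := (if j == i then c i else 0).
  have sumW (u1 u2 : 'I_N -> R) :
      \sum_(j < N) c j * (if j == i then u2 i else u1 i - u1 j)
      = \sum_(j < N) a j * u1 j + \sum_(j < N) e j * u2 j.
    rewrite (bigD1 i)//= eqxx.
    rewrite [X in _ = X + _](bigD1 i)//= [X in _ = _ + X](bigD1 i)//= /a /e !eqxx.
    rewrite [X in _ = _ + (_ + X)]big1 ?addr0; last first.
      by move=> j /negbTE ->; rewrite mul0r.
    rewrite addrC; congr (_ + _).
    rewrite mulr_suml -big_split/=; apply: eq_bigr => j /negbTE ->.
    by rewrite mulrBr mulNr.
  have L2 z : \sum_(j < N) c j * W2 j z = comb a z.1 + comb e z.2.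
    by rewrite -(sumW (D^~ z.1) (D^~ z.2)).
  have L1 z : \sum_(j < N) c j * W1 j z
      = comb (fun j => r2 * (a j - e j)) z.1 + comb (fun j => r2 * (a j + e j)) z.2.
    rewrite (sumW (D1^~ z) (D1'^~ z)) /comb -!big_split/=; apply: eq_bigr => j _.
    by rewrite /D1 /D1'; ring.
  (* Parallelogram identity for the form [var]: the total variance, on which the characteristic
     function depends, is unchanged by the rotation. *)
  have par : var (fun j => r2 * (a j - e j)) + var (fun j => r2 * (a j + e j))
      = var a + var e.
    rewrite /var -!big_split/=; apply: eq_bigr => j _.
    rewrite -!big_split/=; apply: eq_bigr => k _.
    transitivity (2 * r2 ^+ 2 * (a j * a k + e j * e k) * Q j k); first by ring.
    by rewrite r2_sqr; field.
  have eqI (f g : T * T -> R) : f =1 g -> \int[P2]_z f z = \int[P2]_z g z.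
    by move=> fg; apply: eq_Rintegral => z _.
  split.
  - transitivity (expR (- ((var a + var e) / 2))).
      rewrite -par -(E2_trig _ _).1; apply: eqI => z.
      by rewrite /cst mul1r; congr cos; exact: (L1 z).
    by rewrite -(E2_trig _ _).1; apply: eqI => z; rewrite /cst mul1r; congr cos; exact/esym/(L2 z).
  - transitivity (0 : R).
      apply: etrans (E2_trig (fun j => r2 * (a j - e j)) (fun j => r2 * (a j + e j))).2.
      by apply: eqI => z; rewrite /cst mul1r; congr sin; exact: (L1 z).
    apply: etrans (esym (E2_trig a e).2) _.
    by apply: eqI => z; rewrite /cst mul1r; congr sin; exact/esym/(L2 z).
have eq1 : [set z | forall j, half_line (b j) (th j) (W1 j z)]
    = [set z | first_max (D1^~ z) i /\ x <= D1' i z].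
  apply/seteqP; split => z /=.
    move=> H; split.
      move=> j; have := H j; rewrite /b /th /W1.
      by have [->|//] := eqVneq j i; rewrite subrr /half_line ltnn /=.
    by have := H i; rewrite /b /th /W1 eqxx /half_line ltnn.
  move=> [H1 H2] j; rewrite /b /th /W1; have [->|_] := eqVneq j i.
    by rewrite /half_line ltnn.
  exact: H1.
have eq2 : [set z | forall j, half_line (b j) (th j) (W2 j z)]
    = [set w | first_max (D^~ w) i] `*` [set w | x <= D i w].
  apply/seteqP; split => z /=.
    move=> H; split.
      move=> j; have := H j; rewrite /b /th /W2.
      by have [->|//] := eqVneq j i; rewrite subrr /half_line ltnn /=.
    by have := H i; rewrite /b /th /W2 eqxx /half_line ltnn.
  move=> [H1 H2] j; rewrite /b /th /W2; have [->|_] := eqVneq j i.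
    by rewrite /half_line ltnn.
  exact: H1.
have := same_orthant_probability mW1 mW2 b th st.
rewrite eq1 eq2 => ->; apply: product_measure1E => //.
rewrite (_ : [set w | _] = D i @^-1` `[x, +oo[%classic); last first.
  by apply/seteqP; split => w /=; rewrite in_itv/= andbT.
by rewrite -[X in measurable X]setTI; exact: mD.
Qed.

Let ge_tail i (x s2 : R) : Q i i <= s2 -> 0 < s2 -> 0 <= x ->
  (P [set w | (x <= D i w)%R] <= (expR (- (x ^+ 2 / (2 * s2))))%:E
   /\ P [set w | (x <= - D i w)%R] <= (expR (- (x ^+ 2 / (2 * s2))))%:E)%E.
Proof.
move=> Qs s20 x0.
have ce (a : R) : (fun w => \sum_(j < N) (if j == i then a else 0) * D j w) = (fun w => a * D i w).
  apply/funext => w; rewrite (bigD1 i)//= eqxx big1 ?addr0//.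
  by move=> j /negbTE ->; rewrite mul0r.
have ve (a : R) : var (fun j => if j == i then a else 0) = a ^+ 2 * Q i i.
  rewrite /var (bigD1 i)//= [X in _ + X]big1 ?addr0; last first.
    by move=> j /negbTE ->; rewrite big1// => k _; rewrite !mul0r.
  rewrite (bigD1 i)//= eqxx [X in _ + X]big1 ?addr0 ?expr2//.
  by move=> k /negbTE ->; rewrite mulr0 mul0r.
split.
- have := gaussD (fun j => if j == i then 1 else 0).
  rewrite ve /comb ce expr1n mul1r => /centered_normal_tail/(_ x s2 Qs s20 x0).
  by under eq_set do rewrite mul1r.
- have := gaussD (fun j => if j == i then -1 else 0).
  rewrite ve /comb ce sqrrN expr1n mul1r => /centered_normal_tail/(_ x s2 Qs s20 x0).
  by under eq_set do rewrite mulN1r.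
Qed.

Let measurable_le i x : measurable [set w | x <= D i w].
Proof.
rewrite (_ : [set w | _] = D i @^-1` `[x, +oo[%classic); last first.
  by apply/seteqP; split => w /=; rewrite in_itv/= andbT.
by rewrite -[X in measurable X]setTI; exact: mD.
Qed.

Let measurable_leN i x : measurable [set w | x <= - D i w].
Proof.
rewrite (_ : [set w | _] = D i @^-1` `]-oo, - x]%classic); last first.
  by apply/seteqP; split => w /=; rewrite in_itv/= lerNr.
by rewrite -[X in measurable X]setTI; exact: mD.
Qed.

(** The events [first_max] are disjoint, so their probabilities sum to at most 1 and the sum is at
    most an average of the [F i]; this takes the place of the union bound. *)
Let sum_first_max (t : R) (F : 'I_N -> \bar R) : 0 <= t ->
  (forall i, F i <= t%:E)%E ->
  (\sum_(i < N) (P [set w | first_max (D^~ w) i] * F i) <= t%:E)%E.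
Proof.
move=> t0 Ft; apply: (@le_trans _ _ (\sum_(i < N) (P [set w | first_max (D^~ w) i] * t%:E))%E).
  by apply: lee_sum => i _; apply: lee_wpmul2l.
rewrite -ge0_sume_distrl; last by move=> i _; exact: measure_ge0.
rewrite -[leRHS]mul1e; apply: lee_wpmul2r; first by rewrite lee_fin.
rewrite -measure_semi_additive_ord//.
- by apply: probability_le1; apply: bigsetU_measurable => i _; exact: mA.
- by apply/trivIsetP => i j _ _; apply: contraNeq => /set0P[w [/= /first_max_inj h /h]] /eqP.
- by apply: bigsetU_measurable => i _; exact: mA.
Qed.

(* On the product space, (D + D')/sqrt 2 and (D' - D)/sqrt 2 have the joint law
   of (D, D'): the index at which the first is maximal is independent of the
   second, which is thus evaluated at a single random index. No union bound
   appears, so the estimate does not depend on [N]. *)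
Lemma concentration (eta s s2 : R) : (forall i, Q i i <= s2) -> 0 < s2 ->
  2 * s <= eta ->
  (P [set w | exists i, (eta < D i w)%R] * P [set w | forall i, (D i w <= s)%R]
   <= (2 * expR (- ((eta - 2 * s) ^+ 2 / (16 * s2))))%:E)%E.
Proof.
move=> Qs s20 seta.
(* Origin of the constant 16: a factor 2 from the Gaussian tail, 4 from the half of [eta - 2 * s],
   and 2 from the square of [r2]. *)
pose x := r2 * ((eta - 2 * s) / 2).
have x0 : 0 <= x by apply: mulr_ge0; [exact: ltW|rewrite divr_ge0// subr_ge0].
have xE : x ^+ 2 / (2 * s2) = (eta - 2 * s) ^+ 2 / (16 * s2).
  by rewrite exprMn r2_sqr; field; rewrite gt_eqF.
set t := expR _; have tE : t = expR (- (x ^+ 2 / (2 * s2))) by rewrite xE.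
have mgt : measurable [set w | exists i, eta < D i w].
  rewrite (_ : [set w | _] = \bigcup_(i in [set: 'I_N]) (D i @^-1` `]eta, +oo[%classic)).
    apply: fin_bigcup_measurable => // i _.
    by rewrite -[X in measurable X]setTI; exact: mD.
  apply/seteqP; split => w /= [i]; first by exists i => //=; rewrite in_itv/= andbT.
  by rewrite /= in_itv/= andbT; exists i.
have mle : measurable [set w | forall i, D i w <= s].
  rewrite (_ : [set w | _] = \bigcap_(i in [set: 'I_N]) (D i @^-1` `]-oo, s]%classic)).
    apply: fin_bigcap_measurable => // i _.
    by rewrite -[X in measurable X]setTI; exact: mD.
  apply/seteqP; split => w /= H i; first by rewrite /= in_itv/= => _; exact: H.
  by have := H i Logic.I; rewrite /= in_itv/=.
pose E1 i := [set z | first_max (D1^~ z) i /\ x <= D1' i z].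
pose E2 i := [set w | x <= - D i w] `*` [set w | first_max (D^~ w) i].
have mE2 i : measurable (E2 i) by exact: measurableX.
have mE1 i : measurable (E1 i).
  rewrite (_ : E1 i = (D1' i @^-1` `[x, +oo[%classic) `&`
     \bigcap_(j in [set: 'I_N]) ((fun z => D1 i z - D1 j z) @^-1` half_line (j < i)%N 0)); last first.
    apply/seteqP; split => z /=.
      by move=> [H1 H2]; split; [rewrite in_itv/= andbT|move=> j _; exact: H1].
    by rewrite in_itv/= andbT => -[H1 H2]; split => // j; exact: H2.
  have mD1 j : measurable_fun setT (D1 j).
    by apply: measurable_funM => //; exact: measurable_funD.
  apply: measurableI.
    have mD1' : measurable_fun setT (D1' i).
      by apply: measurable_funM => //; exact: measurable_funB.
    by rewrite -[X in measurable X]setTI; exact: mD1'.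
  apply: fin_bigcap_measurable => // j _; rewrite -[X in measurable X]setTI.
  have mB : measurable_fun setT (fun z => D1 i z - D1 j z) by exact: measurable_funB.
  by apply: mB => //; exact: measurable_half_line.
rewrite muleC -product_measure1E//.
apply: (@le_trans _ _ (P2 ((\big[setU/set0]_(i < N) E1 i) `|` (\big[setU/set0]_(i < N) E2 i)))).
  apply: le_measure; rewrite ?inE.
  - exact: measurableX.
  - by apply: measurableU; exact: bigsetU_measurable.
  move=> [w w'] /= [lew [i0 gtw']].
  have [i1 h1] := exists_first_max (D1^~ (w, w')) i0.
  have [i' h'] := exists_first_max (D^~ w') i0.
  have [hx|hx] := leP x (D1' i1 (w, w')).
    by left; rewrite (bigD1 i1)//=; left.
  have [hy|hy] := leP x (- D i' w).
    by right; rewrite (bigD1 i')//=; left.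
  (* Here [i1] maximizes the rotated vector and [i'] the second copy. If [D1'] is below [x] at [i1]
     and [D i' w] is above [- x], then [D i1 w] exceeds [r2 * (r2 * (eta - x) - x)], which is at
     least [s]: a contradiction. *)
  exfalso.
  have a1 := first_max_ge h1 i'.
  have a2 := first_max_ge h' i0.
  have a3 := lew i1.
  have a4 : D i1 w = r2 * (D1 i1 (w, w') - D1' i1 (w, w')).
    rewrite /D1 /D1' /=; transitivity (r2 ^+ 2 * 2 * D i1 w); last by ring.
    by rewrite r2_sqr; field.
  have a5 : r2 * (D i' w + D i' w') <= D1 i1 (w, w') by [].
  have r21 : r2 <= 1.
    by rewrite -(@ler_pXn2r _ 2)// ?nnegrE ?ltW// r2_sqr expr1n; lra.
  have a6 : r2 * (r2 * (D i' w + D i' w') - D1' i1 (w, w')) <= s.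
    by apply: le_trans a3; rewrite a4 ler_pM2l// lerD2r.
  have a7 : r2 * (- x + eta) < D1' i1 (w, w') + r2 * (D i' w' + D i' w) - D1' i1 (w, w').
    by rewrite addrAC subrr add0r ltr_pM2l//; lra.
  have a8 : r2 * (r2 * (eta - x) - x) < s.
    apply: lt_le_trans a6; rewrite ltr_pM2l// ltrD//.
      by rewrite ltr_pM2l//; lra.
    by rewrite ltrN2.
  have a9 : r2 * (r2 * (eta - x) - x) = 2^-1 * (eta - x) - 2^-1 * ((eta - 2 * s) / 2).
    rewrite /x; transitivity (r2 ^+ 2 * (eta - r2 * ((eta - 2 * s) / 2)) - r2 ^+ 2 * ((eta - 2 * s) / 2)).
      by ring.
    by rewrite r2_sqr.
  have a10 : x <= (eta - 2 * s) / 2 by rewrite /x ler_piMl// divr_ge0// subr_ge0.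
  by move: a8; rewrite a9; lra.
apply: (le_trans (measureU2 _ _ _)); try by apply: bigsetU_measurable => i _.
rewrite mulr_natl mulr2n EFinD; apply: leeD.
- apply: (le_trans (measure_bigsetU_le P2 _ mE1)).
  rewrite (eq_bigr (fun i => (P [set w | first_max (D^~ w) i] * P [set w | (x <= D i w)%R])%E)).
    apply: sum_first_max; first exact: expR_ge0.
    by move=> i; rewrite tE; exact: (ge_tail (Qs i) s20 x0).1.
  by move=> i _; exact: rotation.
- apply: (le_trans (measure_bigsetU_le P2 _ mE2)).
  rewrite (eq_bigr (fun i => (P [set w | first_max (D^~ w) i] * P [set w | (x <= - D i w)%R])%E)).
    apply: sum_first_max; first exact: expR_ge0.
    by move=> i; rewrite tE; exact: (ge_tail (Qs i) s20 x0).2.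
  by move=> i _; rewrite muleC -product_measure1E.
Qed.

End concentration.

(** * Paths on the unit interval *)

Section unit_interval.
Context (R : realType).

Lemma time_itv (t : I01 R) : 0 <= time t <= 1.
Proof. by have := valP t; rewrite inE /= in_itv. Qed.

Lemma clamp_subproof (x : R) : Num.max 0 (Num.min x 1) \in [set` `[0, 1 : R]%R].
Proof. by rewrite inE /= in_itv /= le_max lexx/= ge_max ler01 ge_min lexx orbT. Qed.

(** A retraction of the line onto the unit interval, through which compactness, grids and rational
    times are transported. *)
Definition clamp (x : R) : I01 R := SigSub (clamp_subproof x).

Lemma time_clamp x : 0 <= x <= 1 -> time (clamp x) = x.
Proof. by move=> /andP[x0 x1]; rewrite /time /= min_l// max_r. Qed.

Lemma time_inj : injective (@time R).
Proof. exact: val_inj. Qed.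

Lemma timeK (t : I01 R) : clamp (time t) = t.
Proof. by apply: time_inj; rewrite time_clamp// time_itv. Qed.

Lemma clamp_dist (x : R) (t : I01 R) : `|time (clamp x) - time t| <= `|x - time t|.
Proof.
have /andP[t0 t1] := time_itv t; rewrite [time (clamp x)]/time /=.
have [x1|x1] := leP x 1.
  have [x0|x0] := leP 0 x; first by [].
  by rewrite sub0r normrN ger0_norm// ltr0_norm ?subr_lt0 ?(lt_le_trans x0)//; lra.
by rewrite max_r// ger0_norm ?subr_ge0// ger0_norm; lra.
Qed.

Lemma I01_continuousP (f : I01 R -> R) : continuous f <->
  forall t e, 0 < e -> exists2 r, 0 < r &
    forall s, `|time t - time s| < r -> `|f t - f s| < e.
Proof.
split=> [cf t e e0|H t].
  have /nbhs_ballP[r /= r0 h] :=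
    (@cvgrPdist_lt _ _ _ _ (nbhs_filter t) f (f t)).1 (cf t) _ e0.
  by exists r => // s st; exact: h.
apply: (@cvgrPdist_lt _ _ _ _ (nbhs_filter t) f (f t)).2 => e e0.
have [r r0 h] := H t e e0.
by apply/nbhs_ballP; exists r => // s st; exact: h.
Qed.

Lemma continuous_time : continuous (@time R).
Proof. by apply/I01_continuousP => t e e0; exists e. Qed.

Lemma continuous_clamp : continuous clamp.
Proof.
move=> x; apply/cvg_ballP => e e0; apply/nbhs_ballP; exists e => // y yx.
have {}yx : `|x - y| < e by [].
change (`|time (clamp x) - time (clamp y)| < e).
apply: le_lt_trans yx; rewrite /time/=.
have h (a b c : R) : `|Num.min a c - Num.min b c| <= `|a - b|.
  wlog ab : a b / a <= b.
    by move=> H; have [/H//|/ltW/H] := leP a b; rewrite distrC [leRHS]distrC.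
  rewrite distrC [leRHS]distrC [leRHS]ger0_norm ?subr_ge0//.
  by case: (leP a c); case: (leP b c) => bc ac; rewrite ger0_norm; lra.
have h' (a b c : R) : `|Num.max c a - Num.max c b| <= `|a - b|.
  wlog ab : a b / a <= b.
    by move=> H; have [/H//|/ltW/H] := leP a b; rewrite distrC [leRHS]distrC.
  rewrite distrC [leRHS]distrC [leRHS]ger0_norm ?subr_ge0//.
  by case: (leP c a); case: (leP c b) => bc ac; rewrite ger0_norm; lra.
exact: le_trans (h' _ _ _) (h _ _ _).
Qed.

Lemma compact_I01 : compact [set: I01 R].
Proof.
have -> : [set: I01 R] = clamp @` `[0, 1]%classic.
  apply/seteqP; split => // t _; exists (time t); last exact: timeK.
  by rewrite /= in_itv/=; exact: time_itv.
apply: continuous_compact; last exact: segment_compact.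
exact/continuous_subspaceT/continuous_clamp.
Qed.

(** Near-covering compactness yields one radius for all points; half of each local radius is kept
    for the displacement of the centre. *)
Lemma compact_uniform_continuity (X : pseudoMetricType R) (f : X -> R) :
  compact [set: X] -> continuous f -> forall e : R, 0 < e ->
  exists2 r, 0 < r & forall x y, ball x r y -> `|f x - f y| <= e.
Proof.
move=> /compact_near_coveringP cX cf e e0.
have e2 : 0 < e / 2 by rewrite divr_gt0.
have key : \forall r \near 0^'+, forall x, [set: X] x ->
    forall y, ball x r y -> `|f x - f y| <= e.
  apply: (cX R 0^'+ (fun r x => forall y, ball x r y -> `|f x - f y| <= e)).
  move=> x _; have /nbhs_ballP[r /= r0 h] :=
    (@cvgrPdist_lt _ _ _ _ (nbhs_filter x) f (f x)).1 (cf x) _ e2.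
  exists (ball x (r / 2), [set s | 0 < s < r / 2]); first split => /=.
  - by apply: nbhsx_ballx; rewrite divr_gt0.
  - near=> s; rewrite /=; apply/andP; split; near: s.
      exact: nbhs_right_gt.
    by apply: nbhs_right_lt; rewrite divr_gt0.
  move=> [z s] /= [xz /andP[s0 sr]] y zy.
  have xz' : ball x r z by apply: le_ball xz; lra.
  have xy : ball x r y.
    rewrite [r]splitr; apply: ball_triangle xz _.
    by apply: le_ball zy; exact: ltW.
  rewrite [e]splitr (le_trans (ler_distD (f x) _ _))// lerD//.
    by rewrite distrC ltW// h.
  by rewrite ltW// h.
near (0 : R)^'+ => r; exists r; first by near: r; exact: nbhs_right_gt.
by move=> x; exact: (near key r).
Unshelve. all: by end_near. Qed.

End unit_interval.

Section path_space.
Context (R : realType).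
Local Notation C := (C01 R).

Lemma C01_ballE (g h : C) (e : R) :
  ball g e h = (forall t, `|path_fun g t - path_fun h t| < e) :> Prop.
Proof. by []. Qed.

Lemma continuous_path_fun (g : C) : continuous (path_fun g).
Proof. by move=> t; exact: (@cts_fun _ _ g t). Qed.

(** Strict in time and nonstrict in value: the set is closed, and it can be tested at rational
    times. *)
Definition mod_set (r e : R) : set C :=
  [set g | forall s t, `|time s - time t| < r -> `|path_fun g s - path_fun g t| <= e].

Lemma mod_set_exists (g : C) (e : R) : 0 < e -> exists2 r, 0 < r & mod_set r e g.
Proof.
move=> e0.
have [r r0 H] := compact_uniform_continuity (@compact_I01 R) (@continuous_path_fun g) e0.
by exists r => // s t; exact: H.
Qed.

Definition grid (N : nat) (i : 'I_N.+1) : I01 R := clamp (i%:R / N%:R).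

Lemma grid_near (N : nat) (r : R) (t : I01 R) : N%:R^-1 < r -> (0 < N)%N ->
  exists i : 'I_N.+1, `|time t - time (grid i)| < r.
Proof.
move=> Nr N0; have /andP[t0 t1] := time_itv t.
have N0' : (0 : R) < N%:R by rewrite ltr0n.
pose k := Num.truncn (time t * N%:R).
have kE : k%:R <= time t * N%:R < k.+1%:R.
  by apply: truncn_itv; rewrite mulr_ge0.
have kN : (k < N.+1)%N.
  rewrite ltnS -(ler_nat R); have /andP[h _] := kE; apply: le_trans h _.
  by rewrite ler_piMl.
exists (Ordinal kN); rewrite /grid/= time_clamp; last first.
  apply/andP; split; first by rewrite divr_ge0.
  by rewrite ler_pdivrMr// mul1r ler_nat -ltnS.
apply: le_lt_trans Nr; have /andP[h1 h2] := kE.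
rewrite ger0_norm; last by rewrite subr_ge0 ler_pdivrMr.
rewrite lerBlDr -[X in _ <= X + _]div1r -mulrDl ler_pdivlMr//.
by rewrite addrC natr1 ltW.
Qed.

(** Arzela-Ascoli for ultrafilters. Compactness of segments gives a pointwise limit at each time;
    the common moduli pass to this limit, and they upgrade convergence on a finite grid to uniform
    convergence. *)
Lemma ultra_cvg_path (F : set_system C) : UltraFilter F ->
  (forall e : R, 0 < e -> exists2 r : R, 0 < r & F (mod_set r e)) ->
  (forall t, exists M : R, F [set g | `|path_fun g t| <= M]) ->
  exists g : C, F --> g.
Proof.
move=> UF Fmod Fbnd.
have evcvg t : exists l : R, (fun g : C => path_fun g t) @ F --> l.
  have [M FM] := Fbnd t.
  have [l [_ cl]] : `[- M, M]%classic `&` cluster ((fun g : C => path_fun g t) @ F) !=set0.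
    apply: (@segment_compact R (- M) M).
    rewrite nbhs_filterE /fmap/=.
    by apply: filterS FM => g; rewrite /= in_itv/= ler_norml.
  exists l => A nA.
  have [//|FcA] := in_ultra_setVsetC ((fun g : C => path_fun g t) @^-1` A) UF.
  have [z [/= zA zA']] := cl (~` A) A FcA nA.
  by [].
pose g0 t := projT1 (cid (evcvg t)).
have g0E t : (fun g : C => path_fun g t) @ F --> g0 t := projT2 (cid (evcvg t)).
have near0 t e : 0 < e -> F [set g : C | `|path_fun g t - g0 t| < e].
  move=> e0; have /cvgrPdist_lt /(_ _ e0) := g0E t.
  by apply: filterS => g /=; rewrite distrC.
have g0mod r e : F (mod_set r e) ->
    forall s t, `|time s - time t| < r -> `|g0 s - g0 t| <= e.
  move=> Fr s t st; apply/ler_addgt0Pr => e' e'0.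
  have e'2 : 0 < e' / 2 by rewrite divr_gt0.
  have [g [[/= gs gt] gr]] := filter_ex (filterI (filterI (near0 s _ e'2) (near0 t _ e'2)) Fr).
  have gst := gr s t st.
  have -> : g0 s - g0 t = (path_fun g s - path_fun g t)
     - (path_fun g s - g0 s) + (path_fun g t - g0 t) by ring.
  rewrite (le_trans (ler_normD _ _))// [X in e + X]splitr addrA lerD//; last exact: ltW.
  by rewrite (le_trans (ler_normB _ _))// lerD// ltW.
have cg0 : continuous g0.
  apply/I01_continuousP => t e e0; have e2 : 0 < e / 2 by rewrite divr_gt0.
  have [r r0 Fr] := Fmod _ e2; exists r => // s /(g0mod _ _ Fr) h.
  by apply: le_lt_trans h _; lra.
pose G : C := mkcts cg0.
exists G; apply/fcvg_ballP => e e0.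
have e4 : 0 < e / 4 by rewrite divr_gt0.
have [r r0 Fr] := Fmod _ e4.
have [N N0 Nr] : exists2 N : nat, (0 < N)%N & N%:R^-1 < r.
  exists (Num.truncn r^-1).+1 => //; rewrite invf_plt ?posrE ?ltr0n//.
  exact: truncnS_gt.
have Fgrid : F [set g : C | forall i : 'I_N.+1, `|path_fun g (grid i) - g0 (grid i)| < e / 4].
  by apply: filter_forall => i; exact: near0.
apply: filterS (filterI Fr Fgrid) => g [gr ggrid].
rewrite /= C01_ballE => t.
have [i ti] := grid_near t Nr N0.
have a1 := gr _ _ ti; have a2 := ggrid i; have a3 := g0mod _ _ Fr _ _ ti.
have -> : path_fun G t - path_fun g t = (g0 t - g0 (grid i))
   - (path_fun g (grid i) - g0 (grid i)) - (path_fun g t - path_fun g (grid i)).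
  by change (path_fun G t) with (g0 t); ring.
rewrite (le_lt_trans (ler_normB _ _))//.
apply: (@le_lt_trans _ _ (e / 4 + e / 4 + e / 4)); last lra.
rewrite lerD// (le_trans (ler_normB _ _))// lerD//; exact: ltW.
Qed.

Lemma rat_near (x r : R) : 0 < r -> exists q : rat, `|ratr q - x| < r.
Proof.
move=> r0; have xx : x - r < x + r by lra.
have [q] := rat_in_itvoo xx; rewrite in_itv/= => /andP[a b].
by exists q; rewrite ltr_norml; apply/andP; split; lra.
Qed.

Definition rat_time (q : rat) : I01 R := clamp (ratr q).

Lemma rat_time_near (t : I01 R) (r : R) : 0 < r ->
  exists q, `|time t - time (rat_time q)| < r.
Proof.
move=> r0; have [q h] := rat_near (time t) r0; exists q.
by rewrite distrC; apply: le_lt_trans (clamp_dist _ _) h.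
Qed.

(** Continuity reduces the condition to rational times, and exchanging the two times removes the
    absolute value. What remains is a countable family of one-sided constraints, suited both to
    measurability and to one-sided maximal bounds. *)
Lemma mod_set_rat (r e : R) (g : C) : mod_set r e g <->
  forall p q, `|time (rat_time p) - time (rat_time q)| < r ->
    path_fun g (rat_time p) - path_fun g (rat_time q) <= e.
Proof.
split=> [H p q pq|H s t st]; first exact: le_trans (ler_norm _) (H _ _ pq).
wlog : s t st / path_fun g t <= path_fun g s.
  move=> W; have [|/ltW] := leP (path_fun g t) (path_fun g s); first exact: W.
  by rewrite distrC; apply: W; rewrite distrC.
move=> ts; rewrite ger0_norm ?subr_ge0//; apply/ler_addgt0Pr => e' e'0.
have e2 : 0 < e' / 2 by rewrite divr_gt0.
have cg := (I01_continuousP (path_fun g)).1 (@continuous_path_fun g).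
have [r1 r10 h1] := cg s _ e2; have [r2 r20 h2] := cg t _ e2.
pose r' := (r - `|time s - time t|) / 2.
have r'0 : 0 < r' by rewrite divr_gt0// subr_gt0.
have m1 : 0 < Num.min r1 r' by rewrite lt_min r10.
have m2 : 0 < Num.min r2 r' by rewrite lt_min r20.
have [p hp] := rat_time_near s m1; have [q hq] := rat_time_near t m2.
move: hp hq; rewrite !lt_min => /andP[p1 p2] /andP[q1 q2].
have pq : `|time (rat_time p) - time (rat_time q)| < r.
  have -> : time (rat_time p) - time (rat_time q) = (time s - time t)
     - (time s - time (rat_time p)) + (time t - time (rat_time q)) by ring.
  rewrite (le_lt_trans (ler_normD _ _))//.
  rewrite (le_lt_trans (lerD (ler_normB _ _) (lexx _)))//.
  have : r' + r' = r - `|time s - time t| by rewrite -splitr.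
  by lra.
have := H _ _ pq; have := h1 _ p1; have := h2 _ q1.
by rewrite !ltr_norml => /andP[? ?] /andP[? ?] ?; lra.
Qed.

(* The cells of all orders form a countable family of small sets from which
   every open set is a union. *)
Definition cell (km : nat * nat) (z : seq int) : set C :=
  mod_set km.2.+1%:R^-1 km.1.+1%:R^-1 `&`
  [set g | forall i : 'I_km.2.+3, Num.floor (km.1.+1%:R * path_fun g (grid i)) = nth 0 z i].

(** The 3 counts the oscillation of each path between [t] and a close grid point, plus the width of
    a rounding interval there. *)
Lemma cell_small km z (g h : C) : cell km z g -> cell km z h ->
  forall t, `|path_fun g t - path_fun h t| <= 3 / km.1.+1%:R.
Proof.
case: km => k m [gm gz] [hm hz] t /=; rewrite /= in gm hm gz hz.
have k0 : (0 : R) < k.+1%:R by rewrite ltr0n.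
(* With [m.+3] points the mesh is the inverse of [m + 2], strictly below the radius of the modulus,
   which is the inverse of [m + 1]. *)
have [i ti] : exists i : 'I_m.+3, `|time t - time (grid i)| < (m.+1%:R^-1 : R).
  by apply: grid_near => //; rewrite ltf_pV2 ?posrE ?ltr0n// ltr_nat.
have a1 := gm _ _ ti; have a2 := hm _ _ ti.
have a3 : `|path_fun g (grid i) - path_fun h (grid i)| <= k.+1%:R^-1.
  have /andP[g1 g2] := floor_itv (k.+1%:R * path_fun g (grid i)).
  have /andP[h1 h2] := floor_itv (k.+1%:R * path_fun h (grid i)).
  rewrite hz intrD mulr1z in h1 h2; rewrite gz intrD mulr1z in g1 g2.
  rewrite -(ler_pM2l k0) mulfV ?gt_eqF// -{1}(ger0_norm (ltW k0)) -normrM mulrBr.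
  have aux (A B Z : R) : Z <= A -> A < Z + 1 -> Z <= B -> B < Z + 1 -> `|A - B| <= 1.
    by move=> *; rewrite ler_norml; apply/andP; split; lra.
  exact: aux g1 g2 h1 h2.
have -> : path_fun g t - path_fun h t = (path_fun g t - path_fun g (grid i))
  + (path_fun g (grid i) - path_fun h (grid i)) - (path_fun h t - path_fun h (grid i)).
  by ring.
rewrite (le_trans (ler_normB _ _))//.
have -> : 3 / k.+1%:R = k.+1%:R^-1 + k.+1%:R^-1 + k.+1%:R^-1 :> R.
  by move: (k.+1%:R^-1) => x; ring.
by rewrite lerD// (le_trans (ler_normD _ _))// lerD.
Qed.

Lemma cell_cover (g : C) (e : R) : 0 < e ->
  exists km z, cell km z g /\ 3 / km.1.+1%:R < e.
Proof.
move=> e0; pose k := Num.truncn (3 / e).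
have k0 : (0 : R) < k.+1%:R by rewrite ltr0n.
have ke : 3 / k.+1%:R < e by rewrite ltr_pdivrMr// mulrC -ltr_pdivrMr// truncnS_gt.
have ki : 0 < k.+1%:R^-1 :> R by rewrite invr_gt0.
have [r r0 gr] := mod_set_exists g ki.
pose m := Num.truncn (r^-1).
have mr : m.+1%:R^-1 < r by rewrite invf_plt ?posrE ?ltr0n// truncnS_gt.
exists (k, m), [seq Num.floor (k.+1%:R * path_fun g (grid i)) | i : 'I_m.+3]; split => //; split.
  by move=> s t st; apply: gr; exact: lt_trans st mr.
move=> i /=; rewrite (nth_map i); last by rewrite size_enum_ord.
by rewrite nth_ord_enum.
Qed.

Lemma bigcap_rat_measurable d (T : measurableType d) (F : rat -> set T) :
  (forall q, measurable (F q)) -> measurable (\bigcap_q F q).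
Proof.
move=> mF; rewrite -[X in measurable X]setCK setC_bigcap; apply: measurableC.
by apply: bigcupT_measurable_rat => q; exact: measurableC.
Qed.

(** Preimages of cells are given by countably many conditions on coordinates, and an open set is the
    countable union of the cells it contains. *)
Lemma measurable_path d (T : measurableType d) (U : T -> C) :
  (forall t, measurable_fun setT (fun w => path_fun (U w) t)) ->
  measurable_fun setT (U : T -> borel C).
Proof.
move=> mU.
have mmod r e : measurable (U @^-1` mod_set r e).
  rewrite (_ : _ @^-1` _ = \bigcap_(p in [set: rat]) \bigcap_(q in [set: rat])
     [set w | `|time (rat_time p) - time (rat_time q)| < r ->
      path_fun (U w) (rat_time p) - path_fun (U w) (rat_time q) <= e]); last first.
    apply/seteqP; split => w.
      by move=> /mod_set_rat H p _ q _; exact: H.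
    by move=> H; apply/mod_set_rat => p q; exact: H.
  apply: bigcap_rat_measurable => p; apply: bigcap_rat_measurable => q.
  have [pq|pq] := ltP `|time (rat_time p) - time (rat_time q)| r; last first.
    rewrite (_ : [set _ | _] = setT)//; apply/seteqP; split => // w _ /= h.
  rewrite (_ : [set _ | _] = (fun w => path_fun (U w) (rat_time p)
      - path_fun (U w) (rat_time q)) @^-1` `]-oo, e]%classic); last first.
    by apply/seteqP; split => w /=; rewrite in_itv/=; [exact|move=> ? _].
  have mB : measurable_fun setT (fun w => path_fun (U w) (rat_time p)
      - path_fun (U w) (rat_time q)) by exact: measurable_funB.
  by rewrite -[X in measurable X]setTI; exact: mB.
have mcell km z : measurable (U @^-1` cell km z).
  rewrite /cell preimage_setI; apply: measurableI => //.
  rewrite (_ : _ @^-1` _ = \bigcap_(i in [set: 'I_km.2.+3])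
     ((fun w => km.1.+1%:R * path_fun (U w) (grid i))
       @^-1` `[(nth 0 z i)%:~R, (nth 0 z i + 1)%:~R[%classic)); last first.
    apply/seteqP; split => w /= H i.
      by move=> _ /=; rewrite -(H i) in_itv/= floor_itv.
    have := H i Logic.I; rewrite /= in_itv/= => h.
    exact: floor_def.
  apply: fin_bigcap_measurable => // i _.
  have mM : measurable_fun setT (fun w => km.1.+1%:R * path_fun (U w) (grid i)).
    exact: measurable_funM.
  by rewrite -[X in measurable X]setTI; exact: mM.
apply: (@measurability _ _ T (borel C) setT (U : T -> borel C) (@open C)) => //.
move=> _ [G oG <-]; rewrite setTI.
have -> : U @^-1` G = \bigcup_(kmz in [set x : nat * nat * seq int | cell x.1 x.2 `<=` G])
    (U @^-1` cell kmz.1 kmz.2).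
  apply/seteqP; split => w; last by move=> [kmz /= h]; exact: h.
  move=> /= Gw; have /nbhs_ballP[e /= e0 eG] := open_nbhs_nbhs (conj oG Gw).
  have [km [z [cz ze]]] := cell_cover (U w) e0.
  exists (km, z) => //= h ch; apply: eG; rewrite C01_ballE => t.
  by apply: le_lt_trans ze; exact: cell_small cz ch _.
rewrite bigcup_mkcond; apply: countable_bigcupT_measurable => [|kmz].
  exact: countableP.
by case: ifP.
Qed.

End path_space.

(** * Charges and the rate function *)

Lemma sub_eq_add (V : zmodType) (a b c d : V) : a - b = c - d -> a + d = c + b.
Proof. by move=> e; rewrite -[a](subrK b) e addrAC subrK. Qed.

Lemma ereal_linear_sub (R : realDomainType) (a : R) (p1 n1 p2 n2 : \bar R) :
  p1 \is a fin_num -> n1 \is a fin_num -> p2 \is a fin_num -> n2 \is a fin_num ->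
  (p1 - n1 + a%:E * (p2 - n2) = p1 + a%:E * p2 - (n1 + a%:E * n2))%E.
Proof.
move: p1 n1 p2 n2 => [p1||] [n1||] [p2||] [n2||]// _ _ _ _.
by congr EFin; ring.
Qed.

Section charge_integral_theory.
Context d (T : measurableType d) (R : realType).
Implicit Types nu : {charge set T -> \bar R}.

Lemma finite_bounded_integrable (mu : {finite_measure set T -> \bar R})
    (f : T -> R) (M : R) :
  measurable_fun setT f -> (forall x, `|f x| <= M) ->
  mu.-integrable setT (EFin \o f).
Proof.
move=> mf fM; apply: measurable_bounded_integrable => //.
  by rewrite ltey_eq fin_num_measure.
exists M; split; first exact: num_real.
by move=> x Mx w _; exact: le_trans (fM w) (ltW Mx).
Qed.

(** The integral does not depend on the decomposition: [p - n = m1 - m2] means that the measures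
    [p + m2] and [m1 + n] coincide, and integrals are additive in the measure. *)
Lemma charge_integral_sub nu (m1 m2 : {finite_measure set T -> \bar R})
    (f : T -> R) (M : R) :
  (forall A, measurable A -> nu A = (m1 A - m2 A)%E) ->
  measurable_fun setT f -> (forall x, `|f x| <= M) ->
  charge_integral nu f = (\int[m1]_x f x) - (\int[m2]_x f x).
Proof.
move=> nuE mf fM; rewrite /charge_integral.
set p := jordan_pos _; set n := jordan_neg _.
have ip := finite_bounded_integrable p mf fM.
have i_n := finite_bounded_integrable n mf fM.
have i1 := finite_bounded_integrable m1 mf fM.
have i2 := finite_bounded_integrable m2 mf fM.
have : (\int[measure_add p m2]_x (f x)%:E = \int[measure_add m1 n]_x (f x)%:E)%E.
  apply: eq_measure_integral => A mA _.
  rewrite /measure_add/= /msum !big_ord_recl/= !big_ord0 !adde0.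
  have := nuE A mA; rewrite (jordan_decomp (hahn_posneg nu) mA) /cadd /=.
  rewrite -/p -/n.
  have -> : (cscale (-1) n A = - n A)%E by rewrite /cscale EFinN mulN1e.
  have [fp fn] : p A \is a fin_num /\ n A \is a fin_num.
    by split; exact: fin_num_measure.
  have [f1 f2] : m1 A \is a fin_num /\ m2 A \is a fin_num.
    by split; exact: fin_num_measure.
  rewrite -(fineK fp) -(fineK fn) -(fineK f1) -(fineK f2) -!EFinB -!EFinD.
  by move=> [/sub_eq_add ->].
have fE (mu : {finite_measure set T -> \bar R}) : mu.-integrable setT (EFin \o f) ->
    (\int[mu]_x (f x)%:E = (\int[mu]_x f x)%:E)%E.
  by move=> imu; rewrite /Rintegral fineK//; exact: integrable_fin_num.
rewrite !integral_measure_add// !fE// -!EFinD => -[e].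
by rewrite -[LHS](addrK (\int[m2]_x f x)) [X in X - _]addrAC e addrK.
Qed.

Definition charge_mass nu : R :=
  fine (jordan_pos (hahn_posneg nu) setT) + fine (jordan_neg (hahn_posneg nu) setT).

Lemma charge_mass_ge0 nu : 0 <= charge_mass nu.
Proof. by rewrite addr_ge0// fine_ge0. Qed.

Lemma Rintegral_dist (mu : {finite_measure set T -> \bar R}) (f g : T -> R) (M e : R) :
  measurable_fun setT f -> measurable_fun setT g ->
  (forall x, `|f x| <= M) -> (forall x, `|g x| <= M) ->
  (forall x, `|f x - g x| <= e) ->
  `|\int[mu]_x f x - (\int[mu]_x g x)| <= e * fine (mu setT).
Proof.
move=> mf mg fM gM fg.
have jf := finite_bounded_integrable mu mf fM.
have jg := finite_bounded_integrable mu mg gM.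
have mfg : measurable_fun setT (fun x => f x - g x) by exact: measurable_funB.
have jfg := finite_bounded_integrable mu mfg fg.
rewrite -RintegralB// (le_trans (le_normr_Rintegral _ jfg))//.
have je : mu.-integrable setT (EFin \o cst e) by exact: finite_measure_integrable_cst.
rewrite -(@Rintegral_cst _ _ _ mu _ measurableT) le_Rintegral//.
apply: (@finite_bounded_integrable _ _ e); first exact: measurableT_comp.
by move=> x; rewrite normr_id.
Qed.

Lemma charge_integral_dist nu (f g : T -> R) (M e : R) :
  measurable_fun setT f -> measurable_fun setT g ->
  (forall x, `|f x| <= M) -> (forall x, `|g x| <= M) ->
  (forall x, `|f x - g x| <= e) ->
  `|charge_integral nu f - charge_integral nu g| <= e * charge_mass nu.
Proof.
move=> mf mg fM gM fg; rewrite /charge_integral.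
set p := jordan_pos _; set n := jordan_neg _.
have -> : \int[p]_x f x - (\int[n]_x f x) - (\int[p]_x g x - (\int[n]_x g x))
  = (\int[p]_x f x - (\int[p]_x g x)) - (\int[n]_x f x - (\int[n]_x g x)) by ring.
rewrite (le_trans (ler_normB _ _))// mulrDr lerD//.
  exact: (Rintegral_dist p mf mg fM gM fg).
exact: (Rintegral_dist n mf mg fM gM fg).
Qed.

Lemma Rintegral_mscale (b : {nonneg R}) (m : {finite_measure set T -> \bar R})
    (f : T -> R) (M : R) :
  measurable_fun setT f -> (forall x, `|f x| <= M) ->
  \int[mscale b m]_x f x = b%:num * (\int[m]_x f x).
Proof.
move=> mf fM.
have ib := finite_bounded_integrable (mscale b m) mf fM.
have i := finite_bounded_integrable m mf fM.
have cb : (mscale b m).-integrable setT (EFin \o (fun=> M)).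
  exact: finite_measure_integrable_cst.
have c : m.-integrable setT (EFin \o (fun=> M)) by exact: finite_measure_integrable_cst.
have H : \int[mscale b m]_x (f x + M) = b%:num * (\int[m]_x (f x + M)).
  have fM0 x : 0 <= f x + M.
    by have := fM x; rewrite ler_norml => /andP[? _]; lra.
  have mfM : measurable_fun setT (fun x => (f x + M)%:E).
    by apply/measurable_EFinP; exact: measurable_funD.
  have If : (\int[m]_x (f x + M)%:E)%E \is a fin_num.
    by apply: integrable_fin_num => //; exact: (integrableD measurableT i c).
  have g0 x : setT x -> (0 <= (f x + M)%:E)%E by rewrite lee_fin.
  by rewrite /Rintegral (ge0_integral_mscale m measurableT b mfM g0) -(fineK If) -EFinM.
have E1 := RintegralD measurableT ib cb; have E2 := RintegralD measurableT i c.
have := etrans (esym E1) (etrans H (congr1 _ E2)).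
have C1 : \int[mscale b m]_x M = M * (b%:num * fine (m setT)).
  by rewrite Rintegral_cst//= /mscale/= fineM// fin_num_measure.
by rewrite C1 Rintegral_cst// mulrDr [_ * (M * _)]mulrCA => /addIr.
Qed.

(** The combination is written as a difference of two finite measures; for negative [a] the Jordan
    parts of [nu2] exchange their roles. *)
Lemma charge_integralZD nu1 nu2 (a : R) (f : T -> R) (M : R) :
  measurable_fun setT f -> (forall x, `|f x| <= M) ->
  charge_integral (cadd nu1 (cscale a nu2)) f
  = charge_integral nu1 f + a * charge_integral nu2 f.
Proof.
move=> mf fM.
set p1 := jordan_pos (hahn_posneg nu1); set n1 := jordan_neg (hahn_posneg nu1).
set p2 := jordan_pos (hahn_posneg nu2); set n2 := jordan_neg (hahn_posneg nu2).
have na0 : 0 <= `|a| by [].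
pose b : {nonneg R} := NngNum na0.
have fE (m m' : {finite_measure set T -> \bar R}) : fin_num_fun (measure_add m (mscale b m')).
  move=> A mA; rewrite /measure_add/= /msum !big_ord_recl/= !big_ord0 !adde0.
  by rewrite fin_numD fin_numM// fin_num_measure.
pose ms (m m' : {finite_measure set T -> \bar R}) (k : nat) : {measure set T -> \bar R} :=
  if k is 0 then m else mscale b m'.
pose F (m m' : {finite_measure set T -> \bar R}) : {finite_measure set T -> \bar R} :=
  HB.pack (msum (ms m m') 2) (Measure_isFinite.Build _ _ _ (msum (ms m m') 2) (fE m m')).
have FE (m m' : {finite_measure set T -> \bar R}) :
    \int[F m m']_x f x = \int[m]_x f x + `|a| * (\int[m']_x f x).
  have i := finite_bounded_integrable m mf fM.
  have i' := finite_bounded_integrable m' mf fM.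
  have ims : (mscale b m').-integrable setT (EFin \o f).
    exact: (finite_bounded_integrable _ mf fM).
  rewrite -(Rintegral_mscale b m' mf fM) /Rintegral integral_measure_add//.
  by rewrite fineD ?integrable_fin_num.
have cs1 A : (cscale (-1) n1 A = - n1 A)%E by rewrite /cscale EFinN mulN1e.
have cs2 A : (cscale (-1) n2 A = - n2 A)%E by rewrite /cscale EFinN mulN1e.
have nuE A : measurable A -> [/\ nu1 A = (p1 A - n1 A)%E, nu2 A = (p2 A - n2 A)%E,
    p1 A \is a fin_num, n1 A \is a fin_num & p2 A \is a fin_num /\ n2 A \is a fin_num].
  move=> mA; split; try exact: fin_num_measure; last by split; exact: fin_num_measure.
  - by rewrite (jordan_decomp (hahn_posneg nu1) mA) /cadd/= -cs1.
  - by rewrite (jordan_decomp (hahn_posneg nu2) mA) /cadd/= -cs2.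
have FA (m m' : {finite_measure set T -> \bar R}) A : F m m' A = (m A + `|a|%:E * m' A)%E.
  by rewrite /= /measure_add/= /msum !big_ord_recl/= !big_ord0 !adde0.
have [a0|a0] := leP 0 a.
- rewrite (@charge_integral_sub _ (F p1 p2) (F n1 n2) _ _ _ mf fM).
    by rewrite !FE /charge_integral -/p1 -/n1 -/p2 -/n2 ger0_norm//; ring.
  move=> A mA; rewrite !FA /cadd /cscale/= ger0_norm//.
  have [E1 E2 f1 f2 [f3 f4]] := nuE A mA.
  rewrite [LHS](_ : _ = (nu1 A + a%:E * nu2 A)%E)// E1 E2.
  exact: ereal_linear_sub.
- rewrite (@charge_integral_sub _ (F p1 n2) (F n1 p2) _ _ _ mf fM).
    by rewrite !FE /charge_integral -/p1 -/n1 -/p2 -/n2 ltr0_norm//; ring.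
  move=> A mA; rewrite !FA /cadd /cscale/= ltr0_norm//.
  have [E1 E2 f1 f2 [f3 f4]] := nuE A mA.
  rewrite [LHS](_ : _ = (nu1 A + a%:E * nu2 A)%E)// E1 E2.
  by rewrite -(ereal_linear_sub (- a) f1 f2 f4 f3) EFinN mulNe -muleN fin_num_oppeB// [(- n2 A + _)%E]addeC.
Qed.

End charge_integral_theory.

Section continuous_on_I01.
Context (R : realType).

Lemma continuous_I01_measurable (f : I01 R -> R) :
  continuous f -> measurable_fun setT (f : borel (I01 R) -> R).
Proof.
move=> /continuousP cf; apply: (measurability _ (RGenOpens.measurableE R)).
move=> _ [_ [a [b ->] <-]]; rewrite setTI; apply: sub_sigma_algebra.
exact/cf/interval_open.
Qed.

Lemma compact_continuous_bounded (X : pseudoMetricType R) (f : X -> R) :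
  compact [set: X] -> continuous f -> exists2 M : R, 0 <= M & forall x, `|f x| <= M.
Proof.
move=> cX cf.
have cI : compact (f @` [set: X]).
  by apply: continuous_compact => //; exact: continuous_subspaceT.
have [M [_ HM]] := @compact_bounded R R^o _ cI.
exists (Num.max 0 (M + 1)); first by rewrite le_max lexx.
move=> x; rewrite le_max; apply/orP; right.
by apply: (HM (M + 1)); [rewrite ltrDl|exists x].
Qed.

Lemma compact_I01sq : compact [set: I01 R * I01 R].
Proof.
rewrite (_ : [set: _] = [set: I01 R] `*` [set: I01 R]); last first.
  by apply/seteqP; split.
by apply: compact_setX; exact: compact_I01.
Qed.

(** Half-open cells indexed up to [N] included: for positive [N], the last one contains only the
    time 1. *)
Definition time_cell (N : nat) (i : 'I_N.+1) : set (I01 R) :=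
  [set t | i%:R <= time t * N%:R < i.+1%:R].

Lemma measurable_time_cell N (i : 'I_N.+1) :
  measurable (time_cell i : set (borel (I01 R))).
Proof.
have mt : measurable_fun setT ((fun t => time t * N%:R) : borel (I01 R) -> R).
  by apply: measurable_funM => //; exact: continuous_I01_measurable (@continuous_time R).
rewrite -[X in measurable X]setTI.
rewrite (_ : time_cell i = (fun t => time t * N%:R) @^-1` `[i%:R, i.+1%:R[%classic).
  exact: mt.
by apply/seteqP; split => t /=; rewrite in_itv.
Qed.

Lemma sum_time_cell N (f : 'I_N.+1 -> R) (t : I01 R) (i : 'I_N.+1) :
  time_cell i t -> \sum_j f j * \1_(time_cell j) t = f i.
Proof.
move=> ti; rewrite (bigD1 i)//= indicE mem_set// mulr1 big1 ?addr0// => j ji.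
rewrite indicE memNset ?mulr0// => /= /andP[a b].
have /= /andP[a' b'] := ti.
have := le_lt_trans a b'; have := le_lt_trans a' b.
by rewrite !ltr_nat !ltnS => ij ji'; move: ji; rewrite -val_eqE/= eqn_leq ij ji'.
Qed.

Lemma time_cell_ex N (t : I01 R) : exists i : 'I_N.+1, time_cell i t.
Proof.
have /andP[t0 t1] := time_itv t.
have tN : 0 <= time t * N%:R by rewrite mulr_ge0.
have ltk : (Num.truncn (time t * N%:R) < N.+1)%N.
  rewrite ltnS -(ler_nat R) (@le_trans _ _ (time t * N%:R)) ?truncn_le//.
  by rewrite ler_piMl.
by exists (Ordinal ltk) => /=; rewrite /time_cell/=; exact: truncn_itv.
Qed.

Lemma time_cell_near N (i : 'I_N.+1) (t : I01 R) : (0 < N)%N -> time_cell i t ->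
  `|time t - time (grid R i)| <= N%:R^-1.
Proof.
move=> N0 /= /andP[a b]; have N0' : (0 : R) < N%:R by rewrite ltr0n.
rewrite /grid time_clamp; last first.
  rewrite divr_ge0//= ler_pdivrMr// mul1r ler_nat -ltnS.
  exact: ltn_ord.
rewrite ger0_norm ?subr_ge0 ?ler_pdivrMr//.
rewrite lerBlDr -(ler_pM2r N0') mulrDl mulVf ?gt_eqF// divfK ?gt_eqF//.
by rewrite -natr1 in b; lra.
Qed.

End continuous_on_I01.

Definition pair_list (R : realType) (J : Type) (l : seq (R * J)) (h : J -> R) : R :=
  \sum_(p <- l) p.1 * h p.2.

Definition mass_list (R : realType) (J : Type) (l : seq (R * J)) : R :=
  \sum_(p <- l) `|p.1|.

(** * Charges and finite lists of weighted times *)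

Section discretization.
Context (R : realType).
Local Notation I := (I01 R).
Implicit Types (l : seq (R * I)) (nu : signed_measure R) (h : I -> R).

Definition modulus h (r e : R) : Prop :=
  forall s t : I, `|time s - time t| < r -> `|h s - h t| <= e.

Lemma Rintegral_linear_comb (mu : {finite_measure set (borel I) -> \bar R})
    (K : Type) (s : seq K) (c : K -> R) (g : K -> I -> R) (M : K -> R) :
  (forall k, measurable_fun setT (g k : borel I -> R)) ->
  (forall k x, `|g k x| <= M k) ->
  mu.-integrable setT (EFin \o (fun x => \sum_(k <- s) c k * g k x)) /\
    \int[mu]_x (\sum_(k <- s) c k * g k x) = \sum_(k <- s) c k * (\int[mu]_x g k x).
Proof.
move=> mg gM; elim: s => [|k s [IH1 IH2]].
  split.
      apply: (@finite_bounded_integrable _ _ _ mu _ 0).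
        by under eq_fun do rewrite big_nil; exact: measurable_cst.
      by move=> x; rewrite big_nil normr0.
    by under eq_Rintegral do rewrite big_nil; rewrite big_nil Rintegral_cst// mul0r.
  have ig := finite_bounded_integrable mu (mg k) (gM k).
  have icg : mu.-integrable setT (EFin \o (fun x => c k * g k x)).
    exact: (integrableZl measurableT (c k) ig).
  split.
    rewrite (_ : _ \o _ = fun x => ((c k * g k x)%:E + (\sum_(j <- s) c j * g j x)%:E)%E).
      exact: (integrableD measurableT icg IH1).
    by apply/funext => x /=; rewrite big_cons.
  under eq_Rintegral do rewrite big_cons.
  by rewrite (RintegralD measurableT icg IH1) (RintegralZl (c k) measurableT ig) IH2 big_cons.
Qed.

Lemma charge_integral_sum nu (K : Type) (s : seq K) (c : K -> R) (g : K -> I -> R) (M : K -> R) :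
  (forall k, measurable_fun setT (g k : borel I -> R)) ->
  (forall k x, `|g k x| <= M k) ->
  charge_integral nu (fun x => \sum_(k <- s) c k * g k x)
  = \sum_(k <- s) c k * charge_integral nu (g k).
Proof.
move=> mg gM.
rewrite /charge_integral !(Rintegral_linear_comb _ _ _ mg gM).2 -sumrB.
by apply: eq_bigr => k _; rewrite mulrBr.
Qed.

(** [M] is the total variation of [nu]. It is fixed before the mesh, so that the error [M * e]
    vanishes with the oscillation [e]. *)
Lemma discretization nu : exists2 M : R, 0 <= M & forall r : R, 0 < r ->
  exists l, mass_list l <= M /\
  forall h e, continuous h -> modulus h r e ->
    `|pair_list l h - charge_integral nu h| <= M * e.
Proof.
exists (charge_mass nu); first exact: charge_mass_ge0.
move=> r r0; pose N := (Num.truncn r^-1).+1.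
have N0 : (0 < N)%N by [].
have N0' : (0 : R) < N%:R by rewrite ltr0n.
have Nr : N%:R^-1 < r by rewrite invf_plt ?posrE// truncnS_gt.
pose J (i : 'I_N.+1) : I -> R := \1_(time_cell i).
have mJ i : measurable_fun setT (J i : borel I -> R).
  exact: measurable_indic (measurable_time_cell i).
have J1 i x : `|J i x| <= 1.
  by rewrite /J indicE; case: (_ \in _); rewrite ?normr1 ?normr0.
(* The charge of each cell is lumped at the left endpoint of that cell. *)
exists [seq (charge_integral nu (J i), grid R i) | i <- index_enum 'I_N.+1]; split.
  rewrite /mass_list big_map.
  have mJE (mu : {finite_measure set (borel I) -> \bar R}) :
      \sum_i (\int[mu]_x J i x) = fine (mu setT).
    have := @Rintegral_cst _ _ _ mu _ measurableT 1; rewrite mul1r => <-.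
    transitivity (\int[mu]_x (\sum_i 1 * J i x)).
      rewrite (Rintegral_linear_comb mu (index_enum 'I_N.+1) (fun=> 1) mJ J1).2.
      by apply: eq_bigr => i _; rewrite mul1r.
    by apply: eq_Rintegral => x _; have [i] := time_cell_ex N x; exact: (@sum_time_cell _ _ (fun=> 1)).
  rewrite /charge_mass -!mJE -big_split; apply: ler_sum => i _ /=.
  rewrite (le_trans (ler_normB _ _))// ger0_norm ?ger0_norm//; apply: Rintegral_ge0 => x _;
    by rewrite /J indicE.
move=> h e ch hm.
have [M M0 hM] := compact_continuous_bounded (@compact_I01 R) ch.
pose g x := \sum_(i <- index_enum 'I_N.+1) h (grid R i) * J i x.
have gE (i : 'I_N.+1) x : time_cell i x -> g x = h (grid R i).
  exact: (sum_time_cell (fun i => h (grid R i))).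
rewrite distrC /pair_list big_map /=.
have -> : \sum_(i <- index_enum 'I_N.+1) charge_integral nu (J i) * h (grid R i)
    = charge_integral nu g.
  rewrite (@charge_integral_sum _ _ _ _ _ _ mJ J1).
  by apply: eq_bigr => i _; rewrite mulrC.
rewrite mulrC; apply: (@charge_integral_dist _ _ _ _ _ _ M).
- exact: continuous_I01_measurable.
- by apply: measurable_sum => i; apply: measurable_funM => //; exact: mJ.
- exact: hM.
- by move=> x; have [i xi] := time_cell_ex N x; rewrite (gE _ _ xi).
- move=> x; have [i xi] := time_cell_ex N x; rewrite (gE _ _ xi).
  by apply: hm; apply: le_lt_trans Nr; exact: time_cell_near.
Qed.

Lemma charge_of_list l : exists nu, forall h, continuous h ->
  charge_integral nu h = pair_list l h.
Proof.
have D (t : I) (h : I -> R) : continuous h ->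
  charge_integral (charge_of_finite_measure (\d_(t : borel I)) : signed_measure R) h = h t.
  move=> ch; have [M M0 hM] := compact_continuous_bounded (@compact_I01 R) ch.
  have mh := continuous_I01_measurable ch.
  have mhE : measurable_fun setT (EFin \o h : borel I -> \bar R) by exact/measurable_EFinP.
  rewrite (@charge_integral_sub _ _ _ _ (\d_(t : borel I)) mzero _ _ _ mh hM); last first.
    by move=> A mA; rewrite /mzero sube0.
  rewrite /Rintegral integral_measure_zero subr0 (integral_dirac _ measurableT mhE).
  by rewrite diracT mul1e.
elim: l => [|[c t] l [nu IH]].
  pose nu : signed_measure R := charge_of_finite_measure (mzero : {finite_measure set (borel I) -> \bar R}).
  exists nu => h ch.
  have [M M0 hM] := compact_continuous_bounded (@compact_I01 R) ch.
  have mh := continuous_I01_measurable ch.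
  rewrite (@charge_integral_sub _ _ _ _ mzero mzero _ _ _ mh hM).
    by rewrite subrr /pair_list big_nil.
  by move=> A mA; rewrite sube0.
exists (cadd nu (cscale c (charge_of_finite_measure (\d_(t : borel I))))) => h ch.
have [M M0 hM] := compact_continuous_bounded (@compact_I01 R) ch.
rewrite (charge_integralZD _ _ _ (continuous_I01_measurable ch) hM) D// IH//.
by rewrite /pair_list big_cons /= addrC.
Qed.

End discretization.

Lemma unif_cvgP (R : realType) (T : choiceType) (U : Type) (F : set_system U) (FF : Filter F) (f : U -> T -> R) (g : T -> R) :
  {uniform, f @ F --> g} <-> forall e : R, 0 < e -> \forall u \near F, forall t, `|g t - f u t| < e.
Proof.
split=> [H e e0|H].
  have /H : nbhs (g : {uniform T -> R}) [set h | forall t, `|g t - h t| < e].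
    apply/uniform_nbhs; exists [set p | `|p.1 - p.2| < e]; split.
      by rewrite -entourage_ballE; exists e.
    by move=> h hh t; exact: hh.
  done.
move=> A /uniform_nbhs[E [entE EA]].
have [e /= e0 eE] : exists2 e : R, 0 < e & [set p : R * R | `|p.1 - p.2| < e] `<=` E.
  by move: entE; rewrite -entourage_ballE => -[e e0 h]; exists e => // p; exact: h.
apply: filterS (H e e0) => u hu; apply: EA => t _; exact: (eE (g t, f u t) (hu t)).
Qed.

Lemma ler_addM_gt0 (R : realFieldType) (a b K : R) :
  (forall e, 0 < e -> a <= b + K * e) -> a <= b.
Proof.
move=> H; rewrite leNgt; apply/negP => ba.
have K0 : 0 < 1 + `|K| by rewrite ltr_pwDl.
have e0 : 0 < (a - b) / (2 * (1 + `|K|)) by rewrite divr_gt0 ?subr_gt0 ?mulr_gt0.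
have := H _ e0.
have : K * ((a - b) / (2 * (1 + `|K|))) <= (1 + `|K|) * ((a - b) / (2 * (1 + `|K|))).
  by rewrite ler_wpM2r ?(ltW e0)// (le_trans (ler_norm _))// lerDr.
have -> : (1 + `|K|) * ((a - b) / (2 * (1 + `|K|))) = (a - b) / 2.
  by field; rewrite gt_eqF.
lra.
Qed.

Section linear_functionals.
Context (R : realType) (J : Type).
Implicit Types (l : seq (R * J)) (h : J -> R) (q : J -> J -> R).

Definition scale_list (a : R) l := [seq (a * p.1, p.2) | p <- l].

Lemma pair_list_cat l l' h : pair_list (l ++ l') h = pair_list l h + pair_list l' h.
Proof. by rewrite /pair_list big_cat. Qed.

Lemma pair_list_scale a l h : pair_list (scale_list a l) h = a * pair_list l h.
Proof. by rewrite /pair_list big_map mulr_sumr; apply: eq_bigr => p _; rewrite mulrA. Qed.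

Lemma pair_listD l h g : pair_list l (fun t => h t + g t) = pair_list l h + pair_list l g.
Proof. by rewrite /pair_list -big_split; apply: eq_bigr => p _; rewrite mulrDr. Qed.

Lemma pair_listZ l a h : pair_list l (fun t => a * h t) = a * pair_list l h.
Proof. by rewrite /pair_list mulr_sumr; apply: eq_bigr => p _; rewrite mulrCA. Qed.

Lemma mass_list_ge0 l : 0 <= mass_list l.
Proof. exact: sumr_ge0. Qed.

Lemma pair_list_dist l h g (e : R) : (forall t, `|h t - g t| <= e) ->
  `|pair_list l h - pair_list l g| <= mass_list l * e.
Proof.
move=> hg; rewrite /pair_list -sumrB (le_trans (ler_norm_sum _ _ _))// /mass_list mulr_suml.
by apply: ler_sum => p _; rewrite -mulrBr normrM ler_wpM2l.
Qed.

Definition quad_list q l l' : R :=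
  pair_list l (fun s => pair_list l' (q s)).

Lemma pair_list_exchange (J' : Type) l (l' : seq (R * J')) (F : J -> J' -> R) :
  pair_list l (fun i => pair_list l' (F i)) = pair_list l' (fun j => pair_list l (F ^~ j)).
Proof.
rewrite /pair_list; under eq_bigr do rewrite mulr_sumr; rewrite exchange_big/=.
by apply: eq_bigr => p _; rewrite mulr_sumr; apply: eq_bigr => p' _; rewrite mulrCA.
Qed.

Lemma quad_listC q l l' : (forall s t, q s t = q t s) -> quad_list q l l' = quad_list q l' l.
Proof.
move=> q_sym; rewrite /quad_list pair_list_exchange; congr pair_list; apply/funext => s.
by congr pair_list; apply/funext => t.
Qed.

Lemma quad_list_combine q (x y : R) l l' : (forall s t, q s t = q t s) ->
  quad_list q (scale_list x l ++ scale_list y l') (scale_list x l ++ scale_list y l')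
  = x ^+ 2 * quad_list q l l + 2 * x * y * quad_list q l l' + y ^+ 2 * quad_list q l' l'.
Proof.
move=> q_sym.
have El m : quad_list q (scale_list x l ++ scale_list y l') m
    = x * quad_list q l m + y * quad_list q l' m.
  by rewrite /quad_list pair_list_cat !pair_list_scale.
have Er m : quad_list q m (scale_list x l ++ scale_list y l')
    = x * quad_list q m l + y * quad_list q m l'.
  by rewrite quad_listC// El !(quad_listC _ m).
by rewrite El !Er (@quad_listC _ l' l)//; ring.
Qed.

End linear_functionals.

Section bind_lists.
Context (R : realType) (J J' : Type) (f : J -> seq (R * J')).

(** Substitution of the combination [f j] for each generator [j], that is, the linear extension of
    [f]. Bilinear forms are pulled back along it. *)
Definition bind_list (l : seq (R * J)) := flatten [seq scale_list p.1 (f p.2) | p <- l].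

Lemma pair_list_bind l h : pair_list (bind_list l) h = pair_list l (fun j => pair_list (f j) h).
Proof.
rewrite /bind_list; elim: l => [|p l IH]; first by rewrite /pair_list !big_nil.
by rewrite /= pair_list_cat pair_list_scale IH [RHS]/pair_list big_cons.
Qed.

Lemma quad_list_bind (k : J' -> J' -> R) l l' : quad_list k (bind_list l) (bind_list l')
  = quad_list (fun i j => quad_list k (f i) (f j)) l l'.
Proof.
rewrite /quad_list pair_list_bind; congr pair_list; apply/funext => i.
rewrite pair_list_exchange pair_list_bind; congr pair_list; apply/funext => j.
by rewrite pair_list_exchange.
Qed.

End bind_lists.

Section modulus_of_continuity.
Context (R : realType).
Implicit Types (h : I01 R -> R).

Lemma modulus_ge0 h r e : 0 < r -> modulus h r e -> 0 <= e.
Proof. by move=> r0 /(_ (@zero01 R) (@zero01 R)); rewrite !subrr normr0; exact. Qed.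

Lemma modulus_le h r r' e : r' <= r -> modulus h r e -> modulus h r' e.
Proof. by move=> rr H s t st; apply: H; exact: lt_le_trans st rr. Qed.

Lemma modulus_continuous h : (forall e, 0 < e -> exists2 r, 0 < r & modulus h r e) ->
  continuous h.
Proof.
move=> H; apply/I01_continuousP => t e e0.
have e2 : 0 < e / 2 by rewrite divr_gt0.
have [r r0 hr] := H _ e2; exists r => // s ts.
by apply: le_lt_trans (hr _ _ ts) _; rewrite ltr_pdivrMr// mulr_natr mulr2n ltrDl.
Qed.

Lemma continuous_modulus h e : continuous h -> 0 < e -> exists2 r, 0 < r & modulus h r e.
Proof.
move=> ch e0.
have [r r0 H] := compact_uniform_continuity (@compact_I01 R) ch e0.
by exists r => // s t; exact: H.
Qed.

End modulus_of_continuity.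

(** * The bilinear form of a continuous positive kernel *)

Section kernel.
Context (R : realType) (q : I01 R -> I01 R -> R).
Local Notation I := (I01 R).
Hypothesis q_continuous : continuous (fun p : I * I => q p.1 p.2).
Hypothesis q_sym : forall s t, q s t = q t s.
Hypothesis q_psd : forall l, 0 <= quad_list q l l.
Implicit Types (l : seq (R * I)) (nu mu : signed_measure R) (h : I -> R).

Lemma kernel_modulus (e : R) : 0 < e -> exists2 r, 0 < r & forall s s' t t',
  `|time s - time s'| < r -> `|time t - time t'| < r -> `|q s t - q s' t'| <= e.
Proof.
move=> e0.
have [r r0 H] := compact_uniform_continuity (@compact_I01sq R) q_continuous e0.
by exists r => // s s' t t' ss tt; apply: (H (s, t) (s', t')).
Qed.

Lemma kernel_bounded : exists2 K : R, 0 < K & forall s t, `|q s t| <= K.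
Proof.
have [M M0 H] := compact_continuous_bounded (@compact_I01sq R) q_continuous.
by exists (M + 1) => [|s t]; [rewrite ltr_wpDl|rewrite (le_trans (H (s, t)))// lerDl].
Qed.

Lemma continuous_section s : continuous (q s).
Proof.
apply: modulus_continuous => e e0; have [r r0 H] := kernel_modulus e0.
by exists r => // t t' tt; apply: H => //; rewrite subrr normr0.
Qed.

Lemma kernel_path_modulus nu (r e : R) : 0 < r ->
  (forall s s' t t', `|time s - time s'| < r -> `|time t - time t'| < r ->
     `|q s t - q s' t'| <= e) ->
  modulus (kernel_path q nu) r (e * charge_mass nu).
Proof.
move=> r0 H s t st; rewrite /kernel_path.
have [K K0 hK] := kernel_bounded.
apply: (@charge_integral_dist _ _ _ _ _ _ K) => //.
- exact: continuous_I01_measurable (@continuous_section s).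
- exact: continuous_I01_measurable (@continuous_section t).
- by move=> x; apply: H => //; rewrite subrr normr0.
Qed.

Lemma continuous_kernel_path nu : continuous (kernel_path q nu).
Proof.
apply: modulus_continuous => e e0.
have m0 : 0 < charge_mass nu + 1 by rewrite ltr_wpDl// charge_mass_ge0.
have [r r0 H] := kernel_modulus (divr_gt0 e0 m0).
exists r => // s t st; apply: le_trans (kernel_path_modulus nu r0 H st) _.
by rewrite -mulrA ler_piMr ?(ltW e0)// mulrC ler_pdivrMr// mul1r lerDl.
Qed.

(** The inner product of the RKHS at the level of charges; on the diagonal it is [kernel_sqnorm] by
    unfolding. *)
Definition kernel_form nu mu : R := charge_integral nu (kernel_path q mu).

(** The same [K] bounds both masses and the error constant, which keeps the later estimates
    polynomial in [K]. *)
Definition discretizes (K r : R) nu l : Prop :=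
  [/\ mass_list l <= K, charge_mass nu <= K & forall h e, continuous h ->
     modulus h r e -> `|pair_list l h - charge_integral nu h| <= K * e].

Lemma discretizes_exists nu : exists2 K0 : R, 0 <= K0 & forall K r, K0 <= K -> 0 < r ->
  exists l, discretizes K r nu l.
Proof.
have [M M0 H] := discretization nu.
exists (M + charge_mass nu) => [|K r KK r0]; first by rewrite addr_ge0// charge_mass_ge0.
have m0 := charge_mass_ge0 nu.
have [l [lM lh]] := H _ r0; exists l; split; [lra|lra|move=> h e ch he].
apply: le_trans (lh _ _ ch he) _; rewrite ler_wpM2r//; last by lra.
exact: modulus_ge0 he.
Qed.

Section discretized.
Variables (K r e : R).
Hypotheses (r0 : 0 < r) (K0 : 0 <= K) (e0 : 0 <= e).
Hypothesis qr : forall s s' t t', `|time s - time s'| < r ->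
  `|time t - time t'| < r -> `|q s t - q s' t'| <= e.

Lemma discretized_path nu l : discretizes K r nu l ->
  forall t, `|pair_list l (q t) - kernel_path q nu t| <= K * e.
Proof.
move=> [_ _ H] t; apply: H; first exact: continuous_section.
by move=> s s' ss; apply: qr => //; rewrite subrr normr0.
Qed.

Lemma discretized_form nu mu l l' : discretizes K r nu l -> discretizes K r mu l' ->
  `|quad_list q l l' - kernel_form nu mu| <= 2 * K ^+ 2 * e.
Proof.
move=> dl dl'; have [lK _ H] := dl; have [_ mK _] := dl'.
have H1 := pair_list_dist l (discretized_path dl').
have H2 := H _ _ (@continuous_kernel_path mu) (kernel_path_modulus mu r0 qr).
have H3 : mass_list l * (K * e) <= K * (K * e) by rewrite ler_wpM2r// mulr_ge0.
have H4 : K * (e * charge_mass mu) <= K * (K * e).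
  by rewrite ler_wpM2l// mulrC ler_wpM2r.
rewrite /quad_list /kernel_form.
rewrite (le_trans (ler_distD (pair_list l (kernel_path q mu)) _ _))//.
have -> : 2 * K ^+ 2 * e = K * (K * e) + K * (K * e) by ring.
by rewrite lerD// ?(le_trans H1)// (le_trans H2).
Qed.

End discretized.

(** The order of quantifiers matters: [K] depends only on the charges and precedes the precision
    [e], so errors of order [K ^+ 2 * e] can be made arbitrarily small. *)
Lemma discretize_two nu mu : exists2 K : R, 0 < K & forall (e r : R), 0 < e -> 0 < r ->
  exists r' : R, [/\ 0 < r' <= r, (forall s s' t t', `|time s - time s'| < r' ->
    `|time t - time t'| < r' -> `|q s t - q s' t'| <= e) &
  exists l l', discretizes K r' nu l /\ discretizes K r' mu l'].
Proof.
have [K1 K10 H1] := discretizes_exists nu; have [K2 K20 H2] := discretizes_exists mu.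
exists (K1 + K2 + 1) => [|e r e0 r0]; first by lra.
have [r1 r10 hr] := kernel_modulus e0.
exists (Num.min r r1); split.
- by rewrite lt_min r0 r10 ge_min lexx.
- by move=> s s' t t'; rewrite !lt_min => /andP[_ ?] /andP[_ ?]; exact: hr.
have m0 : 0 < Num.min r r1 by rewrite lt_min r0.
have [l hl] := H1 (K1 + K2 + 1) _ ltac:(lra) m0.
have [l' hl'] := H2 (K1 + K2 + 1) _ ltac:(lra) m0.
by exists l, l'.
Qed.

(** Discretizing both charges reduces the exchange of integrals to an exchange of finite sums. *)
Lemma kernel_form_sym nu mu : kernel_form nu mu = kernel_form mu nu.
Proof.
have [K K0 H] := discretize_two nu mu.
apply/eqP; rewrite -subr_eq0 -normr_le0.
apply: (@ler_addM_gt0 _ _ _ (4 * K ^+ 2)) => e e0.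
have [r [/andP[r0 _] qr [l [l' [dl dl']]]]] := H e 1 e0 ltr01.
have := discretized_form r0 (ltW K0) (ltW e0) qr dl dl'.
have := discretized_form r0 (ltW K0) (ltW e0) qr dl' dl.
by rewrite (quad_listC l' l q_sym) add0r !ler_norml => /andP[a b] /andP[c f]; lra.
Qed.

Lemma kernel_form_psd nu mu (x y : R) :
  0 <= x ^+ 2 * kernel_form nu nu + 2 * x * y * kernel_form nu mu
       + y ^+ 2 * kernel_form mu mu.
Proof.
have [K K0 H] := discretize_two nu mu.
apply: (@ler_addM_gt0 _ _ _ ((x ^+ 2 + 2 * `|x * y| + y ^+ 2) * (2 * K ^+ 2))) => e e0.
have [r [/andP[r0 _] qr [l [l' [dl dl']]]]] := H e 1 e0 ltr01.
have := discretized_form r0 (ltW K0) (ltW e0) qr dl dl'.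
have := discretized_form r0 (ltW K0) (ltW e0) qr dl dl.
have := discretized_form r0 (ltW K0) (ltW e0) qr dl' dl'.
have := q_psd (scale_list x l ++ scale_list y l'); rewrite quad_list_combine//.
set A := kernel_form nu nu; set B := kernel_form nu mu; set C := kernel_form mu mu.
set a := quad_list q l l; set b := quad_list q l l'; set c := quad_list q l' l'.
set w := 2 * K ^+ 2 * e => P hc ha hb.
have h1 : x ^+ 2 * (a - A) <= x ^+ 2 * w.
  by rewrite ler_wpM2l ?sqr_ge0// (le_trans (ler_norm _)).
have h3 : y ^+ 2 * (c - C) <= y ^+ 2 * w.
  by rewrite ler_wpM2l ?sqr_ge0// (le_trans (ler_norm _)).
have h2 : x * y * (b - B) <= `|x * y| * w.
  by rewrite (le_trans (ler_norm _))// normrM ler_wpM2l.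
have -> : (x ^+ 2 + 2 * `|x * y| + y ^+ 2) * (2 * K ^+ 2) * e
  = x ^+ 2 * w + 2 * (`|x * y| * w) + y ^+ 2 * w by rewrite /w; ring.
move: P h1 h2 h3; move: (w) (A) (B) (C) (a) (b) (c); clear.
move=> w A B C a b c; rewrite !mulrBr (_ : 2 * x * y * b = 2 * (x * y * b)); last by ring.
rewrite (_ : 2 * x * y * B = 2 * (x * y * B)); last by ring.
move: (x ^+ 2 * a) (x ^+ 2 * A) (x * y * b) (x * y * B) (y ^+ 2 * c) (y ^+ 2 * C).
move: (x ^+ 2 * w) (y ^+ 2 * w) (`|x * y| * w); clear=> *; lra.
Qed.

Lemma charge_integralDZ nu (f g : I -> R) (a : R) : continuous f -> continuous g ->
  charge_integral nu (fun t => f t + a * g t)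
  = charge_integral nu f + a * charge_integral nu g.
Proof.
move=> cf cg.
have [M M0 hM] := compact_continuous_bounded (@compact_I01 R) cf.
have [N N0 hN] := compact_continuous_bounded (@compact_I01 R) cg.
pose F (b : bool) := if b then f else g.
have := @charge_integral_sum _ nu bool [:: true; false] (fun b => if b then 1 else a) F
  (fun b => if b then M else N).
rewrite !big_cons big_nil/= addr0 mul1r => <- //.
- congr charge_integral; apply/funext => t.
  by rewrite !big_cons big_nil/= addr0 mul1r.
- by case; exact: continuous_I01_measurable.
- by case=> x; [exact: hM|exact: hN].
Qed.

Lemma kernel_sqnorm_sub nu mu : kernel_sqnorm q (charge_sub nu mu)
  = kernel_form nu nu - 2 * kernel_form nu mu + kernel_form mu mu.
Proof.
rewrite /kernel_sqnorm.
have ZD m1 m2 f : continuous f -> charge_integral (charge_sub m1 m2 : signed_measure R) f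
    = charge_integral m1 f - charge_integral m2 f.
  move=> cf; have [M M0 hM] := compact_continuous_bounded (@compact_I01 R) cf.
  rewrite /charge_sub (charge_integralZD _ _ _ (continuous_I01_measurable cf) hM).
  by rewrite mulN1r.
have cn := @continuous_kernel_path nu; have cm := @continuous_kernel_path mu.
have E : kernel_path q (charge_sub nu mu)
    = (fun t => kernel_path q nu t + (-1) * kernel_path q mu t).
  apply/funext => t; rewrite {1}/kernel_path ZD; last exact: continuous_section.
  by rewrite mulN1r.
rewrite ZD; last exact: continuous_kernel_path.
rewrite E !charge_integralDZ//.
have := kernel_form_sym nu mu; rewrite /kernel_form => ->; ring.
Qed.

Lemma kernel_form_list l : exists nu, [/\ forall h, continuous h ->
     charge_integral nu h = pair_list l h,
   forall t, kernel_path q nu t = pair_list l (q t) &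
   kernel_form nu nu = quad_list q l l].
Proof.
have [nu H] := charge_of_list l; exists nu.
have E t : kernel_path q nu t = pair_list l (q t).
  by rewrite /kernel_path H//; exact: continuous_section.
split=> //; rewrite /kernel_form H; last exact: continuous_kernel_path.
by rewrite /quad_list; congr pair_list; apply/funext.
Qed.

(** With [l] seen as a charge [mu], this is the positivity of the form at [nu - mu]. *)
Lemma list_energy_le l nu :
  pair_list l (kernel_path q nu) - quad_list q l l / 2 <= kernel_form nu nu / 2.
Proof.
have [mu [H _ E]] := kernel_form_list l.
have := kernel_form_psd nu mu 1 (-1).
rewrite kernel_form_sym E {2}/kernel_form H; last exact: continuous_kernel_path.
by rewrite expr1n sqrrN expr1n; lra.
Qed.

Lemma charge_energy_le (h : I -> R) (a : R) nu : continuous h ->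
  (forall l, pair_list l h - quad_list q l l / 2 <= a) ->
  charge_integral nu h - kernel_form nu nu / 2 <= a.
Proof.
move=> ch H; have [K K0 D] := discretize_two nu nu.
apply: (@ler_addM_gt0 _ _ _ (K + K ^+ 2)) => e e0.
have [r r0 hr] := continuous_modulus ch e0.
have [r' [/andP[r'0 rr] qr [l [_ [dl _]]]]] := D e r e0 r0.
have := discretized_form r'0 (ltW K0) (ltW e0) qr dl dl.
have [_ _ /(_ _ _ ch (modulus_le rr hr))] := dl.
have := H l; rewrite !ler_norml mulrDl => h1 /andP[h2 h3] /andP[h4 h5]; lra.
Qed.

End kernel.

(** * The rate as a supremum over lists *)

Section rate_function.
Context (R : realType) (q : I01 R -> I01 R -> R).
Local Notation I := (I01 R).
Hypothesis q_continuous : continuous (fun p : I * I => q p.1 p.2).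
Hypothesis q_sym : forall s t, q s t = q t s.
Hypothesis q_psd : forall l, 0 <= quad_list q l l.
Hypothesis q_zero : q (zero01 R) (zero01 R) = 0.
Implicit Types (l : seq (R * I)) (nu mu : signed_measure R) (h : I -> R).

Let form_psd := kernel_form_psd q_continuous q_sym q_psd.

Lemma kernel_form_ge0 nu : 0 <= kernel_form q nu nu.
Proof. by have := form_psd nu nu 1 0; rewrite expr1n expr0n/=; lra. Qed.

(** Young's inequality for squared norms: the difference of the two sides is [eta^-1] times the
    squared norm of [nu - (1 + eta) * mu]. It controls norms without taking square roots. *)
Lemma kernel_form_perturb nu mu (eta : R) : 0 < eta ->
  kernel_form q nu nu <= (1 + eta) * kernel_form q mu mu
    + (1 + eta^-1) * kernel_sqnorm q (charge_sub nu mu).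
Proof.
move=> eta0; rewrite kernel_sqnorm_sub//.
have := form_psd nu mu 1 (- (1 + eta)).
set A := kernel_form q nu nu; set C := kernel_form q nu mu; set B := kernel_form q mu mu.
move=> H; rewrite -subr_ge0.
have -> : (1 + eta) * B + (1 + eta^-1) * (A - 2 * C + B) - A
   = eta^-1 * (1 ^+ 2 * A + 2 * 1 * - (1 + eta) * C + (- (1 + eta)) ^+ 2 * B).
  by field; rewrite gt_eqF.
by rewrite mulr_ge0// invr_ge0 ltW.
Qed.

Lemma rkhs_approx_sqnorm_cvg lambda h : rkhs_approx q lambda h ->
  exists r : R, (fun m => kernel_sqnorm q (lambda m)) @ \oo --> r.
Proof.
move=> [ca _]; pose N m := kernel_form q (lambda m) (lambda m).
have [N0 hN0] := ca 1 ltr01.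
(* [kernel_form_perturb] with [eta = 1] bounds the energies beyond [N0] by [2 * N N0 + 2]; one more
   unit makes [K] positive. *)
pose K := 2 * N N0 + 3.
have NK m : (N0 <= m)%N -> N m <= K - 1.
  move=> m0; have := kernel_form_perturb (lambda m) (lambda N0) ltr01.
  by have := hN0 _ _ m0 (leqnn _); rewrite /K /N invr1; lra.
have K0 : 0 < K.
  by have := kernel_form_ge0 (lambda N0); rewrite -/(N N0) /K; lra.
suff : cvg ((fun m => kernel_sqnorm q (lambda m)) @ \oo) by move=> /cvg_ex.
apply: cauchy_cvg; apply: cauchy_exP => e e0.
(* Half of [e] pays for [eta * N b], the other half for the Cauchy distance. *)
pose eta := e / (2 * K); have eta0 : 0 < eta by rewrite divr_gt0// mulr_gt0.
have eta1 : 0 < 1 + eta^-1 by rewrite addr_gt0// invr_gt0.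
have d0 : 0 < e / (2 * (1 + eta^-1)) by rewrite divr_gt0// mulr_gt0.
have [M hM] := ca _ d0.
exists (N (maxn N0 M)); exists (maxn N0 M) => // m /=.
rewrite geq_max => /andP[Nm Mm]; rewrite /= -ball_normE/=.
set p := maxn N0 M.
have Np : (N0 <= p)%N by exact: leq_maxl.
have Mp : (M <= p)%N by exact: leq_maxr.
have B (a b : nat) : (N0 <= a)%N -> (M <= a)%N -> (N0 <= b)%N -> (M <= b)%N -> N a - N b < e.
  move=> a1 a2 b1 b2.
  have := kernel_form_perturb (lambda a) (lambda b) eta0.
  have : (1 + eta^-1) * kernel_sqnorm q (charge_sub (lambda a) (lambda b)) < e / 2.
    rewrite mulrC -ltr_pdivlMr//; have := hM _ _ a2 b2.
    by rewrite invfM mulrA.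
  have : eta * N b <= e / 2.
    rewrite (@le_trans _ _ (eta * K))//.
      by rewrite ler_wpM2l ?ltW// (le_lt_trans (NK _ b1))// ltrBlDr ltrDl.
    by rewrite /eta invfM mulrA divfK// gt_eqF.
  rewrite -/(N a) -/(N b); lra.
by rewrite ltr_norml ltrNl opprB !B.
Qed.

(** [rkhs_sqnorm] selects a limit with [xget]. The set of limits is nonempty by
    [rkhs_approx_sqnorm_cvg], so the selected value comes from some approximating sequence, and the
    bounds below are established for that sequence. *)
Lemma gaussian_rate_approx (y : R) (h : C01 R) (a : R) :
  (gaussian_rate q y h <= a%:E)%E ->
  path_fun h (zero01 R) = y /\ exists lambda (r : R),
    [/\ rkhs_approx q lambda (fun t => path_fun h t - y),
        (fun m => kernel_sqnorm q (lambda m)) @ \oo --> r & r / 2 <= a].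
Proof.
rewrite /gaussian_rate; case: asboolP => // -[h0 [ch [la0 hla0]]].
rewrite lee_fin => ra; split=> //.
have [r0 hr0] := rkhs_approx_sqnorm_cvg hla0.
have [|la hla hr] := @xgetPex _ 0 [set r | exists2 lambda,
    rkhs_approx q lambda (fun t => path_fun h t - y) &
    (fun m => kernel_sqnorm q (lambda m)) @ \oo --> r].
  by exists r0; exists la0.
by exists la, (rkhs_sqnorm q (fun t => path_fun h t - y)); split=> //; rewrite mulrC.
Qed.

Lemma pair_list_uniform_cvg (h : nat -> I -> R) (g : I -> R) l :
  {uniform, h @ \oo --> g} -> (fun m => pair_list l (h m)) @ \oo --> pair_list l g.
Proof.
move=> /unif_cvgP H; apply/cvgrPdist_lt => e e0.
have m0 : 0 < mass_list l + 1 by rewrite ltr_wpDl// mass_list_ge0.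
apply: filterS (H _ (divr_gt0 e0 m0)) => m hm.
have := pair_list_dist l (fun t => ltW (hm t)).
move/le_lt_trans; apply; rewrite mulrCA.
by rewrite -[ltRHS]mulr1 ltr_pM2l// ltr_pdivrMr// mul1r ltrDl.
Qed.

Lemma gaussian_rate_list (y : R) (h : C01 R) (a : R) : (gaussian_rate q y h <= a%:E)%E ->
  forall l, pair_list l (fun t => path_fun h t - y) - quad_list q l l / 2 <= a.
Proof.
move=> /gaussian_rate_approx[h0 [la [r [[_ hla] hr ra]]]] l.
apply: le_trans ra.
have c1 : (fun m => pair_list l (kernel_path q (la m)) - quad_list q l l / 2) @ \oo -->
    pair_list l (fun t => path_fun h t - y) - quad_list q l l / 2.
  by apply: cvgB; [exact: pair_list_uniform_cvg|exact: cvg_cst].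
have c2 : (fun m => kernel_sqnorm q (la m) / 2) @ \oo --> r / 2.
  by apply: cvgM; [exact: hr|exact: cvg_cst].
by apply: (ler_cvg_to c1 c2); apply: nearW => m; exact: list_energy_le.
Qed.

(** Provides the tilts of the lower bound: a path of finite rate is uniformly close to the image of
    a list under the kernel, at almost no extra energy. *)
Lemma gaussian_rate_near (y : R) (h : C01 R) (a kappa : R) : 0 < kappa ->
  (gaussian_rate q y h <= a%:E)%E ->
  exists l, (forall t, `|path_fun h t - y - pair_list l (q t)| <= kappa) /\
    quad_list q l l / 2 <= a + kappa.
Proof.
move=> k0 /gaussian_rate_approx[h0 [la [r [[_ /unif_cvgP hla] hr ra]]]].
have k2 : 0 < kappa / 2 by rewrite divr_gt0.
have [m [hm nm]] : exists m, (forall t, `|path_fun h t - y - kernel_path q (la m) t| < kappa / 2)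
    /\ `|r - kernel_sqnorm q (la m)| < kappa.
  apply: (@filter_ex _ \oo); apply: filterI; first exact: hla.
  exact: (@cvgrPdist_lt _ _ _ _ _ _ _).1 hr _ k0.
have [K K0 D] := discretize_two q_continuous (la m) (la m).
have KK : 0 < K + K ^+ 2 by rewrite addr_gt0// exprn_gt0.
have e0 : 0 < kappa / (2 * (K + K ^+ 2)) by rewrite divr_gt0// mulr_gt0.
set e := kappa / _ in e0.
have eE : K * e + K ^+ 2 * e = kappa / 2.
  by rewrite -mulrDl /e; field; rewrite gt_eqF.
have Ke : 0 < K * e by rewrite mulr_gt0.
have KKe : 0 < K ^+ 2 * e by rewrite mulr_gt0// exprn_gt0.
have [r' [/andP[r0 _] qr [l [_ [dl _]]]]] := D e 1 e0 ltr01.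
exists l; split=> [t|].
  have := discretized_path q_continuous r0 qr dl t.
  have := hm t; rewrite distrC => h1 h2.
  rewrite distrC (le_trans (ler_distD (kernel_path q (la m) t) _ _))//; lra.
have := discretized_form q_continuous r0 (ltW K0) (ltW e0) qr dl dl.
move: nm; rewrite /kernel_sqnorm -/(kernel_form q (la m) (la m)) !ltr_norml ler_norml.
by rewrite -mulrA => /andP[? ?] /andP[? ?]; lra.
Qed.

Lemma charge_integral_uniform_cvg nu (h : nat -> I -> R) (g : I -> R) :
  (forall m, continuous (h m)) -> continuous g -> {uniform, h @ \oo --> g} ->
  (fun m => charge_integral nu (h m)) @ \oo --> charge_integral nu g.
Proof.
move=> ch cg /unif_cvgP H; apply/cvgrPdist_lt => e e0.
have m0 : 0 < charge_mass nu + 1 by rewrite ltr_wpDl// charge_mass_ge0.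
apply: filterS (H _ (divr_gt0 e0 m0)) => m hm.
have [M M0 hM] := compact_continuous_bounded (@compact_I01 R) (ch m).
have [N N0 hN] := compact_continuous_bounded (@compact_I01 R) cg.
have := @charge_integral_dist _ _ _ nu g (h m) (N + M) _
  (continuous_I01_measurable cg) (continuous_I01_measurable (ch m)).
move=> /(_ (e / (charge_mass nu + 1))) hd.
apply: (@le_lt_trans _ _ (e / (charge_mass nu + 1) * charge_mass nu)).
  by apply: hd => t; [rewrite (le_trans (hN t))// lerDl|rewrite (le_trans (hM t))// lerDr|exact: ltW].
rewrite mulrAC -mulrA.
by rewrite -[ltRHS]mulr1 ltr_pM2l// ltr_pdivrMr// mul1r ltrDl.
Qed.

(** The bound on lists extends to the charge [la M]. Uniform convergence replaces the integral of
    [h] by the inner product of [la M] with [la n], and the Cauchy property turns the result into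
    half the squared norm of [la n]. *)
Lemma list_bound_sqnorm (la : nat -> signed_measure R) (h : I -> R) (r a : R) :
  continuous h -> rkhs_approx q la h ->
  (fun m => kernel_sqnorm q (la m)) @ \oo --> r ->
  (forall l, pair_list l h - quad_list q l l / 2 <= a) -> r / 2 <= a.
Proof.
move=> ch [ca hla] hr H; apply: (@ler_addM_gt0 _ _ _ 2) => e e0.
have [M hM] := ca _ e0.
have cI := @charge_integral_uniform_cvg (la M) _ h
  (fun m => @continuous_kernel_path _ _ q_continuous (la m)) ch hla.
have [n [n1 [n2 n3]]] : exists n, `|charge_integral (la M) h
      - charge_integral (la M) (kernel_path q (la n))| < e /\
    `|r - kernel_sqnorm q (la n)| < e /\ (M <= n)%N.
  apply: (@filter_ex _ \oo); apply: filterI.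
    exact: (@cvgrPdist_lt _ _ _ _ _ _ _).1 cI _ e0.
  apply: filterI; first exact: (@cvgrPdist_lt _ _ _ _ _ _ _).1 hr _ e0.
  by exists M.
have := hM _ _ (leqnn _) n3; rewrite kernel_sqnorm_sub//.
have := charge_energy_le q_continuous (la M) ch H.
move: n1 n2; rewrite -/(kernel_form q (la M) (la n)) /kernel_sqnorm -/(kernel_form q (la n) (la n)).
move: (charge_integral (la M) h) (kernel_form q (la M) (la n)) (kernel_form q (la n) (la n)).
move: (kernel_form q (la M) (la M)) e0; clear.
move=> A e0 B C D; rewrite ltr_norml => /andP[? ?]; rewrite ltr_norml => /andP[? ?] ? ?.
by lra.
Qed.

Lemma list_rate_le (y : R) (h : C01 R) (a : R) :
  (forall l, pair_list l (fun t => path_fun h t - y) - quad_list q l l / 2 <= a) ->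
  (gaussian_rate q y h <= a%:E)%E.
Proof.
set g := fun t : I => path_fun h t - y; move=> H.
have cg : continuous g.
  apply/I01_continuousP => t e e0.
  have [s s0 hs] := (I01_continuousP _).1 (@continuous_path_fun _ h) t e e0.
  by exists s => // u /hs; rewrite /g opprB addrA subrK.
pose Phi l := pair_list l g - quad_list q l l / 2.
have S_sup : has_sup (range Phi).
  split; first by exists (Phi [::]); exists [::].
  by exists a => _ [l _ <-]; exact: H.
pose S := sup (range Phi).
have PhiS l : Phi l <= S by apply: ub_le_sup; [exact: S_sup.2|exists l].
have Sa : S <= a by apply: ge_sup; [exact: S_sup.1|move=> _ [l _ <-]; exact: H].
(* A weight at time 0 has no energy because of [q_zero]; arbitrarily large weights of either sign
   there would make the supremum infinite unless [g] vanishes. *)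
have g0 : g (zero01 R) = 0.
  have gS c : c * g (zero01 R) <= S.
    have := PhiS [:: (c, zero01 R)].
    by rewrite /Phi /quad_list /pair_list !big_seq1/= q_zero !mulr0 mul0r subr0.
  apply/eqP; rewrite -normr_le0; apply: (@ler_addM_gt0 _ _ _ S) => e e0.
  have := gS (e^-1 * Num.sg (g (zero01 R))); rewrite -mulrA -normrEsg.
  by rewrite mulrC ler_pdivrMr// add0r.
have /choice[L hL] : forall m : nat, exists l, S - m.+1%:R^-1 < Phi l.
  move=> m; have m0 : (0 : R) < m.+1%:R^-1 by rewrite invr_gt0.
  by have [_ [l _ <-] hl] := sup_adherent m0 S_sup; exists l.
(* Parallelogram argument: the midpoint of two almost maximizing lists cannot exceed [S], so their
   distance in energy is controlled by their defects. *)
have quadB m p : quad_list q (L m) (L m) - 2 * quad_list q (L m) (L p)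
    + quad_list q (L p) (L p) <= 4 * (m.+1%:R^-1 + p.+1%:R^-1).
  have := PhiS (scale_list (1 / 2) (L m) ++ scale_list (1 / 2) (L p)).
  have := hL m; have := hL p.
  rewrite /Phi quad_list_combine// pair_list_cat !pair_list_scale.
  rewrite (_ : (1 / 2) ^+ 2 = 1 / 4 :> R); last by field.
  move: m.+1%:R^-1 p.+1%:R^-1 (pair_list (L m) g) (pair_list (L p) g) => d d'.
  move: (quad_list q (L m) (L m)) (quad_list q (L m) (L p)) (quad_list q (L p) (L p)).
  move: (S); clear.
  move=> s A B C u v; lra.
have [K K0 hK] := kernel_bounded q_continuous.
(* First-order condition at an almost maximizer: a weight [c] added at [t] gains [c] times the
   discrepancy and costs at most [c ^+ 2 * K / 2]. The choice of [kappa / K] or its opposite for [c]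
   gives a bound uniform in [t]. *)
have path m t (kappa : R) : 0 < kappa -> m.+1%:R^-1 <= kappa ^+ 2 / (2 * K) ->
    `|g t - pair_list (L m) (q t)| <= kappa.
  move=> k0 mk; have PS c : c * (g t - pair_list (L m) (q t)) <= kappa ^+ 2 / (2 * K) + c ^+ 2 * K / 2.
    have := PhiS (scale_list 1 (L m) ++ scale_list c [:: (1, t)]).
    rewrite /Phi quad_list_combine// pair_list_cat !pair_list_scale (@quad_listC _ _ _ (L m) _ q_sym).
    have Eq l' : quad_list q [:: (1, t)] l' = pair_list l' (q t).
      by rewrite /quad_list {1}/pair_list big_seq1 mul1r.
    have Ep f : pair_list [:: (1, t)] f = f t by rewrite /pair_list big_seq1 mul1r.
    rewrite !Eq !Ep.
    have : c ^+ 2 * q t t <= c ^+ 2 * K.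
      by rewrite ler_wpM2l ?sqr_ge0// (le_trans (ler_norm _)).
    have := hL m; rewrite /Phi expr1n; set b := pair_list (L m) (q t).
    rewrite (_ : 2 * 1 * c * b = 2 * (c * b)); last by ring.
    move: mk; rewrite [c * (_ - b)]mulrBr !mul1r.
    move: m.+1%:R^-1 (kappa ^+ 2 / (2 * K)) (c ^+ 2 * K) (c ^+ 2 * q t t) (c * b) (c * g t).
    move: (pair_list _ _) (quad_list _ _ _) (S); clear=> *; lra.
  have main c : c ^+ 2 = (kappa / K) ^+ 2 -> c * (g t - pair_list (L m) (q t)) <= kappa / K * kappa.
    move=> cE; apply: le_trans (PS c) _; rewrite cE le_eqVlt; apply/orP; left; apply/eqP.
    by field; rewrite gt_eqF.
  have kK : 0 < kappa / K by rewrite divr_gt0.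
  rewrite ler_norml lerNl; apply/andP; split; rewrite -(ler_pM2l kK); last exact: main.
  by rewrite mulrN -mulNr main// sqrrN.
have /choice[la hla] : forall m, exists nu, [/\ forall f, continuous f ->
     charge_integral nu f = pair_list (L m) f,
   forall t, kernel_path q nu t = pair_list (L m) (q t) &
   kernel_form q nu nu = quad_list q (L m) (L m)].
  by move=> m; exact: kernel_form_list.
have approx : rkhs_approx q la g.
  split=> [e e0|].
    have [N hN] : exists N : nat, N.+1%:R^-1 < e / 8.
      have e8 : 0 < e / 8 by rewrite divr_gt0.
      exists (Num.truncn (e / 8)^-1); rewrite invf_plt ?posrE//; exact: truncnS_gt.
    exists N => m p Nm Np; rewrite kernel_sqnorm_sub//.
    have [Im _ ->] := hla m; have [_ Ip ->] := hla p.
    rewrite {1}/kernel_form Im; last exact: continuous_kernel_path.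
    rewrite (_ : kernel_path q (la p) = (fun t => pair_list (L p) (q t))); last exact/funext.
    apply: le_lt_trans (quadB m p) _.
    have inv (k : nat) : (N <= k)%N -> k.+1%:R^-1 <= N.+1%:R^-1 :> R.
      by move=> Nk; rewrite lef_pV2 ?posrE// ler_nat.
    move: hN (inv _ Nm) (inv _ Np); move: N.+1%:R^-1 m.+1%:R^-1 p.+1%:R^-1; clear.
    by move=> *; lra.
  apply/unif_cvgP => e e0.
  have k0 : 0 < e / 2 by rewrite divr_gt0.
  have b0 : 0 < (e / 2) ^+ 2 / (2 * K) by rewrite divr_gt0 ?exprn_gt0 ?mulr_gt0.
  exists (Num.truncn ((e / 2) ^+ 2 / (2 * K))^-1) => // m /= Nm t.
  have [_ -> _] := hla m.
  apply: (@le_lt_trans _ _ (e / 2)); last by lra.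
  apply: path => //; rewrite invf_ple ?posrE// ltW//.
  by rewrite (lt_le_trans (truncnS_gt _))// ler_nat ltnS.
rewrite /gaussian_rate; case: asboolP => [_|[]]; last first.
  by split; [apply/eqP; rewrite -subr_eq0; apply/eqP|split=> //; exists la].
rewrite lee_fin mulrC.
have [r0 hr0] := rkhs_approx_sqnorm_cvg approx.
have [|la' hla' hr] := @xgetPex _ 0 [set r | exists2 lambda, rkhs_approx q lambda g &
    (fun m => kernel_sqnorm q (lambda m)) @ \oo --> r].
  by exists r0; exists la.
exact: (list_bound_sqnorm cg hla' hr H).
Qed.

End rate_function.

(** * The conditioned Gaussian process *)

Section gaussian_lists.
Context d (T : measurableType d) (R : realType) (P : probability T R).
Variable X : R -> {RV P >-> R}.
Hypothesis X_gaussian : gaussian_process X.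
Hypothesis X_centered : centered_process X.
Implicit Types l : seq (R * R).

Let nonneg_times l := {in l, forall p, 0 <= p.2}.

Lemma integrableM_centered_normal (Y Z : T -> R) (v v' : R) :
  centered_normal P Y v -> centered_normal P Z v' ->
  P.-integrable setT (EFin \o (fun w => Y w * Z w)).
Proof.
move=> nY nZ; have [mY _ _] := nY; have [mZ _ _] := nZ.
have i := integrableD measurableT (integrable_centered_normal_sqr nY)
  (integrable_centered_normal_sqr nZ).
apply: (@dominated_integrable _ _ _ P _ (fun w => Y w ^+ 2 + Z w ^+ 2)).
- exact: measurable_funM.
- exact: i.
- move=> w; have := sqr_ge0 (Y w - Z w); have := sqr_ge0 (Y w + Z w).
  by rewrite ler_norml !sqrrD !sqrrN mulrN mulNrn; nra.
Qed.

Lemma gaussian_list_law l : nonneg_times l ->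
  (\int[P]_w (pair_list l (X ^~ w))%:E = 0)%E ->
  exists v, centered_normal P (fun w => pair_list l (X ^~ w)) v.
Proof.
move=> l0 El; have [|m [s law]] := @X_gaussian (size l) (fun i => (nth (0, 0) l i).2)
  (fun i => (nth (0, 0) l i).1).
  by move=> i; apply: l0; rewrite mem_nth.
have E : (fun w => \sum_(i < size l) (nth (0, 0) l i).1 * X (nth (0, 0) l i).2 w)
    = (fun w => pair_list l (X ^~ w)).
  by apply/funext => w; rewrite /pair_list (big_nth (0, 0)) big_mkord.
rewrite E in law; exists (s ^+ 2); apply: (centered_normal_of_law _ El law).
by apply: measurable_sum => p; apply: measurable_funM.
Qed.

Lemma centered_normal_coordinate t : 0 <= t -> exists v, centered_normal P (X t) v.
Proof.
move=> t0; have E w : pair_list [:: (1, t)] (X ^~ w) = X t w.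
  by rewrite /pair_list big_seq1 mul1r.
have [|| v nv] := @gaussian_list_law [:: (1, t)].
- by move=> p; rewrite inE => /eqP ->.
- under eq_integral do rewrite E.
  by have := X_centered t0; rewrite expectation_def.
- by exists v; move: nv; congr (centered_normal P _ v); apply/funext.
Qed.

Lemma cov_fun_Rintegral s t : 0 <= s -> 0 <= t ->
  cov_fun X s t = \int[P]_w (X s w * X t w).
Proof.
move=> s0 t0; rewrite /cov_fun /cov covariance.unlock.
rewrite !X_centered//= expectation.unlock /Rintegral; congr fine; apply: eq_integral => w _ /=.
by rewrite -[in RHS](subr0 (X s w)) -[in RHS](subr0 (X t w)).
Qed.

Lemma Rintegral_pair_list l (F : R -> T -> R) :
  (forall p, p \in l -> P.-integrable setT (EFin \o F p.2)) ->
  P.-integrable setT (EFin \o (fun w => pair_list l (F ^~ w))) /\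
  \int[P]_w pair_list l (F ^~ w) = pair_list l (fun t => \int[P]_w F t w).
Proof.
elim: l => [|p l IH] iF.
  rewrite /pair_list big_nil; split; last first.
    by under eq_Rintegral do rewrite big_nil; exact: Rintegral_cst_prob.
  apply: (@bounded_integrable _ _ _ P _ 0) => [|w]; last by rewrite big_nil normr0.
  by under eq_fun do rewrite big_nil; exact: measurable_cst.
have [|i E] := IH; first by move=> p' p'l; apply: iF; rewrite inE p'l orbT.
have ip : P.-integrable setT (EFin \o F p.2) by apply: iF; rewrite inE eqxx.
have icp := integrableZl measurableT p.1 ip.
have EF : (fun w => pair_list (p :: l) (F ^~ w))
    = (fun w => p.1 * F p.2 w + pair_list l (F ^~ w)).
  by apply/funext => w; rewrite /pair_list big_cons.
rewrite EF; split; first exact: (integrableD measurableT icp i).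
rewrite (RintegralD measurableT icp i) E (RintegralZl p.1 measurableT ip).
by rewrite [RHS]/pair_list big_cons.
Qed.

Lemma Rintegral_pair_listM l l' : nonneg_times l -> nonneg_times l' ->
  \int[P]_w (pair_list l (X ^~ w) * pair_list l' (X ^~ w)) = quad_list (cov_fun X) l l'.
Proof.
move=> l0 l'0; rewrite /quad_list.
have iXX p p' : p \in l -> p' \in l' ->
    P.-integrable setT (EFin \o (fun w => X p.2 w * X p'.2 w)).
  move=> /l0/centered_normal_coordinate[a na] /l'0/centered_normal_coordinate[b nb].
  exact: integrableM_centered_normal na nb.
have H p : p \in l -> P.-integrable setT (EFin \o (fun w => X p.2 w * pair_list l' (X ^~ w))) /\
    \int[P]_w (X p.2 w * pair_list l' (X ^~ w)) = pair_list l' (cov_fun X p.2).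
  move=> pl; have [p' p'l|I1 I2] := @Rintegral_pair_list l' (fun t w => X p.2 w * X t w).
    exact: iXX.
  have EF w : X p.2 w * pair_list l' (X ^~ w) = pair_list l' (fun t => X p.2 w * X t w).
    by rewrite pair_listZ.
  under [X in integrable _ _ (_ \o X)]eq_fun do rewrite EF.
  under eq_Rintegral do rewrite EF.
  split=> //; rewrite I2 /pair_list !big_seq; apply: eq_bigr => p' p'l.
  by rewrite cov_fun_Rintegral//; [exact: l0|exact: l'0].
have [p pl|_ I2] := @Rintegral_pair_list l (fun t w => X t w * pair_list l' (X ^~ w)).
  by have [] := H p pl.
under eq_Rintegral => w _.
  rewrite (_ : pair_list l (X ^~ w) * pair_list l' (X ^~ w)
    = pair_list l (fun t => X t w * pair_list l' (X ^~ w))); last first.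
    by under [in RHS]eq_fun do rewrite mulrC; rewrite pair_listZ mulrC.
  over.
rewrite I2 /pair_list !big_seq; apply: eq_bigr => p pl.
by have [_ ->] := H p pl.
Qed.

(** The hypothesis on the process gives some variance; it is identified by computing the second
    moment of the combination from the covariances. *)
Lemma centered_normal_list l : nonneg_times l ->
  centered_normal P (fun w => pair_list l (X ^~ w)) (quad_list (cov_fun X) l l).
Proof.
move=> l0.
have iX p : p \in l -> P.-integrable setT (EFin \o X p.2).
  by move=> /l0/centered_normal_coordinate[v /integrable_centered_normal].
have [i E] := @Rintegral_pair_list l (fun t => X t : T -> R) iX.
have [|v nv] := gaussian_list_law l0.
  have -> : (\int[P]_w (pair_list l (X ^~ w))%:E = (\int[P]_w pair_list l (X ^~ w))%:E)%E.
    by rewrite /Rintegral fineK//; exact: integrable_fin_num.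
  rewrite E /pair_list big1_seq// => p /= pl.
  by rewrite /Rintegral -expectation_def X_centered ?mulr0// l0.
suff <- : v = quad_list (cov_fun X) l l by [].
rewrite -(Rintegral_centered_normal_sqr nv).
rewrite -(Rintegral_pair_listM l0 l0).
by apply: eq_Rintegral => w _; rewrite expr2.
Qed.

Lemma cov_increment a s t : 0 <= a -> 0 <= s -> 0 <= t ->
  cov P (increment X a s) (increment X a t)
  = cov_fun X s t - cov_fun X s a - cov_fun X a t + cov_fun X a a.
Proof.
move=> a0 s0 t0.
pose dl u : seq (R * R) := [:: (1, u); (-1, a)].
have E u : increment X a u = (fun w => pair_list (dl u) (X ^~ w)).
  by apply/funext => w; rewrite /increment /pair_list !big_cons big_nil/= addr0 mul1r mulN1r.
have dl0 u : 0 <= u -> nonneg_times (dl u).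
  by move=> u0 p; rewrite !inE => /orP[] /eqP ->.
have mean0 u : 0 <= u -> fine ('E_P[increment X a u])%E = 0.
  move=> u0; rewrite expectation.unlock E.
  exact: (Rintegral_centered_normal (centered_normal_list (dl0 _ u0))).
rewrite /cov covariance.unlock !mean0// expectation.unlock.
transitivity (\int[P]_w (pair_list (dl s) (X ^~ w) * pair_list (dl t) (X ^~ w))).
  rewrite /Rintegral; congr fine; apply: eq_integral => w _.
  by rewrite -[in RHS](subr0 (pair_list (dl s) _)) -[in RHS](subr0 (pair_list (dl t) _)) !E.
rewrite Rintegral_pair_listM; [|exact: dl0|exact: dl0].
by rewrite /quad_list /pair_list !big_cons !big_nil/=; ring.
Qed.

End gaussian_lists.

(** * Algebra and continuity of the conditioning recursion *)

Section conditioning_theory.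
Context (R : realType) (k : R -> R -> R) (tau : nat -> R).
Hypothesis k_sym : forall t s, k t s = k s t.

Lemma k_cond_sym j t s : k_cond k tau j t s = k_cond k tau j s t.
Proof.
elim: j t s => [|j IH] t s //=; rewrite /regression (IH t s) (IH s t).
rewrite (IH t s); congr (_ - _).
by rewrite mulrAC [RHS]mulrAC [X in X / _]mulrC.
Qed.

(** The coefficients of the conditioned value at [t], for zero pinning values, as a combination of
    values of the original process. *)
Fixpoint cond_list (j : nat) (t : R) : seq (R * R) :=
  if j is i.+1 then
    bind_list (cond_list i) [:: (1, t); (- alpha k tau i.+1 t, tau i.+1)]
  else [:: (1, t)].

Lemma pair_list2 (J : Type) (a b : R) (s t : J) (h : J -> R) :
  pair_list [:: (a, s); (b, t)] h = a * h s + b * h t.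
Proof. by rewrite /pair_list !big_cons big_nil addr0. Qed.

Lemma pair_cond_list (T : Type) (X : R -> T -> R) j t w :
  pair_list (cond_list j t) (X ^~ w) = X_cond k tau X (fun=> 0) j t w.
Proof.
elim: j t => [|j IH] t; first by rewrite /pair_list big_seq1 mul1r.
by rewrite [cond_list _ _]/= pair_list_bind pair_list2 /= !IH mul1r subr0 mulNr.
Qed.

Lemma cond_list_times j t : 0 <= t -> (forall i, (1 <= i <= j)%N -> 0 <= tau i) ->
  forall p, p \in cond_list j t -> 0 <= p.2.
Proof.
elim: j t => [|j IH] t t0 tau0 p; first by rewrite inE => /eqP ->.
have H u : 0 <= u -> forall p, p \in cond_list j u -> 0 <= p.2.
  by move=> u0; apply: IH => // i /andP[i1 ij]; apply: tau0; rewrite i1 ltnW.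
rewrite /= /bind_list /= cats0 mem_cat => /orP[] /mapP[p' p'l ->] /=.
  exact: H p'l.
by apply: H p'l; apply: tau0; rewrite leqnn.
Qed.

(** Identifies [k_cond] as the covariance of the conditioned process: one substitution step of
    [cond_list] reproduces one step of the recursion, the variance at the new pinning time
    cancelling one regression term. *)
Lemma quad_cond_list j t s : (forall i, (1 <= i <= j)%N -> 0 < var_cond k tau i) ->
  quad_list k (cond_list j t) (cond_list j s) = k_cond k tau j t s.
Proof.
elim: j t s => [|j IH] t s v0; first by rewrite /quad_list /pair_list !big_seq1 !mul1r.
rewrite [cond_list _ t]/= [cond_list _ s]/= quad_list_bind.
have IH' u u' : quad_list k (cond_list j u) (cond_list j u') = k_cond k tau j u u'.
  by apply: IH => i /andP[i1 ij]; apply: v0; rewrite i1 ltnW.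
rewrite /quad_list pair_list2 !pair_list2 -!/(quad_list _ _ _) !IH' /= /alpha /regression /=.
have := v0 j.+1; rewrite leqnn => /(_ isT); rewrite /var_cond/= => v0'.
rewrite (k_cond_sym j (tau j.+1) s); field.
by rewrite gt_eqF.
Qed.

Lemma alpha_pin j : 0 < var_cond k tau j -> alpha k tau j (tau j) = 1.
Proof. by move=> v0; rewrite /alpha /regression divff// gt_eqF. Qed.

Lemma X_cond_pin (T : Type) (X : R -> T -> R) x j w : 0 < var_cond k tau j.+1 ->
  X_cond k tau X x j.+1 (tau j.+1) w = x j.+1.
Proof. by move=> v0; rewrite /= alpha_pin// mul1r subKr. Qed.

(** The recursion is affine. The deterministic mean is the same recursion run on the zero process
    over a one-point sample space, so results on [X_cond] apply to both parts. *)
Lemma X_condE (T : Type) (X : R -> T -> R) x j t w : X_cond k tau X x j t w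
  = X_cond k tau X (fun=> 0) j t w + X_cond k tau (fun _ (_ : unit) => 0) x j t tt.
Proof. by elim: j t => [|j IH] t; [rewrite addr0|rewrite /= !IH; ring]. Qed.

Lemma k_cond_pin j t : 0 < var_cond k tau j.+1 -> k_cond k tau j.+1 t (tau j.+1) = 0.
Proof.
by move=> v0; rewrite /= /regression divfK ?subrr// gt_eqF.
Qed.

Section continuity.
Hypothesis k_continuous : forall t s : R, 0 < t -> 0 < s ->
  {for (t, s), continuous (fun p : R * R => k p.1 p.2)}.
Variable n : nat.
Hypothesis tau_gt0 : forall i, (1 <= i <= n)%N -> 0 < tau i.

Lemma continuous_k_cond j t s : (j <= n)%N -> 0 < t -> 0 < s ->
  {for (t, s), continuous (fun p : R * R => k_cond k tau j p.1 p.2)}.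
Proof.
elim: j t s => [|j IH] t s jn t0 s0; first exact: k_continuous.
have tau0 : 0 < tau j.+1 by apply: tau_gt0; rewrite jn.
have IH' u v := IH u v (ltnW jn).
apply: cvgB; first exact: IH'.
apply: cvgM; [apply: cvgM; last exact: cvg_cst|].
  apply: (@continuous2_cvg _ R R R _ _ (fun p : R * R => p.1) (fun=> tau j.+1)).
  - exact: (IH' t (tau j.+1) t0 tau0).
  - exact: cvg_fst.
  - exact: cvg_cst.
apply: (@continuous2_cvg _ R R R _ _ (fun p : R * R => p.2) (fun=> tau j.+1)).
- exact: (IH' s (tau j.+1) s0 tau0).
- exact: cvg_snd.
- exact: cvg_cst.
Qed.

Lemma continuous_k_condl j t s : (j <= n)%N -> 0 < t -> 0 < s ->
  {for t, continuous (fun u => k_cond k tau j u s)}.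
Proof.
move=> jn t0 s0; apply: (@continuous2_cvg _ R R R _ _ (fun u : R => u) (fun=> s)).
- exact: (continuous_k_cond jn t0 s0).
- exact: cvg_id.
- exact: cvg_cst.
Qed.

Lemma continuous_X_cond (T : Type) (X : R -> T -> R) x w j t : (j <= n)%N -> 0 < t ->
  (forall u, 0 < u -> {for u, continuous (X ^~ w)}) ->
  {for t, continuous (fun u => X_cond k tau X x j u w)}.
Proof.
move=> jn t0 cX; elim: j jn => [|j IH] jn; first exact: cX.
apply: cvgB; first by apply: IH; exact: ltnW.
apply: cvgM; last exact: cvg_cst.
apply: cvgM; last exact: cvg_cst.
by apply: continuous_k_condl => //; [exact: ltnW|apply: tau_gt0; rewrite jn].
Qed.

End continuity.
End conditioning_theory.

Section uniform_limits.
Context (R : realType) (J : Type) (U : Type) (F : set_system U) {FF : Filter F}.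

Definition ucvg (f : U -> J -> R) (g : J -> R) : Prop :=
  forall e : R, 0 < e -> \forall u \near F, forall t, `|g t - f u t| < e.

Lemma eq_ucvg (f f' : U -> J -> R) g g' : f =2 f' -> g =1 g' -> ucvg f g -> ucvg f' g'.
Proof.
move=> ff' gg' fg e e0; apply: filterS (fg e e0) => u h t.
by rewrite -gg' -ff'.
Qed.

Lemma ucvg_subZ (f f' : U -> J -> R) g g' (c : R) : ucvg f g -> ucvg f' g' ->
  ucvg (fun u t => f u t - c * f' u t) (fun t => g t - c * g' t).
Proof.
move=> fg fg' e e0; have e2 : 0 < e / 2 by rewrite divr_gt0.
have c0 : 0 < `|c| + 1 by rewrite ltr_wpDl.
apply: filterS2 (fg _ e2) (fg' _ (divr_gt0 e2 c0)) => u h h' t.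
have -> : g t - c * g' t - (f u t - c * f' u t) = (g t - f u t) - c * (g' t - f' u t) by ring.
rewrite (le_lt_trans (ler_normB _ _))// (splitr e); apply: ltr_leD; first exact: h.
rewrite normrM; apply: (@le_trans _ _ (`|c| * (e / 2 / (`|c| + 1)))).
  by rewrite ler_wpM2l// ltW.
by rewrite mulrCA ler_piMr ?(ltW e2)// ler_pdivrMr// mul1r lerDl.
Qed.

(** The limits must be bounded for the product of the errors to be controlled. The maps [a] and [b]
    evaluate the factors at different indices, such as the two components of a pair of times. *)
Lemma ucvgM (J' : Type) (a : J' -> J) (b : J' -> J) (f f' : U -> J -> R) g g' (M : R) :
  (forall t, `|g t| <= M) -> (forall t, `|g' t| <= M) -> ucvg f g -> ucvg f' g' ->
  forall e : R, 0 < e -> \forall u \near F,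
    forall t, `|g (a t) * g' (b t) - f u (a t) * f' u (b t)| < e.
Proof.
move=> gM gM' fg fg' e e0.
have K0 : 0 < 2 * `|M| + 2 by rewrite ltr_wpDl// mulr_ge0.
have d0 : 0 < Num.min 1 (e / (2 * `|M| + 2)) by rewrite lt_min ltr01 divr_gt0.
apply: filterS2 (fg _ d0) (fg' _ d0) => u h h' t.
move: (h (a t)) (h' (b t)); rewrite !lt_min => /andP[h1 h2] /andP[h3 h4].
have -> : g (a t) * g' (b t) - f u (a t) * f' u (b t)
  = (g (a t) - f u (a t)) * (g' (b t) - (g' (b t) - f' u (b t)))
    + g (a t) * (g' (b t) - f' u (b t)) by ring.
have gM1 : `|g (a t)| <= `|M| by rewrite (le_trans (gM _))// ler_norm.
have gM2 : `|g' (b t)| <= `|M| by rewrite (le_trans (gM' _))// ler_norm.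
rewrite (le_lt_trans (ler_normD _ _))// !normrM.
set d := e / _ in h2 h4; have dE : d * (2 * `|M| + 2) = e by rewrite divfK// gt_eqF.
have B1 : `|g' (b t) - (g' (b t) - f' u (b t))| <= `|M| + 1.
  by rewrite (le_trans (ler_normB _ _))// lerD// ltW.
have B2 : `|g (a t) - f u (a t)| * `|g' (b t) - (g' (b t) - f' u (b t))| <= d * (`|M| + 1).
  by rewrite ler_pM// ltW.
have B3 : `|g (a t)| * `|g' (b t) - f' u (b t)| <= `|M| * d by rewrite ler_pM// ltW.
rewrite (le_lt_trans (lerD B2 B3))// -dE.
have : 0 < d by rewrite divr_gt0.
by rewrite mulrDr mulrDr mulr1 [`|M| * d]mulrC; lra.
Qed.

End uniform_limits.

Section affine_time.
Context (R : realType) (a e : R).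
Hypotheses (a0 : 0 < a) (e0 : 0 <= e).
Local Notation I := (I01 R).

Definition affine_time (t : I) : R := a + e * time t.

Lemma affine_time_gt0 t : 0 < affine_time t.
Proof. by have /andP[t0 _] := time_itv t; rewrite ltr_pwDl// mulr_ge0. Qed.

Lemma affine_time_dist t : `|affine_time t - a| <= e.
Proof.
have /andP[t0 t1] := time_itv t.
by rewrite /affine_time addrAC subrr add0r ger0_norm ?mulr_ge0// ler_piMr.
Qed.

Lemma continuous_affine_time : continuous affine_time.
Proof.
apply/I01_continuousP => t r r0.
have e1 : 0 < e + 1 by rewrite ltr_wpDl.
exists (r / (e + 1)) => [|s st]; first by rewrite divr_gt0.
rewrite /affine_time opprD addrACA subrr add0r -mulrBr normrM ger0_norm//.
apply: (@le_lt_trans _ _ ((e + 1) * `|time t - time s|)).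
  by rewrite ler_wpM2r// lerDl.
by rewrite mulrC -ltr_pdivlMr.
Qed.

Lemma continuous_affine_comp (f : R -> R) :
  (forall u, 0 < u -> {for u, continuous f}) -> continuous (fun t => f (affine_time t)).
Proof.
move=> cf t; apply: (@continuous_comp _ _ _ affine_time f t).
  exact: continuous_affine_time.
by apply: cf; exact: affine_time_gt0.
Qed.

Lemma continuous_affine_comp2 (f : R * R -> R) :
  (forall u v, 0 < u -> 0 < v -> {for (u, v), continuous f}) ->
  continuous (fun p : I * I => f (affine_time p.1, affine_time p.2)).
Proof.
move=> cf p; apply: (@continuous2_cvg _ R R R _ (nbhs_filter p)
  (fun p => affine_time p.1) (fun p => affine_time p.2) (fun x y => f (x, y))).
- have := cf _ _ (affine_time_gt0 p.1) (affine_time_gt0 p.2).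
  rewrite [X in {for _, continuous X}](_ : f = (fun z => f (z.1, z.2)))//.
  by apply/funext => -[].
- exact: (@continuous_comp _ _ _ fst affine_time p cvg_fst (@continuous_affine_time p.1)).
- exact: (@continuous_comp _ _ _ snd affine_time p cvg_snd (@continuous_affine_time p.2)).
Qed.

End affine_time.

(** * Limits of the rescaled conditioned covariances *)

Section covariance_limit.
Context (R : realType) (k : R -> R -> R) (tau : nat -> R) (n : nat).
Local Notation I := (I01 R).
Hypothesis k_sym : forall t s, k t s = k s t.
Hypothesis k_continuous : forall t s : R, 0 < t -> 0 < s ->
  {for (t, s), continuous (fun p : R * R => k p.1 p.2)}.
Hypothesis n_gt0 : (0 < n)%N.
Hypothesis tau_gt0 : forall i, (1 <= i <= n)%N -> 0 < tau i.
Hypothesis var_gt0 : forall i, (1 <= i <= n)%N -> 0 < var_cond k tau i.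
Variable gamma : R -> R.
Hypothesis gamma_gt0 : forall e : R, 0 < e -> 0 < gamma e.
Variables (kbar : I -> I -> R) (rhobar : I -> R -> R).
Let a := tau n.
Let a0 : 0 < a. Proof. by apply: tau_gt0; rewrite n_gt0 leqnn. Qed.

Definition scaled_diff j (u : R) (e : R) (t : I) : R :=
  (k_cond k tau j (affine_time (tau n) e t) u - k_cond k tau j (tau n) u) / gamma e.

(** The second difference of [k_cond] at the last pinning time: it plays the part of the covariance
    of increments after [j] conditionings, in a form on which the recursion acts directly. *)
Definition scaled_diff2 j (e : R) (p : I * I) : R :=
  (k_cond k tau j (affine_time (tau n) e p.1) (affine_time (tau n) e p.2)
   - k_cond k tau j (affine_time (tau n) e p.1) (tau n)
   - k_cond k tau j (tau n) (affine_time (tau n) e p.2)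
   + k_cond k tau j (tau n) (tau n)) / gamma e ^+ 2.

Hypothesis diff_cvg : forall u : R, 0 < u -> ucvg 0^'+ (scaled_diff 0 u) (rhobar ^~ u).
Hypothesis diff2_cvg : ucvg 0^'+ (scaled_diff2 0) (fun p => kbar p.1 p.2).

Lemma scaled_diff_cvg j u : (j <= n)%N -> 0 < u ->
  ucvg 0^'+ (scaled_diff j u) (rhobar_cond k tau rhobar j ^~ u).
Proof.
elim: j u => [|j IH] u jn u0; first exact: diff_cvg.
have tau0 : 0 < tau j.+1 by apply: tau_gt0; rewrite jn.
apply: eq_ucvg (ucvg_subZ (alpha k tau j.+1 u) (IH u (ltnW jn) u0) (IH _ (ltnW jn) tau0)) => // e t.
rewrite /scaled_diff /= /alpha /regression /= !(k_cond_sym _ k_sym j u).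
by ring.
Qed.

(** A uniform limit of bounded functions: a single [e] at which the rescaled difference is within 1
    of the limit is enough. *)
Lemma rhobar_bounded j u : (j <= n)%N -> 0 < u ->
  exists M, forall t, `|rhobar_cond k tau rhobar j t u| <= M.
Proof.
move=> jn u0.
have [e [e0 he]] : exists e : R, 0 < e /\ forall t,
    `|rhobar_cond k tau rhobar j t u - scaled_diff j u e t| < 1.
  apply: (@filter_ex _ (0^'+ : set_system R)); apply: filterI.
    exact: nbhs_right_gt.
  exact: scaled_diff_cvg.
have c : continuous (fun t => k_cond k tau j (affine_time (tau n) e t) u).
  apply: (@continuous_affine_comp _ _ _ a0 (ltW e0) (fun x => k_cond k tau j x u)).
  by move=> v v0; apply: (continuous_k_condl k_continuous tau_gt0).
have [M M0 hM] := compact_continuous_bounded (@compact_I01 R) c.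
exists (1 + (M + `|k_cond k tau j (tau n) u|) / gamma e) => t.
rewrite -[rhobar_cond _ _ _ _ _ _](subrK (scaled_diff j u e t)).
rewrite (le_trans (ler_normD _ _))// lerD//; first exact: ltW.
rewrite /scaled_diff normrM [X in _ * X]ger0_norm ?invr_ge0 ?(ltW (gamma_gt0 e0))//.
rewrite ler_wpM2r ?invr_ge0 ?(ltW (gamma_gt0 e0))//.
by rewrite (le_trans (ler_normB _ _))// lerD.
Qed.

Lemma kbar_condS j t s : (0 < var_cond k tau j.+1) ->
  kbar_cond k tau kbar rhobar j.+1 t s = kbar_cond k tau kbar rhobar j t s
  - (var_cond k tau j.+1)^-1 * (rhobar_cond k tau rhobar j t (tau j.+1)
      * rhobar_cond k tau rhobar j s (tau j.+1)).
Proof.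
move=> v0; rewrite /kbar_cond big_nat_recr//= opprD addrA; congr (_ - _).
by rewrite /alphabar /=; field; rewrite gt_eqF.
Qed.

Lemma scaled_diff2_cvg j : (j <= n)%N ->
  ucvg 0^'+ (scaled_diff2 j) (fun p => kbar_cond k tau kbar rhobar j p.1 p.2).
Proof.
elim: j => [|j IH] jn.
  apply: eq_ucvg diff2_cvg => // p.
  by rewrite /kbar_cond big_geq// subr0.
have tau0 : 0 < tau j.+1 by apply: tau_gt0; rewrite jn.
have v0 : 0 < var_cond k tau j.+1 by apply: var_gt0; rewrite jn.
have cD := scaled_diff_cvg (ltnW jn) tau0.
have [M hM] := rhobar_bounded (ltnW jn) tau0.
have cDD : ucvg 0^'+ (fun e (p : I * I) =>
      scaled_diff j (tau j.+1) e p.1 * scaled_diff j (tau j.+1) e p.2)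
    (fun p => rhobar_cond k tau rhobar j p.1 (tau j.+1)
      * rhobar_cond k tau rhobar j p.2 (tau j.+1)).
  by move=> e e0; apply: (@ucvgM _ _ _ _ _ (I * I)%type fst snd _ _ _ _ M hM hM cD cD).
apply: eq_ucvg (ucvg_subZ (var_cond k tau j.+1)^-1 (IH (ltnW jn)) cDD) => [e p|p]; last first.
  by rewrite kbar_condS.
rewrite /scaled_diff2 /scaled_diff /= /regression /var_cond /=.
rewrite -exprVn.
by move: (gamma e)^-1 (k_cond k tau j (tau j.+1) (tau j.+1))^-1 => g v; ring.
Qed.

Definition cond_kernel (e : R) (s t : I) : R :=
  k_cond k tau n (affine_time (tau n) e s) (affine_time (tau n) e t).

(** After the last conditioning the process is pinned at [tau n]: the three other terms of the
    second difference vanish and the kernel itself remains. *)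
Lemma cond_kernel_cvg : ucvg 0^'+ (fun e (p : I * I) => cond_kernel e p.1 p.2 / gamma e ^+ 2)
  (fun p => kbar_cond k tau kbar rhobar n p.1 p.2).
Proof.
have pin t : k_cond k tau n t (tau n) = 0.
  by rewrite -(prednK n_gt0) k_cond_pin// prednK// var_gt0// n_gt0 leqnn.
apply: eq_ucvg (scaled_diff2_cvg (leqnn n)) => // e p; rewrite /scaled_diff2 !pin (k_cond_sym _ k_sym _ (tau n)) pin.
by rewrite !subr0 addr0.
Qed.

Lemma continuous_cond_kernel e : 0 < e -> continuous (fun p : I * I => cond_kernel e p.1 p.2).
Proof.
move=> e0; apply: (@continuous_affine_comp2 _ _ _ a0 (ltW e0)
  (fun p => k_cond k tau n p.1 p.2)).
by move=> u v u0 v0; exact: (continuous_k_cond k_continuous tau_gt0).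
Qed.

Lemma continuous_kbar_cond :
  continuous (fun p : I * I => kbar_cond k tau kbar rhobar n p.1 p.2).
Proof.
have H : \forall e \near 0^'+,
    continuous (fun p : I * I => cond_kernel e p.1 p.2 / gamma e ^+ 2).
  apply: filterS (@nbhs_right_gt R 0) => e e0 p; apply: cvgM; last exact: cvg_cst.
  exact: continuous_cond_kernel.
apply: (@uniform_limit_continuous _ _
  ((fun e (p : I * I) => cond_kernel e p.1 p.2 / gamma e ^+ 2) @ 0^'+) _ _ H).
exact/unif_cvgP/cond_kernel_cvg.
Qed.

Lemma cond_kernel_pointwise s t : (fun e => cond_kernel e s t / gamma e ^+ 2) @ 0^'+
  --> kbar_cond k tau kbar rhobar n s t.
Proof.
apply/cvgrPdist_lt => e e0; apply: filterS (cond_kernel_cvg e0) => u.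
by move=> /(_ (s, t)).
Qed.

Lemma kbar_cond_sym s t : kbar_cond k tau kbar rhobar n s t = kbar_cond k tau kbar rhobar n t s.
Proof.
have := @cond_kernel_pointwise s t.
rewrite (_ : (fun e => _) = (fun e => cond_kernel e t s / gamma e ^+ 2)).
  by move=> h; exact: (cvg_unique _ h (@cond_kernel_pointwise t s)).
by apply/funext => e; rewrite /cond_kernel k_cond_sym.
Qed.

Lemma kbar_cond_zero : kbar_cond k tau kbar rhobar n (zero01 R) (zero01 R) = 0.
Proof.
have := @cond_kernel_pointwise (zero01 R) (zero01 R).
rewrite (_ : (fun e => _) = (fun=> 0)).
  by move=> h; exact: (cvg_unique _ h (cvg_cst _)).
apply/funext => e; rewrite /cond_kernel /affine_time mulr0 addr0.
by rewrite -{1 2 3}(prednK n_gt0) k_cond_pin ?mul0r// prednK// var_gt0// n_gt0 leqnn.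
Qed.

Lemma quad_kbar_cond_cvg (l l' : seq (R * I)) :
  (fun e => quad_list (cond_kernel e) l l' / gamma e ^+ 2) @ 0^'+
  --> quad_list (kbar_cond k tau kbar rhobar n) l l'.
Proof.
have C (J : Type) (f : R -> J -> R) (g : J -> R) (m : seq (R * J)) :
    (forall t, (fun e => f e t) @ 0^'+ --> g t) ->
    (fun e => pair_list m (f e)) @ 0^'+ --> pair_list m g.
  move=> fg; rewrite /pair_list; elim: m => [|p m IH].
    by rewrite big_nil; under eq_fun do rewrite big_nil; exact: cvg_cst.
  rewrite big_cons; under eq_fun do rewrite big_cons.
  by apply: cvgD => //; apply: cvgM => //; exact: cvg_cst.
rewrite (_ : (fun e => _) = (fun e => pair_list l (fun s => pair_list l'
    (fun t => cond_kernel e s t / gamma e ^+ 2)))); last first.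
  apply/funext => e; rewrite /quad_list mulrC -pair_listZ; congr pair_list.
  apply/funext => s; rewrite -pair_listZ; congr pair_list.
  by apply/funext => t; rewrite mulrC.
by apply: (C _ (fun e s => pair_list l' (fun t => cond_kernel e s t / gamma e ^+ 2))) => s;
  apply: C => t; exact: cond_kernel_pointwise.
Qed.

End covariance_limit.

(** * The large deviation principle *)

Section open_path_sets.
Context (R : realType).
Local Notation I := (I01 R).
Local Notation C := (C01 R).

Lemma open_C01P (A : set C) : open A <-> forall g, A g ->
  exists2 r : R, 0 < r & forall h : C, (forall t, `|path_fun g t - path_fun h t| < r) -> A h.
Proof.
rewrite openE; split=> [H g /H /nbhs_ballP[r /= r0 h]|H g /H[r r0 h]].
  by exists r => // h' hh'; exact: h.
by apply/nbhs_ballP; exists r => // h' hh'; exact: h.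
Qed.

Lemma closed_mod_set (r e : R) : closed (mod_set r e : set C).
Proof.
rewrite -openC; apply/open_C01P => g /= ng.
have [s [t [st gst]]] : exists s t : I, `|time s - time t| < r /\
    e < `|path_fun g s - path_fun g t|.
  apply: contrapT => H; apply: ng => s t st; rewrite leNgt; apply/negP => h.
  by apply: H; exists s, t.
exists ((`|path_fun g s - path_fun g t| - e) / 2) => [|h gh hm].
  by rewrite divr_gt0// subr_gt0.
have := hm _ _ st; have := gh s; have := gh t.
move: (path_fun g s) (path_fun g t) (path_fun h s) (path_fun h t) gst => a b c f h1 h2 h3 h4.
have : `|a - b| <= `|c - f| + `|a - c| + `|b - f|.
  have -> : a - b = (c - f) + (a - c) - (b - f) by ring.
  by rewrite (le_trans (ler_normB _ _))// lerD2r (le_trans (ler_normD _ _)).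
by lra.
Qed.

Definition half_space (l : seq (R * I)) (y x : R) : set C :=
  [set g | x < pair_list l (fun t => path_fun g t - y)].

Lemma open_half_space l y x : open (half_space l y x).
Proof.
apply/open_C01P => g; rewrite /half_space/= => gx.
have m0 : 0 < mass_list l + 1 by rewrite ltr_wpDl// mass_list_ge0.
set p := pair_list _ _ in gx.
exists ((p - x) / (mass_list l + 1)) => [|h gh]; first by rewrite divr_gt0// subr_gt0.
have := @pair_list_dist _ _ l (fun t => path_fun g t - y) (fun t => path_fun h t - y)
  ((p - x) / (mass_list l + 1)).
rewrite -/p /half_space/= ler_norml => H.
have /H/andP[_] : forall t, `|path_fun g t - y - (path_fun h t - y)| <= (p - x) / (mass_list l + 1).
  by move=> t; rewrite opprB addrA subrK ltW.
move=> h1; have h2 : mass_list l * ((p - x) / (mass_list l + 1)) < p - x.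
  rewrite mulrCA -[ltRHS]mulr1 ltr_pM2l ?subr_gt0// ltr_pdivrMr// mul1r ltrDl//.
by move: h1 h2; lra.
Qed.

End open_path_sets.

(** The arithmetic that follows from testing a path against [[:: (c, s); (- c, t)]], with the
    quadratic form expanded. *)
Lemma scaled_increment_le (R : realFieldType) (a c eta y g h u v w : R) :
  c * (c * (u - 2 * v + w) / 2) <= c * (eta / 2) -> a <= c * (eta / 2) ->
  c * (g - y) + - c * (h - y) - (c * (c * u + - c * v) + - c * (c * v + - c * w)) / 2 <= a ->
  c * (g - h) <= c * eta.
Proof. by move=> *; lra. Qed.

Lemma abs_path_le (R : realFieldType) (a y g u : R) :
  g - y <= a + u / 2 -> - (g - y) <= a + u / 2 -> `|g| <= `|a| + `|u| + `|y|.
Proof.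
have := ler_norm a; have := ler_norm u; have := ler_norm y; have := ler_norm (- y).
by rewrite normrN ler_norml => *; have := normr_ge0 u; lra.
Qed.

Lemma ultra_setC (X : Type) (F : set_system X) (A : set X) :
  UltraFilter F -> F A -> F (~` A) -> False.
Proof.
move=> UF FA FnA; have PF : ProperFilter F by exact: ultra_proper.
have F0 : F set0 by rewrite -(setICr A); exact: filterI.
exact: (@filter_not_empty X F _ F0).
Qed.

Lemma ereal_lt_dense (R : realFieldType) (a b : \bar R) : (a < b)%E ->
  exists r : R, (a < r%:E < b)%E.
Proof.
move: a b => [a||] [b||]//.
- rewrite lte_fin => ab; exists ((a + b) / 2); rewrite !lte_fin.
  by apply/andP; split; lra.
- by move=> _; exists (a + 1); rewrite lte_fin ltrDl ltr01 ltry.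
- by move=> _; exists (b - 1); rewrite lte_fin ltNyr ltrBlDr ltrDl ltr01.
- by move=> _; exists 0; rewrite ltNyr ltry.
Qed.

Section measure_bounds.
Context d (T : measurableType d) (R : realType) (P : probability T R).

(** Continuity from below. It is here that a bound independent of the number of coordinates becomes
    a bound on a countable supremum. *)
Lemma measure_bigcup_le (F : nat -> set T) (a : \bar R) :
  (forall i, measurable (F i)) ->
  (forall n, (P [set w | exists i : 'I_n, F i w] <= a)%E) -> (P (\bigcup_i F i) <= a)%E.
Proof.
move=> mF Fa; pose B n := [set w | exists i : 'I_n, F i w].
have BE n : B n = \bigcup_(i in [set i | (i < n)%N]) F i.
  apply/seteqP; split=> w /=; first by move=> [i Fi]; exists i => //=; exact: ltn_ord.
  by move=> [i /= ni Fi]; exists (Ordinal ni).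
have mB n : measurable (B n) by rewrite BE; apply: bigcup_measurable.
have UB : \bigcup_i F i = \bigcup_n B n.
  apply/seteqP; split=> w [i _ Fi]; last by case: Fi => j Fj; exists j.
  by exists i.+1 => //; exists ord_max.
have nB : nondecreasing_seq B.
  move=> n p np; apply/subsetPset => w [i Fi].
  by exists (widen_ord np i).
have mU : measurable (\bigcup_n B n) by exact: bigcup_measurable.
have := nondecreasing_cvg_mu (mu := P) mB mU nB; rewrite -UB => c.
rewrite -(cvg_lim _ c)//; apply: lime_le; first by apply/cvg_ex; eexists; exact: c.
by apply: nearW => n; exact: Fa.
Qed.

Lemma Rintegral_indic_prob (E : set T) : measurable E -> \int[P]_w \1_E w = fine (P E).
Proof. by move=> mE; rewrite /Rintegral integral_indic// setIT. Qed.

End measure_bounds.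

(** * The principle for a deterministic mean plus a small Gaussian family *)

Section large_deviations.
Context d (T : measurableType d) (R : realType) (P : probability T R).
Local Notation I := (I01 R).
Variable q : I -> I -> R.
Hypothesis q_continuous : continuous (fun p : I * I => q p.1 p.2).
Hypothesis q_sym : forall s t, q s t = q t s.
Hypothesis q_psd : forall l, 0 <= quad_list q l l.
Hypothesis q_zero : q (zero01 R) (zero01 R) = 0.
Variables (gamma : R -> R) (y : R) (U : R -> T -> C01 R).
Variables (V : R -> T -> I -> R) (m : R -> I -> R) (K : R -> I -> I -> R).
Hypothesis gamma_gt0 : forall e : R, 0 < e -> 0 < gamma e.
Hypothesis gamma_cvg : gamma e @[e --> 0^'+] --> 0.
Hypothesis U_E : forall e w t, 0 < e -> path_fun (U e w) t = m e t + V e w t.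
Hypothesis V_normal : forall e l, 0 < e ->
  centered_normal P (fun w => pair_list l (V e w)) (quad_list (K e) l l).
Hypothesis K_sym : forall e s t, K e s t = K e t s.
Hypothesis K_cvg : ucvg 0^'+ (fun e (p : I * I) => K e p.1 p.2 / gamma e ^+ 2)
  (fun p => q p.1 p.2).
Hypothesis m_cvg : ucvg 0^'+ m (fun=> y).
Hypothesis V_cvg : forall w, ucvg 0^'+ (fun e => V e w) (fun=> 0).

Lemma measurable_V e t : 0 < e -> measurable_fun setT (fun w => V e w t).
Proof.
move=> e0; have [mV _ _] := @V_normal e [:: (1, t)] e0.
have E w : V e w t = pair_list [:: (1, t)] (V e w) by rewrite /pair_list big_seq1 mul1r.
by under eq_fun do rewrite E.
Qed.

Lemma measurable_U e : 0 < e -> measurable_fun setT (U e : T -> borel (C01 R)).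
Proof.
move=> e0; apply: measurable_path => t; under eq_fun do rewrite U_E//.
by apply: measurable_funD => //; exact: measurable_V.
Qed.

Lemma measurable_preimage_open e (A : set (C01 R)) : 0 < e -> open A ->
  measurable (U e @^-1` A).
Proof.
move=> e0 oA; rewrite -[X in measurable X]setTI.
by apply: (measurable_U e0) => //; exact: sub_sigma_algebra.
Qed.

Lemma measurable_preimage_closed e (A : set (C01 R)) : 0 < e -> closed A ->
  measurable (U e @^-1` A).
Proof.
move=> e0 cA; rewrite -[X in measurable X]setCK; apply: measurableC.
by rewrite preimage_setC; apply: measurable_preimage_open => //; exact: closed_openC.
Qed.

Let small e s : set T := \bigcap_(p in [set: rat]) [set w | `|V e w (rat_time R p)| <= s].

Let measurable_small e s : 0 < e -> measurable (small e s).
Proof.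
move=> e0; apply: bigcap_rat_measurable => p.
rewrite (_ : [set _ | _] = (fun w => `|V e w (rat_time R p)|) @^-1` `]-oo, s]%classic).
  rewrite -[X in measurable X]setTI.
  have mV : measurable_fun setT (fun w => `|V e w (rat_time R p)|).
    by apply: measurableT_comp => //; exact: measurable_V.
  exact: mV.
by apply/seteqP; split=> w /=; rewrite in_itv.
Qed.

Lemma probability_small s : 0 < s ->
  \forall e \near 0^'+, ((2^-1 : R)%:E <= P (small e s))%E.
Proof.
move=> s0.
have H1 w : (fun e => \1_(small e s) w : R) @ 0^'+ --> (1 : R).
  apply/cvgrPdist_lt => c c0; apply: filterS (@V_cvg w s s0) => e he.
  rewrite indicE mem_set ?subrr ?normr0// => p _ /=.
  by have := he (rat_time R p); rewrite sub0r normrN => /ltW.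
have H2 : (fun e => \int[P]_w (\1_(small e s) w : R)) @ 0^'+ --> (1 : R).
  (* Bounded convergence is sequential, so the one-sided limit is tested along sequences of positive
     numbers tending to 0. *)
  apply/cvg_at_rightP => u [u0 uc].
  have := @cvg_Rintegral_bounded _ _ _ P (fun n w => \1_(small (u n) s) w) (cst 1) 1.
  rewrite Rintegral_cst_prob; apply.
  - by move=> n; apply: measurable_indic; exact: measurable_small.
  - by move=> w; exact: ((cvg_at_rightP _ _ _).1 (H1 w) u (conj u0 uc)).
  - by move=> n w; rewrite indicE; case: (_ \in _); rewrite ?normr1 ?normr0.
have half1 : (2^-1 : R) < 1 by rewrite invf_lt1// ltr1n.
apply: filterS2 (cvgr_ge _ H2 _ half1) (@nbhs_right_gt R 0) => e.
move=> + e0; rewrite Rintegral_indic_prob; last exact: measurable_small.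
move=> h; rewrite -[P _]fineK ?lee_fin//; apply: fin_num_measure.
exact: measurable_small.
Qed.

(** An enumeration of the pairs of rational times closer than [r]. The default [(0, 0)] is itself
    such a pair, so every index is admissible. *)
Let good_pair (r : R) (i : nat) : rat * rat :=
  if unpickle i is Some x then
    if `|time (rat_time R x.1) - time (rat_time R x.2)| < r then x else (0, 0)
  else (0, 0).

Let good_pair_near r i : 0 < r ->
  `|time (rat_time R (good_pair r i).1) - time (rat_time R (good_pair r i).2)| < r.
Proof.
move=> r0; rewrite /good_pair; case: unpickle => [x|]; last by rewrite subrr normr0.
by case: ifP => //; rewrite subrr normr0.
Qed.

Let good_pairK r a b : `|time (rat_time R a) - time (rat_time R b)| < r ->
  good_pair r (pickle (a, b)) = (a, b).
Proof. by move=> ab; rewrite /good_pair pickleK [LHS]ifT. Qed.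

(** [concentration] is applied to increments at level [2 * s]: paths bounded by [s] have increments
    at most [2 * s], an event of probability at least one half. Dividing by this half turns the
    factor 2 into 4. *)
Lemma increments_bound (e r s2 eta s : R) N : 0 < e -> 0 < r -> 0 < s2 -> 4 * s <= eta ->
  (forall u v, `|time u - time v| < r -> K e u u - 2 * K e u v + K e v v <= s2) ->
  ((2^-1 : R)%:E <= P (small e s))%E ->
  (P [set w | exists i : 'I_N, (eta < V e w (rat_time R (good_pair r i).1)
      - V e w (rat_time R (good_pair r i).2))%R]
   <= (4 * expR (- ((eta - 4 * s) ^+ 2 / (16 * s2))))%:E)%E.
Proof.
move=> e0 r0 s20 seta Kr Ps.
pose dl (i : 'I_N) : seq (R * I) := [:: (1, rat_time R (good_pair r i).1); (-1, rat_time R (good_pair r i).2)].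
pose D (i : 'I_N) w := V e w (rat_time R (good_pair r i).1)
      - V e w (rat_time R (good_pair r i).2).
have DE i w : pair_list (dl i) (V e w) = D i w by rewrite pair_list2 mul1r mulN1r.
pose Q i j := quad_list (K e) (dl i) (dl j).
have mD i : measurable_fun setT (D i) by apply: measurable_funB; exact: measurable_V.
have gD c : centered_normal P (fun w => \sum_(i < N) c i * D i w)
    (\sum_(i < N) \sum_(j < N) c i * c j * Q i j).
  pose L := [seq (c i, i) | i <- index_enum 'I_N].
  have QE : quad_list Q L L = \sum_(i < N) \sum_(j < N) c i * c j * Q i j.
    rewrite /quad_list /pair_list big_map; apply: eq_bigr => i _ /=; rewrite big_map mulr_sumr.
    by apply: eq_bigr => j _ /=; rewrite mulrA.
  have := @V_normal e (bind_list dl L) e0; rewrite quad_list_bind -/Q QE.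
  rewrite (_ : (fun w => _) = (fun w => \sum_(i < N) c i * D i w))//.
  apply/funext => w; rewrite pair_list_bind /pair_list big_map.
  by apply: eq_bigr => i _; rewrite -DE.
have Qs i : Q i i <= s2.
  apply: le_trans (Kr _ _ (good_pair_near i r0)); rewrite /Q /quad_list !pair_list2.
  set u := rat_time _ _; set v := rat_time _ _.
  by rewrite (K_sym e v u) le_eqVlt; apply/orP; left; apply/eqP; ring.
have s2eta : 2 * (2 * s) <= eta by lra.
have := concentration mD gD Qs s20 s2eta.
have -> : eta - 2 * (2 * s) = eta - 4 * s by ring.
set A := [set w | exists i, _]; set B := [set w | forall i, _].
have mB : measurable B.
  rewrite (_ : B = \bigcap_(i in [set: 'I_N]) [set w | D i w <= 2 * s]); last first.
    by apply/seteqP; split=> w h i; [move=> _; exact: h|exact: h].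
  apply: fin_bigcap_measurable => // i _.
  rewrite (_ : [set _ | _] = D i @^-1` `]-oo, (2 * s)%R]%classic).
    by rewrite -[X in measurable X]setTI; exact: mD.
  by apply/seteqP; split=> w /=; rewrite in_itv.
have mA : measurable A.
  rewrite (_ : A = \bigcup_(i in [set: 'I_N]) [set w | eta < D i w]); last first.
    by apply/seteqP; split=> w [i]; [exists i|move=> _; exists i].
  apply: fin_bigcup_measurable => // i _.
  rewrite (_ : [set _ | _] = D i @^-1` `]eta, +oo[%classic).
    by rewrite -[X in measurable X]setTI; exact: mD.
  by apply/seteqP; split=> w /=; rewrite in_itv/= andbT.
have : ((2^-1 : R)%:E <= P B)%E.
  apply: (le_trans Ps); apply: le_measure; rewrite ?inE//; first exact: measurable_small.
  move=> w sw i /=; rewrite /D.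
  have := sw (good_pair r i).1 Logic.I; have := sw (good_pair r i).2 Logic.I.
  by rewrite /= !ler_norml => /andP[? ?] /andP[? ?]; lra.
have fA : P A \is a fin_num by exact: fin_num_measure.
have fB : P B \is a fin_num by exact: fin_num_measure.
have A0 : (0 <= P A)%E by exact: measure_ge0.
rewrite -(fineK fA) -(fineK fB) -EFinM !lee_fin => hB hAB.
have : fine (P A) * 2^-1 <= fine (P A) * fine (P B) by rewrite ler_wpM2l// fine_ge0.
by move: hAB; set E := expR _; set a := fine _; set b := _ * fine _; lra.
Qed.

(* The smallness of the paths in probability, which [concentration] needs, comes
   for free from the pathwise convergence [V_cvg]. *)
Lemma modulus_bound (eta A : R) : 0 < eta -> exists2 r : R, 0 < r & \forall e \near 0^'+,
  (P (U e @^-1` ~` mod_set r eta) <= (4 * expR (- (A / gamma e ^+ 2)))%:E)%E.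
Proof.
move=> eta0; pose A1 := `|A| + 1; have A10 : 0 < A1 by rewrite ltr_wpDl.
(* [increments_bound] will be used with level [eta / 2] and [s = eta / 16], whose margin is
   [eta / 4]; then [(eta / 4) ^+ 2 / 16] is [eta ^+ 2 / 256], and the exponent becomes
   [A1 / gamma e ^+ 2]. *)
pose theta := eta ^+ 2 / (256 * A1).
have th0 : 0 < theta by rewrite divr_gt0 ?exprn_gt0 ?mulr_gt0.
(* The rescaled variance of an increment is bounded by two variations of [q] and four approximation
   errors, each at most [theta / 8]. *)
have th8 : 0 < theta / 8 by rewrite divr_gt0.
(* The mean is within [eta / 4] of [y] at both times; an increment of [U] above [eta] thus leaves
   more than [eta / 2] to [V]. *)
have eta4 : 0 < eta / 4 by rewrite divr_gt0.
have eta16 : 0 < eta / 16 by rewrite divr_gt0.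
have [r r0 qr] := kernel_modulus q_continuous th8.
exists r => //; apply: filterS3 (K_cvg th8) (filterI (m_cvg eta4) (probability_small eta16))
  (@nbhs_right_gt R 0) => e hK [hm hs] e0.
have g0 : 0 < gamma e by exact: gamma_gt0.
have g20 : 0 < gamma e ^+ 2 by rewrite exprn_gt0.
pose s2 := gamma e ^+ 2 * theta; have s20 : 0 < s2 by rewrite mulr_gt0.
have Kr u v : `|time u - time v| < r -> K e u u - 2 * K e u v + K e v v <= s2.
  move=> uv; have uu (w : I) : `|time w - time w| < r by rewrite subrr normr0.
  have h1 := qr u u u v (uu u) uv; have h2 := qr v v u v (uu v) uv.
  have /= k1 := hK (u, u); have /= k2 := hK (u, v); have /= k3 := hK (v, v).
  have E a b : exists2 c, K e a b = gamma e ^+ 2 * c & K e a b / gamma e ^+ 2 = c.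
    by exists (K e a b / gamma e ^+ 2) => //; rewrite mulrC divfK// gt_eqF.
  have [a Ea Ka] := E u u; have [b Eb Kb] := E u v; have [c Ec Kc] := E v v.
  rewrite Ka in k1; rewrite Kb in k2; rewrite Kc in k3; rewrite Ea Eb Ec /s2.
  move: h1 h2 (g20) k1 k2 k3; rewrite (q_sym v u); move: (gamma e ^+ 2) => G.
  move: (q u u) (q u v) (q v v) => x z w.
  rewrite ler_norml => /andP[? ?]; rewrite ler_norml => /andP[? ?] G0.
  rewrite ltr_norml => /andP[? ?]; rewrite ltr_norml => /andP[? ?].
  rewrite ltr_norml => /andP[? ?].
  rewrite (_ : _ + _ = G * (a - 2 * b + c)); last by ring.
  by rewrite ler_pM2l//; lra.
have e2 : 4 * (eta / 16) <= eta / 2 by lra.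
have bound N := @increments_bound e r s2 (eta / 2) (eta / 16) N e0 r0 s20 e2 Kr hs.
apply: (@le_trans _ _ (P (\bigcup_i [set w | eta / 2 < V e w (rat_time R (good_pair r i).1)
      - V e w (rat_time R (good_pair r i).2)]))).
  apply: le_measure; rewrite ?inE.
  - by apply: measurable_preimage_open => //; exact/closed_openC/closed_mod_set.
  - apply: bigcup_measurable => i _.
    have mD : measurable_fun setT (fun w => V e w (rat_time R (good_pair r i).1)
      - V e w (rat_time R (good_pair r i).2)) by apply: measurable_funB; exact: measurable_V.
    rewrite (_ : [set _ | _] = (fun w => V e w (rat_time R (good_pair r i).1)
      - V e w (rat_time R (good_pair r i).2)) @^-1` `](eta / 2), +oo[%classic).
      by rewrite -[X in measurable X]setTI; exact: mD.
    by apply/seteqP; split=> w /=; rewrite in_itv/= andbT.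
  move=> w /= nU; apply: contrapT => H; apply: nU; apply/mod_set_rat => a b ab.
  rewrite leNgt; apply/negP => lt; apply: H.
  exists (pickle (a, b)); first exact: Logic.I.
  rewrite [good_pair _ _]good_pairK//.
  change (eta / 2 < V e w (rat_time R a) - V e w (rat_time R b)).
  move: lt; rewrite !U_E//; have := hm (rat_time R a); have := hm (rat_time R b).
  by rewrite !ltr_norml => /andP[? ?] /andP[? ?]; lra.
apply: measure_bigcup_le => [i|N].
  have mD : measurable_fun setT (fun w => V e w (rat_time R (good_pair r i).1)
      - V e w (rat_time R (good_pair r i).2)) by apply: measurable_funB; exact: measurable_V.
  rewrite (_ : [set _ | _] = (fun w => V e w (rat_time R (good_pair r i).1)
      - V e w (rat_time R (good_pair r i).2)) @^-1` `](eta / 2), +oo[%classic).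
    by rewrite -[X in measurable X]setTI; exact: mD.
  by apply/seteqP; split=> w /=; rewrite in_itv/= andbT.
apply: le_trans (bound N) _; rewrite lee_fin ler_pM2l// ler_expR lerN2.
have -> : (eta / 2 - 4 * (eta / 16)) ^+ 2 / (16 * s2) = A1 / gamma e ^+ 2.
  by rewrite /s2 /theta; field; rewrite !gt_eqF.
by rewrite ler_pM2r ?invr_gt0// /A1 (le_trans (ler_norm _))// lerDl.
Qed.

(** An upper bound by [- a] on the exponential rate, written without logarithms. The slack [delta]
    absorbs constant factors, which makes the class stable under finite unions of measurable
    sets. *)
Definition expo_small (a : R) (E : set (C01 R)) : Prop := forall delta : R, 0 < delta ->
  \forall e \near 0^'+, (P (U e @^-1` E) <= (expR (- ((a - delta) / gamma e ^+ 2)))%:E)%E.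

Lemma gamma2_small c : 0 < c -> \forall e \near 0^'+, gamma e ^+ 2 < c.
Proof.
move=> c0; have g2 : gamma e ^+ 2 @[e --> 0^'+] --> (0 : R).
  by rewrite -[X in _ --> X](mulr0 (0 : R)); exact: (cvgM gamma_cvg gamma_cvg).
exact: cvgr_lt g2 _ c0.
Qed.

Lemma expo_small_bound (a c delta : R) : 0 < c -> 0 < delta ->
  \forall e \near 0^'+, c * expR (- (a / gamma e ^+ 2)) <= expR (- ((a - delta) / gamma e ^+ 2)).
Proof.
move=> c0 d0; have lc : 0 < delta / (`|ln c| + 1) by rewrite divr_gt0// ltr_wpDl.
apply: filterS2 (gamma2_small lc) (@nbhs_right_gt R 0) => e ge e0.
have g20 : 0 < gamma e ^+ 2 by rewrite exprn_gt0// gamma_gt0.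
rewrite -{1}(lnK (x := c)) ?posrE// -expRD ler_expR mulrBl opprB lerD2r.
rewrite ler_pdivlMr// (le_trans _ (ltW (_ : (`|ln c| + 1) * gamma e ^+ 2 < _)))//.
  by rewrite ler_wpM2r ?(ltW g20)// (le_trans (ler_norm _))// lerDl.
by rewrite mulrC -ltr_pdivlMr// ltr_wpDl.
Qed.

Lemma expo_smallU a E E' : (forall e, 0 < e -> measurable (U e @^-1` E)) ->
  (forall e, 0 < e -> measurable (U e @^-1` E')) ->
  expo_small a E -> expo_small a E' -> expo_small a (E `|` E').
Proof.
move=> mE mE' sE sE' delta d0; have d2 : 0 < delta / 2 by rewrite divr_gt0.
apply: filterS3 (filterI (sE _ d2) (sE' _ d2))
  (@expo_small_bound (a - delta / 2) 2 (delta / 2) _ d2) (@nbhs_right_gt R 0) => // e [h h'] hb e0.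
rewrite preimage_setU (le_trans (measureU2 _ _ _))//; [exact: mE|exact: mE'|].
rewrite (le_trans (leeD h h'))// -EFinD lee_fin.
set z := expR _ in hb *; rewrite (_ : z + z = 2 * z); last by ring.
rewrite (le_trans hb)//.
by rewrite ler_expR lerN2 ler_wpM2r ?invr_ge0 ?sqr_ge0//; lra.
Qed.

Lemma expo_small_mod_set (eta a : R) : 0 < eta -> exists2 r : R, 0 < r &
  expo_small a (~` mod_set r eta).
Proof.
move=> eta0; have [r r0 H] := modulus_bound a eta0; exists r => // delta d0.
apply: filterS2 H (@expo_small_bound a 4 delta _ d0) => // e h hb.
by rewrite (le_trans h)// lee_fin.
Qed.

Lemma quad_K_cvg l l' (c : R) : 0 < c -> \forall e \near 0^'+,
  `|quad_list q l l' - quad_list (K e) l l' / gamma e ^+ 2| < c.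
Proof.
move=> c0; have m0 : 0 < mass_list l * mass_list l' + 1.
  by rewrite ltr_wpDl// mulr_ge0// mass_list_ge0.
apply: filterS (K_cvg (divr_gt0 c0 m0)) => e hK.
rewrite /quad_list mulrC -pair_listZ.
apply: (@le_lt_trans _ _ (mass_list l * (mass_list l' * (c / (mass_list l * mass_list l' + 1))))).
  apply: pair_list_dist => s; rewrite -pair_listZ; apply: pair_list_dist => t.
  by have := hK (s, t); rewrite mulrC => /ltW.
by rewrite mulrA mulrCA -[ltRHS]mulr1 ltr_pM2l// ltr_pdivrMr// mul1r ltrDl.
Qed.

Lemma pair_m_cvg l (c : R) : 0 < c -> \forall e \near 0^'+,
  `|pair_list l (fun t => m e t - y)| < c.
Proof.
move=> c0; have m0 : 0 < mass_list l + 1 by rewrite ltr_wpDl// mass_list_ge0.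
apply: filterS (m_cvg (divr_gt0 c0 m0)) => e hm.
have := @pair_list_dist _ _ l (fun t => m e t - y) (fun=> 0) (c / (mass_list l + 1)).
have -> : pair_list l (fun=> 0 : R) = 0.
  by rewrite /pair_list big1// => p _; rewrite mulr0.
rewrite subr0 => h; apply: le_lt_trans (h _) _.
  by move=> t; rewrite subr0 distrC ltW.
by rewrite mulrCA -[ltRHS]mulr1 ltr_pM2l// ltr_pdivrMr// mul1r ltrDl.
Qed.

(** Exponential Markov at [h = (gamma e ^+ 2)^-1]: the variance contributes [quad_list q l l / 2] to
    the limiting exponent, exactly what the threshold adds to [a]. Half of [delta] pays for the
    mean, half for the variance. *)
Lemma expo_small_half_space l a :
  expo_small a (half_space l y (a + quad_list q l l / 2)).
Proof.
move=> delta d0; have d2 : 0 < delta / 2 by rewrite divr_gt0.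
apply: filterS3 (quad_K_cvg l l d0) (pair_m_cvg l d2) (@nbhs_right_gt R 0) => e hK hm e0.
have g20 : 0 < gamma e ^+ 2 by rewrite exprn_gt0// gamma_gt0.
have nY := @V_normal e l e0.
have [mY _ _] := nY.
pose x := a + quad_list q l l / 2 - delta / 2.
have h0 : 0 <= (gamma e ^+ 2)^-1 by rewrite invr_ge0 ltW.
apply: (@le_trans _ _ (P [set w | (x <= pair_list l (V e w))%R])).
  apply: le_measure; rewrite ?inE.
  - by apply: measurable_preimage_open => //; exact: open_half_space.
  - rewrite (_ : [set _ | _] = (fun w => pair_list l (V e w)) @^-1` `[x, +oo[%classic).
      by rewrite -[X in measurable X]setTI; exact: mY.
    by apply/seteqP; split=> w /=; rewrite in_itv/= andbT.
  move=> w /=; rewrite /half_space/=.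
  have -> : pair_list l (fun t => path_fun (U e w) t - y)
      = pair_list l (fun t => m e t - y) + pair_list l (V e w).
    by rewrite -pair_listD; congr pair_list; apply/funext => t; rewrite U_E//; ring.
  by move: hm; rewrite /x ltr_norml => /andP[? ?] ?; lra.
apply: (le_trans (centered_normal_markov nY x h0)); rewrite lee_fin ler_expR.
move: hK; set b := quad_list (K e) l l.
have -> : (gamma e ^+ 2)^-1 ^+ 2 * b / 2 - (gamma e ^+ 2)^-1 * x
   = (b / gamma e ^+ 2 / 2 - x) / gamma e ^+ 2.
  by field; rewrite gt_eqF// gamma_gt0.
rewrite -[X in _ <= X]mulNr ler_pM2r ?invr_gt0//; move: (b / _) => c; rewrite /x ltr_norml => /andP[? ?].
by lra.
Qed.

Lemma gaussian_rate_mod_set (a eta : R) : 0 < eta -> exists2 r, 0 < r &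
  forall h, (gaussian_rate q y h <= a%:E)%E -> mod_set r eta h.
Proof.
(* With this weight [a] is at most [c * (eta / 2)], and variations of [q] below [eta / (2 * c)] keep
   the quadratic cost within [c * (eta / 2)] as well. *)
move=> eta0; pose c := 2 * (`|a| + 1) / eta.
have a1 : 0 < `|a| + 1 by rewrite ltr_wpDl.
have c0 : 0 < c by rewrite divr_gt0// mulr_gt0.
have th0 : 0 < eta / (2 * c) by rewrite divr_gt0// mulr_gt0.
have [r r0 qr] := kernel_modulus q_continuous th0.
exists r => // h ha.
have main s t : `|time s - time t| < r -> path_fun h s - path_fun h t <= eta.
  move=> st; have uu (w : I) : `|time w - time w| < r by rewrite subrr normr0.
  have h1 := qr s s s t (uu s) st; have h2 := qr t t s t (uu t) st.
  have := gaussian_rate_list q_continuous q_sym q_psd ha [:: (c, s); (- c, t)].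
  rewrite /quad_list !pair_list2 (q_sym t s) in h2 * => hl; rewrite -(ler_pM2l c0).
  have ac : a <= c * (eta / 2).
    have -> : c * (eta / 2) = `|a| + 1 by rewrite /c; field; rewrite gt_eqF.
    by rewrite (le_trans (ler_norm _))// lerDl.
  have cc : c * (eta / (2 * c)) = eta / 2 by field; rewrite gt_eqF.
  have H : c * (c * (q s s - 2 * q s t + q t t) / 2) <= c * (eta / 2).
    rewrite ler_pM2l// -cc -mulrA ler_pM2l//.
    by move: h1 h2; rewrite !ler_norml => /andP[? ?] /andP[? ?]; lra.
  exact: (scaled_increment_le H ac hl).
by move=> s t st; rewrite ler_norml lerNl opprB !main// distrC.
Qed.

(** The common core of compactness and of the upper bound: moduli give a limit, and since
    half-spaces are open, avoiding them passes to this limit, whose rate is then bounded list by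
    list. *)
Lemma ultra_rate_limit (F : set_system (C01 R)) (a : R) : UltraFilter F ->
  (forall eta : R, 0 < eta -> exists2 r : R, 0 < r & F (mod_set r eta)) ->
  (forall l, F (~` half_space l y (a + quad_list q l l / 2))) ->
  exists2 g, F --> g & (gaussian_rate q y g <= a%:E)%E.
Proof.
move=> UF Fmod Fhalf.
have [//|t|g Fg] := ultra_cvg_path UF.
- exists (`|a| + `|q t t| + `|y|); apply: filterS2 (Fhalf [:: (1, t)]) (Fhalf [:: (-1, t)]) => g.
  rewrite /half_space /quad_list /pair_list /= !big_seq1 /=.
  rewrite !mul1r !mulN1r opprK => /negP; rewrite -leNgt => h1 /negP.
  rewrite -leNgt => h2.
  exact: abs_path_le.
exists g => //; apply: (list_rate_le q_continuous q_sym q_psd q_zero) => l.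
rewrite lerBlDr leNgt; apply/negP => gl.
have := Fg (half_space l y (a + quad_list q l l / 2)).
have ol : nbhs g (half_space l y (a + quad_list q l l / 2)).
  by apply: open_nbhs_nbhs; split => //; exact: open_half_space.
move=> /(_ ol) F1; exact: (ultra_setC UF F1 (Fhalf l)).
Qed.

Lemma compact_gaussian_rate (a : R) : compact [set h | (gaussian_rate q y h <= a%:E)%E].
Proof.
rewrite compact_ultra => F UF Fa.
have [eta eta0|l|g Fg ga] := @ultra_rate_limit F a UF; last by exists g.
  have [r r0 H] := gaussian_rate_mod_set a eta0; exists r => //.
  by apply: filterS Fa.
apply: filterS Fa => h ha; rewrite /half_space /=; apply/negP; rewrite -leNgt -lerBlDr.
exact: gaussian_rate_list.
Qed.

(* Otherwise some ultrafilter on [F] avoids every exponentially small set; the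
   modulus bound makes it converge, and the half-spaces make the rate of its
   limit at most [a]. *)
Lemma expo_small_closed (F : set (C01 R)) (a : R) : closed F ->
  (forall g, F g -> ~ (gaussian_rate q y g <= a%:E)%E) -> expo_small a F.
Proof.
move=> cF HF; apply: contrapT => nF.
(* The trace filter on [F] modulo exponentially small sets. Were it improper, [F] would lie inside
   an exponentially small set and be one itself. *)
pose G := [set A : set (C01 R) | exists E, [/\ forall e, 0 < e -> measurable (U e @^-1` E),
  expo_small a E & F `\` E `<=` A]].
have GF : ProperFilter G.
  apply: Build_ProperFilter; last apply: Build_Filter.
  - move=> [E [mE sE FE]]; apply: nF => delta d0.
    apply: filterS2 (sE _ d0) (@nbhs_right_gt R 0) => e h e0.
    apply: le_trans h; apply: le_measure; rewrite ?inE; [exact: measurable_preimage_closed|exact: mE|].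
    move=> w Fw; apply: contrapT => nE; exact: (FE (U e w)).
  - exists set0; split=> // [e e0|delta d0]; first by rewrite preimage_set0.
    by apply: nearW => e; rewrite preimage_set0 measure0 lee_fin expR_ge0.
  - move=> A B [E [mE sE EA]] [E' [mE' sE' EB]]; exists (E `|` E'); split.
    + by move=> e e0; rewrite preimage_setU; apply: measurableU; [exact: mE|exact: mE'].
    + exact: expo_smallU.
    + by move=> g [Fg /not_orP[nE nE']]; split; [exact: EA|exact: EB].
  - by move=> A B AB [E [mE sE EA]]; exists E; split=> //; exact: subset_trans AB.
have [W [UW GW]] := ultraFilterLemma GF.
have Wsmall E : (forall e, 0 < e -> measurable (U e @^-1` E)) -> expo_small a E -> W (~` E).
  by move=> mE sE; apply: GW; exists E; split=> // g [].
have [eta eta0|l|g Wg ga] := @ultra_rate_limit W a UW.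
- have [r r0 sr] := expo_small_mod_set a eta0; exists r => //; rewrite -[mod_set _ _]setCK.
  apply: Wsmall => // e e0; apply: measurable_preimage_open => //.
  exact/closed_openC/closed_mod_set.
- apply: Wsmall; last exact: expo_small_half_space.
  by move=> e e0; apply: measurable_preimage_open => //; exact: open_half_space.
apply: HF ga; apply: contrapT => nFg.
have WF : W F.
  apply: GW; exists set0; split=> [e e0|delta d0|h []//]; first by rewrite preimage_set0.
  by apply: nearW => e; rewrite preimage_set0 measure0 lee_fin expR_ge0.
have ol : nbhs g (~` F) by apply: open_nbhs_nbhs; split => //; exact: closed_openC.
exact: (ultra_setC UW WF (Wg _ ol)).
Qed.

Lemma limf_esup_rate (F : set (C01 R)) (a : R) : expo_small a F ->
  (limf_esup (fun e : R => (gamma e ^+ 2)%:E * lne (P (U e @^-1` F))) 0^'+ <= (- a)%:E)%E.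
Proof.
move=> sF; apply/lee_addgt0Pr => delta d0.
apply: ereal_inf_le.
exists (ereal_sup ((fun e : R => ((gamma e ^+ 2)%:E * lne (P (U e @^-1` F)))%E) @`
   [set e : R | 0 < e /\ (P (U e @^-1` F) <= (expR (- ((a - delta) / gamma e ^+ 2)))%:E)%E])).
  eexists; last reflexivity.
  by apply: filterS2 (@nbhs_right_gt R 0) (sF _ d0) => e; split.
apply: ge_ereal_sup => _ [e [e0 he] <-].
have g20 : 0 < gamma e ^+ 2 by rewrite exprn_gt0// gamma_gt0.
have -> : ((- a)%:E + delta%:E = (gamma e ^+ 2)%:E * (- ((a - delta) / gamma e ^+ 2))%:E)%E.
  by rewrite -EFinD -EFinM; congr EFin; field; rewrite gt_eqF// gamma_gt0.
rewrite lee_pmul2l//.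
rewrite (@le_trans _ _ (lne (expR (- ((a - delta) / gamma e ^+ 2)))%:E))//; last first.
  by rewrite lne_EFin ?expR_gt0// expRK.
by rewrite lee_lne// in_itv/= leey andbT ?lee_fin ?expR_ge0.
Qed.

(** The density of the tilted law times an exponential of [l'] is the exponential of a single list,
    the concatenation of [l] and [l'] with weights [h] and [r], whose Laplace transform is known. *)
Lemma tilted_exp l l' (e h r x : R) : 0 < e ->
  let F w := expR (h * pair_list l (V e w) - h ^+ 2 * quad_list (K e) l l / 2)
    * expR (r * (pair_list l' (V e w) - x)) in
  P.-integrable setT (EFin \o F) /\
  \int[P]_w F w = expR (h * r * quad_list (K e) l l' + r ^+ 2 * quad_list (K e) l' l' / 2 - r * x).
Proof.
move=> e0 F.
have nY := @V_normal e (scale_list h l ++ scale_list r l') e0.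
pose b := - (h ^+ 2 * quad_list (K e) l l / 2) - r * x.
have FE w : F w = expR b * expR (1 * pair_list (scale_list h l ++ scale_list r l') (V e w)).
  by rewrite /F /b -!expRD pair_list_cat !pair_list_scale; congr expR; ring.
have i := integrable_centered_normal_exp nY 1.
have -> : F = (fun w => expR b * expR (1 * pair_list (scale_list h l ++ scale_list r l') (V e w))).
  exact/funext.
split; first exact: (integrableZl measurableT (expR b) i).
rewrite (RintegralZl (expR b) measurableT i) (Rintegral_centered_normal_exp nY).
rewrite quad_list_combine; last exact: K_sym.
by rewrite -expRD /b; congr expR; field.
Qed.

(** The Chernoff exponent before division by [gamma ^+ 2], chosen so that [shift * (quad_list q l'
    l' + 1) = kappa / 2]; the 1 leaves room for replacing [q] by the rescaled [K] and covers a
    degenerate [l']. *)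
Let shift (kappa : R) l' : R := kappa / (2 * (quad_list q l' l' + 1)).

Let shift_gt0 kappa l' : 0 < kappa -> 0 < shift kappa l'.
Proof. by move=> k0; rewrite divr_gt0// mulr_gt0// ltr_wpDl. Qed.

(** Under the tilted law the mean of [l'] tends to [quad_list q l l']. Of the excess [kappa], a
    quarter covers the error on the mean and a quarter the Chernoff variance term, so half survives
    in the exponent. *)
Lemma tilted_exp_small l l' (kappa delta : R) : 0 < kappa -> 0 < delta ->
  \forall e \near 0^'+, expR ((gamma e ^+ 2)^-1 * (shift kappa l' / gamma e ^+ 2) * quad_list (K e) l l'
    + (shift kappa l' / gamma e ^+ 2) ^+ 2 * quad_list (K e) l' l' / 2
    - shift kappa l' / gamma e ^+ 2 * (quad_list q l l' + kappa)) <= delta.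
Proof.
move=> k0 d0; have s0 := shift_gt0 l' k0; set s := shift kappa l' in s0 *.
have k4 : 0 < kappa / 4 by rewrite divr_gt0.
have a0 : 0 < s * (kappa / 2) by rewrite mulr_gt0// divr_gt0.
have dV : 0 < delta^-1 by rewrite invr_gt0.
(* [expo_small_bound] is used with equal rate and slack: its right-hand side is then 1, and with
   constant [delta^-1] it says that the exponential is at most [delta]. *)
apply: filterS3 (filterI (quad_K_cvg l l' k4) (quad_K_cvg l' l' ltr01))
  (@expo_small_bound (s * (kappa / 2)) _ _ dV a0) (@nbhs_right_gt R 0) => e [h1 h2] hb e0.
have g0 := gamma_gt0 e0; have g20 : 0 < gamma e ^+ 2 by rewrite exprn_gt0.
move: hb; rewrite subrr mul0r oppr0 expR0 mulrC ler_pdivrMr// mul1r.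
apply: le_trans; rewrite ler_expR.
have -> : (gamma e ^+ 2)^-1 * (s / gamma e ^+ 2) * quad_list (K e) l l'
    + (s / gamma e ^+ 2) ^+ 2 * quad_list (K e) l' l' / 2
    - s / gamma e ^+ 2 * (quad_list q l l' + kappa)
  = s * (quad_list (K e) l l' / gamma e ^+ 2 + s * (quad_list (K e) l' l' / gamma e ^+ 2) / 2
      - (quad_list q l l' + kappa)) / gamma e ^+ 2 by field; rewrite gt_eqF.
rewrite -[X in _ <= X]mulNr ler_pM2r ?invr_gt0// -mulrN ler_pM2l//.
have h3 : s * (quad_list (K e) l' l' / gamma e ^+ 2) <= kappa / 2.
  have -> : kappa / 2 = s * (quad_list q l' l' + 1).
    by rewrite /s /shift; field; rewrite gt_eqF// ltr_wpDl.
  by rewrite ler_pM2l//; move: h2; rewrite ltr_norml => /andP[? ?]; lra.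
by move: h1 h3; rewrite ltr_norml => /andP[? ?] ?; lra.
Qed.

Lemma sum_tilted_small l (Ls : seq (seq (R * I))) (kappa delta : R) : 0 < kappa -> 0 < delta ->
  \forall e \near 0^'+, \sum_(l' <- Ls)
    expR ((gamma e ^+ 2)^-1 * (shift kappa l' / gamma e ^+ 2) * quad_list (K e) l l'
    + (shift kappa l' / gamma e ^+ 2) ^+ 2 * quad_list (K e) l' l' / 2
    - shift kappa l' / gamma e ^+ 2 * (quad_list q l l' + kappa)) <= delta.
Proof.
move=> k0; elim: Ls delta => [|l' Ls IH] delta d0.
  by apply: nearW => e; rewrite big_nil ltW.
have d2 : 0 < delta / 2 by rewrite divr_gt0.
apply: filterS2 (IH _ d2) (@tilted_exp_small l l' _ _ k0 d2) => e h1 h2.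
by rewrite big_cons (splitr delta) lerD.
Qed.

(* The density [L] of the tilted law has mean 1. It is at most [c] where [l] is
   not too large, and each way of missing [G] costs an exponential moment under
   the tilted law or, for the modulus, [c] times the original probability. *)
Lemma tilted_lower_bound l (Ls : seq (seq (R * I))) (kappa eta r : R) (G : set (C01 R)) :
  0 < kappa -> l \in Ls ->
  (\forall e \near 0^'+, (P (U e @^-1` ~` mod_set r eta) <=
    (4 * expR (- ((quad_list q l l / 2 + 2 * kappa + 1) / gamma e ^+ 2)))%:E)%E) ->
  open G ->
  (\forall e \near 0^'+, forall w, mod_set r eta (U e w) ->
    (forall l', l' \in Ls -> pair_list l' (V e w) <= quad_list q l l' + kappa) -> G (U e w)) ->
  \forall e \near 0^'+, ((expR (- ((quad_list q l l / 2 + 3 * kappa) / gamma e ^+ 2)))%:E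
     <= P (U e @^-1` G))%E.
Proof.
move=> k0 lLs hW oG hG.
have k2 : 0 < 2 * kappa by rewrite mulr_gt0.
have q4 : (0 : R) < 1 / 4 by rewrite divr_gt0.
(* The mean 1 of the density is shared out: a quarter for the tilted moments, a quarter for the
   modulus, at least a half for [G]. The constant 16 makes the factor 4 of the modulus bound fit in
   a quarter, and 2 absorbs the final half. *)
apply: filterS3 (filterI (filterI hW hG) (quad_K_cvg l l k2))
  (filterI (sum_tilted_small l Ls k0 q4)
     (filterI (@expo_small_bound 1 16 1 _ _) (@expo_small_bound (quad_list q l l / 2 + 3 * kappa) 2 kappa _ k0)))
  (@nbhs_right_gt R 0) => // e [[{}hW {}hG] hK] [hsum [h16 h2]] e0.
have g0 := gamma_gt0 e0; have g20 : 0 < gamma e ^+ 2 by rewrite exprn_gt0.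
pose h := (gamma e ^+ 2)^-1; have h0 : 0 < h by rewrite invr_gt0.
pose v := quad_list (K e) l l; pose Q0 := quad_list q l l.
pose s l' := shift kappa l' / gamma e ^+ 2.
have s0 l' : 0 < s l' by rewrite divr_gt0// shift_gt0.
pose L w := expR (h * pair_list l (V e w) - h ^+ 2 * v / 2).
(* Where [l] is at most [Q0 + kappa], and since [v / gamma e ^+ 2] exceeds [Q0 - 2 * kappa], the
   rescaled exponent of [L] is at most [Q0 + kappa - (Q0 / 2 - kappa)]. *)
pose c := expR ((Q0 / 2 + 2 * kappa) / gamma e ^+ 2).
pose W := U e @^-1` ~` mod_set r eta; pose A := U e @^-1` G.
have mA : measurable A by exact: measurable_preimage_open.
have mW : measurable W by apply: measurable_preimage_open => //; exact/closed_openC/closed_mod_set.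
pose F l' w := L w * expR (s l' * (pair_list l' (V e w) - (quad_list q l l' + kappa))).
have LF l' w : quad_list q l l' + kappa < pair_list l' (V e w) -> L w <= F l' w.
  move=> lt; rewrite /F ler_peMr ?expR_ge0// -expR0 ler_expR mulr_ge0 ?subr_ge0 ?ltW//.
have Lc w : pair_list l (V e w) <= Q0 + kappa -> L w <= c.
  move=> le; rewrite /L /c ler_expR.
  have -> : h * pair_list l (V e w) - h ^+ 2 * v / 2
    = (pair_list l (V e w) - v / gamma e ^+ 2 / 2) / gamma e ^+ 2.
    by rewrite /h; field; rewrite gt_eqF.
  rewrite ler_pM2r ?invr_gt0//.
  by move: hK; rewrite -/v -/Q0 ltr_norml => /andP[? ?]; lra.
have F0 l' w : 0 <= F l' w by rewrite mulr_ge0 ?expR_ge0.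
have sumF0 w : 0 <= \sum_(l' <- Ls) F l' w by exact: sumr_ge0.
have key w : L w <= c * \1_A w + (c * \1_W w + \sum_(l' <- Ls) F l' w).
  have c0 : 0 < c by exact: expR_gt0.
  have i0 (B : set T) : 0 <= c * \1_B w by rewrite indicE mulr_ge0 ?(ltW c0).
  have [[l' l'Ls lt]|nb] := pselect (exists2 l', l' \in Ls &
      quad_list q l l' + kappa < pair_list l' (V e w)).
    apply: (le_trans (LF _ _ lt)); rewrite (big_rem _ l'Ls)/=.
    have : 0 <= \sum_(j <- rem l' Ls) F j w by exact: sumr_ge0.
    by have := i0 A; have := i0 W; lra.
  have good l' : l' \in Ls -> pair_list l' (V e w) <= quad_list q l l' + kappa.
    by move=> l'Ls; rewrite leNgt; apply/negP => lt; apply: nb; exists l'.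
  have Lw := Lc w (good _ lLs).
  have [Uw|nUw] := pselect (mod_set r eta (U e w)).
    have Aw : A w by exact: hG.
    rewrite [\1_A w]indicE mem_set// mulr1 (le_trans Lw)// lerDl addr_ge0//.
  rewrite [\1_W w]indicE mem_set// mulr1 (le_trans Lw)//.
  by have := i0 A; have := sumF0 w; lra.
have iF l' := (@tilted_exp l l' e h (s l') (quad_list q l l' + kappa) e0).1.
have iind (B : set T) : measurable B -> P.-integrable setT (EFin \o (fun w => c * \1_B w)).
  move=> mB; apply: (@bounded_integrable _ _ _ P _ c) => [|w].
    by apply: measurable_funM => //; exact: measurable_indic.
  by rewrite normrM ger0_norm ?expR_ge0// indicE; case: (_ \in _);
    rewrite ?normr1 ?mulr1// normr0 mulr0 expR_ge0.
have isum : P.-integrable setT (EFin \o (fun w => \sum_(l' <- Ls) F l' w)) /\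
    \int[P]_w (\sum_(l' <- Ls) F l' w) = \sum_(l' <- Ls) (\int[P]_w F l' w).
  elim: Ls {lLs hG hsum sumF0 key} => [|l' Ls [IH1 IH2]].
    split; last by under eq_Rintegral do rewrite big_nil; rewrite big_nil; exact: Rintegral_cst_prob.
    apply: (@bounded_integrable _ _ _ P _ 0) => [|w]; last by rewrite big_nil normr0.
    by under eq_fun do rewrite big_nil; exact: measurable_cst.
  have E : (fun w => \sum_(j <- l' :: Ls) F j w) = (fun w => F l' w + \sum_(j <- Ls) F j w).
    by apply/funext => w; rewrite big_cons.
  rewrite E; split; first exact: (integrableD measurableT (iF l') IH1).
  by rewrite (RintegralD measurableT (iF l') IH1) IH2 big_cons.
have iL : P.-integrable setT (EFin \o L) /\ \int[P]_w L w = 1.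
  have [i E] := @tilted_exp l [::] e h 0 0 e0.
  have LE : L = (fun w => expR (h * pair_list l (V e w) - h ^+ 2 * quad_list (K e) l l / 2)
    * expR (0 * (pair_list [::] (V e w) - 0))).
    by apply/funext => w; rewrite mul0r expR0 mulr1.
  rewrite LE; split=> //; rewrite E.
  by rewrite mulr0 mul0r expr0n/= !mul0r subr0 addr0 expR0.
have iR := integrableD measurableT (iind _ mA) (integrableD measurableT (iind _ mW) isum.1).
have := le_Rintegral measurableT iL.1 iR (fun w _ => key w).
rewrite iL.2 (RintegralD measurableT (iind _ mA) (integrableD measurableT (iind _ mW) isum.1)).
rewrite (RintegralD measurableT (iind _ mW) isum.1) isum.2.
have ind (B : set T) : measurable B -> \int[P]_w (c * \1_B w) = c * fine (P B).
  move=> mB; have j : P.-integrable setT (EFin \o (\1_B : T -> R)).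
    apply: (@bounded_integrable _ _ _ P _ 1) => [|w]; first exact: measurable_indic.
    by rewrite indicE; case: (_ \in _); rewrite ?normr1 ?normr0.
  by rewrite (RintegralZl c measurableT j) Rintegral_indic_prob.
rewrite !ind//.
have sumE : \sum_(l' <- Ls) (\int[P]_w F l' w) <= 1 / 4.
  apply: le_trans hsum; rewrite le_eqVlt; apply/orP; left; apply/eqP; apply: eq_bigr => l' _.
  exact: (@tilted_exp l l' e h (s l') (quad_list q l l' + kappa) e0).2.
have fA : P A \is a fin_num by exact: fin_num_measure.
have fW : P W \is a fin_num by exact: fin_num_measure.
have cW : c * fine (P W) <= 1 / 4.
  have : fine (P W) <= 4 * expR (- ((Q0 / 2 + 2 * kappa + 1) / gamma e ^+ 2)).
    by rewrite -lee_fin fineK.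
  rewrite -(ler_pM2l (expR_gt0 ((Q0 / 2 + 2 * kappa) / gamma e ^+ 2))) -/c => /le_trans; apply.
  rewrite mulrCA /c -expRD.
  have -> : (Q0 / 2 + 2 * kappa) / gamma e ^+ 2 + - ((Q0 / 2 + 2 * kappa + 1) / gamma e ^+ 2)
    = - (1 / gamma e ^+ 2) by field; rewrite gt_eqF.
  by move: h16; rewrite subrr mul0r oppr0 expR0; set z := expR _; lra.
move=> hl; have hA : 1 / 2 <= c * fine (P A).
  by move: hl cW sumE; set u := \sum_(_ <- _) _; set a := c * _; set b := c * _; lra.
rewrite -(fineK fA) lee_fin -(ler_pM2l (expR_gt0 ((Q0 / 2 + 2 * kappa) / gamma e ^+ 2))) -/c.
apply: le_trans hA.
have c1 : c * expR (- ((Q0 / 2 + 3 * kappa - kappa) / gamma e ^+ 2)) = 1.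
  by rewrite /c -expRD -[RHS]expR0; congr expR; field; rewrite gt_eqF.
have := ler_wpM2l (expR_ge0 ((Q0 / 2 + 2 * kappa) / gamma e ^+ 2)) h2.
by rewrite -/c c1 mulrCA -/Q0; set z := c * _; lra.
Qed.

Lemma open_lower_bound (G : set (C01 R)) g (v kappa : R) : open G -> G g ->
  (gaussian_rate q y g <= v%:E)%E -> 0 < kappa ->
  \forall e \near 0^'+, ((expR (- ((v + kappa) / gamma e ^+ 2)))%:E <= P (U e @^-1` G))%E.
Proof.
move=> oG Gg gv k0.
have [rho rho0 ballG] := (open_C01P G).1 oG g Gg.
have rho8 : 0 < rho / 8 by rewrite divr_gt0.
(* Five errors of at most [rho / 8] enter the uniform distance: the moduli of [g] and [U], the mean,
   the approximation of [g] by [l], and the tilted constraint. The exponent loses [3 * k1] in the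
   tilt and [k1] in the energy of [l]. *)
pose k1 := Num.min (rho / 8) (kappa / 8).
have k10 : 0 < k1 by rewrite lt_min !divr_gt0.
have k1r : k1 <= rho / 8 by rewrite ge_min lexx.
have k1k : k1 <= kappa / 8 by rewrite ge_min lexx orbT.
have [l [lg lv]] := gaussian_rate_near q_continuous q_sym q_psd k10 gv.
have [r1 r10 hW] := modulus_bound (quad_list q l l / 2 + 2 * k1 + 1) rho8.
have [r2 r20 gmod] := mod_set_exists g rho8.
pose r := Num.min r1 r2; have r0 : 0 < r by rewrite lt_min r10.
pose N := (Num.truncn r^-1).+1.
have Nr : N%:R^-1 < r by rewrite invf_plt ?posrE// truncnS_gt.
(* Besides [l], which bounds the density, the list holds evaluations at the grid points with both
   signs: these one-sided constraints confine [V] there, and the moduli do the rest. *)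
pose Ls := l :: flatten [seq [:: [:: (1, grid R i)]; [:: (- 1, grid R i)]] | i <- enum 'I_N.+1].
have inLs (i : 'I_N.+1) : [:: (1, grid R i)] \in Ls /\ [:: (-1, grid R i)] \in Ls.
  split; rewrite inE; apply/orP; right; apply/flatten_mapP; exists i;
    by rewrite ?mem_enum ?inE ?eqxx ?orbT.
have hg : \forall e \near 0^'+, forall w, mod_set r1 (rho / 8) (U e w) ->
    (forall l', l' \in Ls -> pair_list l' (V e w) <= quad_list q l l' + k1) -> G (U e w).
  apply: filterS2 (m_cvg rho8) (@nbhs_right_gt R 0) => e hm e0 w Umod Vl; apply: ballG => t.
  have [i ti] := grid_near t Nr isT.
  have tr1 : `|time t - time (grid R i)| < r1 by rewrite (lt_le_trans ti)// ge_min lexx.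
  have tr2 : `|time t - time (grid R i)| < r2 by rewrite (lt_le_trans ti)// ge_min lexx orbT.
  have [i1 i2] := inLs i; have := Vl _ i1; have := Vl _ i2.
  have qE (c : R) : quad_list q l [:: (c, grid R i)] = c * pair_list l (q (grid R i)).
    rewrite /quad_list -pair_listZ; congr pair_list; apply/funext => s.
    by rewrite /pair_list big_seq1 q_sym.
  have pE (c : R) : pair_list [:: (c, grid R i)] (V e w) = c * V e w (grid R i).
    by rewrite /pair_list big_seq1.
  rewrite !qE !pE !mul1r !mulN1r.
  have := lg (grid R i); have := hm (grid R i).
  have := Umod _ _ tr1; have := gmod _ _ tr2; rewrite [path_fun (U e w) (grid R i)]U_E//.
  rewrite !ler_norml ltr_norml => /andP[? ?] /andP[? ?] /andP[? ?] /andP[? ?] ? ?.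
  by rewrite ltr_norml; apply/andP; split; lra.
have := tilted_lower_bound k10 (mem_head _ _) hW oG hg.
apply: filterS2 (@nbhs_right_gt R 0) => e e0; apply: le_trans.
rewrite lee_fin ler_expR lerN2 ler_pM2r ?invr_gt0 ?exprn_gt0 ?gamma_gt0//.
by lra.
Qed.

Lemma limf_einf_rate (G : set (C01 R)) (a : R) :
  (\forall e \near 0^'+, ((expR (- (a / gamma e ^+ 2)))%:E <= P (U e @^-1` G))%E) ->
  ((- a)%:E <= limf_einf (fun e : R => (gamma e ^+ 2)%:E * lne (P (U e @^-1` G))) 0^'+)%E.
Proof.
move=> hG; rewrite limf_einfE.
pose D := [set e : R | 0 < e /\ ((expR (- (a / gamma e ^+ 2)))%:E <= P (U e @^-1` G))%E].
apply: (@le_trans _ _ (ereal_inf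
    ((fun e : R => ((gamma e ^+ 2)%:E * lne (P (U e @^-1` G)))%E) @` D))); last first.
  apply: ereal_sup_ubound; exists D => //.
  by apply: filterS2 (@nbhs_right_gt R 0) hG => e; split.
apply: le_ereal_inf_tmp => _ [e [e0 he] <-].
have g20 : 0 < gamma e ^+ 2 by rewrite exprn_gt0// gamma_gt0.
have -> : ((- a)%:E = (gamma e ^+ 2)%:E * (- (a / gamma e ^+ 2))%:E)%E.
  by rewrite -EFinM; congr EFin; field; rewrite gt_eqF// gamma_gt0.
rewrite lee_pmul2l//.
rewrite (@le_trans _ _ (lne (expR (- (a / gamma e ^+ 2)))%:E))//.
  by rewrite lne_EFin ?expR_gt0// expRK.
by rewrite lee_lne// in_itv/= leey andbT ?lee_fin ?expR_ge0.
Qed.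

Lemma gaussian_LDP : satisfies_LDP P U gamma (gaussian_rate q y).
Proof.
split; [exact: gamma_cvg|exact: measurable_U|exact: compact_gaussian_rate| |].
- move=> G oG; rewrite leeNl; apply: le_ereal_inf_tmp => _ [g Gg <-].
  case E : (gaussian_rate q y g) => [v| |].
  + rewrite leeNl; apply/lee_subgt0Pr => kappa k0; rewrite -EFinN -EFinB -opprD.
    apply: limf_einf_rate; apply: (open_lower_bound oG Gg _ k0).
    by rewrite E.
  + by rewrite leey.
  + by move: E; rewrite /gaussian_rate; case: asboolP.
- move=> F cF; rewrite leNgt; apply/negP => lt.
  (* A real strictly between the two sides of the failed inequality: every path of [F] then has rate
     above [- b], so [F] is exponentially small at rate [- b], against the choice of [b]. *)
  have [b /andP[b1 b2]] : exists b : R, (- ereal_inf (gaussian_rate q y @` F) < b%:E <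
      limf_esup (fun e : R => (gamma e ^+ 2)%:E * lne (P (U e @^-1` F))) 0^'+)%E.
    exact: ereal_lt_dense.
  have sF : expo_small (- b) F.
    apply: expo_small_closed => // g Fg; apply/negP; rewrite -ltNge EFinN lteNl.
    apply: le_lt_trans b1; rewrite leeN2; apply: ereal_inf_lbound; exists g => //.
  by have := limf_esup_rate sF; rewrite opprK leNgt b2.
Qed.

End large_deviations.

Lemma C01_exists (R : realType) (f : I01 R -> R) : continuous f ->
  exists g : C01 R, forall t, path_fun g t = f t.
Proof.
move=> cf; have H : isContinuous (I01 R) R f by split.
by exists (HB.pack f H : continuousType (I01 R) R).
Qed.

Unset Implicit Arguments.

Theorem theorem3p4 (R : realType) (d : measure_display) (T : measurableType d)
  (P : probability T R) (X : R -> {RV P >-> R})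
  (hXgauss : gaussian_process X)
  (hXcentered : centered_process X)
  (hXcont : continuous_process X)
  (hkcont : {within [set p : R * R | 0 <= p.1 /\ 0 <= p.2],
               continuous (fun p => cov_fun X p.1 p.2)})
  (n : nat) (hn : (1 <= n)%N)
  (tau x : nat -> R)
  (htau1 : 0 < tau 1%N)
  (htau : forall j : nat, (1 <= j < n)%N -> tau j < tau j.+1)
  (hvar : forall j : nat, (1 <= j <= n)%N -> 0 < var_cond (cov_fun X) tau j)
  (gamma : R -> R)
  (hgamma_pos : forall e : R, 0 < e -> 0 < gamma e)
  (hgamma_lim : gamma e @[e --> 0^'+] --> 0)
  (kbar : I01 R -> I01 R -> R)
  (hkbar : {uniform,
     (fun (e : R) (p : I01 R * I01 R) =>
        cov P (increment X (tau n) (tau n + e * time p.1))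
              (increment X (tau n) (tau n + e * time p.2)) / gamma e ^+ 2)
     @ 0^'+ --> (fun p : I01 R * I01 R => kbar p.1 p.2)})
  (rhobar : I01 R -> R -> R)
  (hrhobar : forall u : R, 0 < u ->
     {uniform,
       (fun (e : R) (t : I01 R) =>
          (cov_fun X (tau n + e * time t) u - cov_fun X (tau n) u) / gamma e)
       @ 0^'+ --> rhobar ^~ u}) :
  exists U : R -> T -> C01 R,
    (forall (e : R) (w : T) (t : I01 R), 0 < e ->
       path_fun (U e w) t
       = X_cond (cov_fun X) tau X x n (tau n + e * time t) w) /\
    satisfies_LDP P U gamma
      (gaussian_rate (kbar_cond (cov_fun X) tau kbar rhobar n) (x n)).
Proof.
have k_sym t s : cov_fun X t s = cov_fun X s t by rewrite /cov_fun /cov covarianceC.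
have tau_gt0 i : (1 <= i <= n)%N -> 0 < tau i.
  elim: i => [|[|i] IH]// /andP[_ ltin].
  apply: (lt_trans (IH _)); first by rewrite /= ltnW.
  by apply: htau.
have taun : 0 < tau n by apply: tau_gt0; rewrite hn leqnn.
have var_n : 0 < var_cond (cov_fun X) tau n by apply: hvar; rewrite hn leqnn.
have k_cont t s : 0 < t -> 0 < s ->
    {for (t, s), continuous (fun p : R * R => cov_fun X p.1 p.2)}.
  (* On the open quadrant, continuity within the set becomes plain continuity at each point. *)
  move=> t0 s0; pose A := [set p : R * R | 0 < p.1] `&` [set p : R * R | 0 < p.2].
  have oA : open A.
    by apply: openI; [apply: (@open_comp _ _ fst [set z : R | 0 < z])|
      apply: (@open_comp _ _ snd [set z : R | 0 < z])];
      [move=> p _; exact: cvg_fst|exact: open_gt|move=> p _; exact: cvg_snd|exact: open_gt].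
  have cA : {within A, continuous (fun p : R * R => cov_fun X p.1 p.2)}.
    apply: continuous_subspaceW hkcont => p [/= p1 p2].
    by split; exact: ltW.
  rewrite continuous_open_subspace// in cA.
  by apply: cA; rewrite inE.
have X_cont w u : 0 < u -> {for u, continuous (fun t => X t w)}.
  move=> u0; have oA : open [set t : R | 0 < t] by exact: open_gt.
  have cA : {within [set t : R | 0 < t], continuous (fun t => X t w)}.
    by apply: continuous_subspaceW (hXcont w) => t /= /ltW.
  rewrite continuous_open_subspace// in cA.
  by apply: cA; rewrite inE.
have pathU e w : exists g : C01 R, 0 < e -> forall t,
    path_fun g t = X_cond (cov_fun X) tau X x n (tau n + e * time t) w.
  (* For [e <= 0] any path will do: the specification only concerns positive [e]. *)
  have [e0|e0] := ltP 0 e; last by exists point.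
  have c : continuous (fun t : I01 R => X_cond (cov_fun X) tau X x n (affine_time (tau n) e t) w).
    apply: (@continuous_affine_comp _ _ _ taun (ltW e0)
      (fun u => X_cond (cov_fun X) tau X x n u w)) => u u0.
    apply: (@continuous_X_cond R (cov_fun X) tau k_cont n tau_gt0 T (fun t => X t : T -> R)
      x w n u (leqnn n) u0) => v v0.
    exact: X_cont.
  by have [g hg] := C01_exists c; exists g.
have /choice[U0 hU0] : forall p : R * T, exists g : C01 R, 0 < p.1 -> forall t,
    path_fun g t = X_cond (cov_fun X) tau X x n (tau n + p.1 * time t) p.2.
  by move=> p; exact: pathU.
exists (fun e w => U0 (e, w)); split; first by move=> e w t e0; rewrite (hU0 (e, w)).
have diff_cvg u : 0 < u -> ucvg 0^'+ (scaled_diff (cov_fun X) tau n gamma 0 u) (rhobar ^~ u).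
  by move=> u0; exact: (unif_cvgP _ _ _).1 (hrhobar u u0).
have diff2_cvg : ucvg 0^'+ (scaled_diff2 (cov_fun X) tau n gamma 0)
    (fun p : I01 R * I01 R => kbar p.1 p.2).
  move=> c c0.
  apply: filterS2 ((unif_cvgP _ _ _).1 hkbar c c0) (@nbhs_right_gt R 0) => e h e0 p.
  have := h p; rewrite cov_increment//.
  - exact: ltW.
  - exact/ltW/(affine_time_gt0 taun (ltW e0)).
  - exact/ltW/(affine_time_gt0 taun (ltW e0)).
(* Stated for an arbitrary process so as to serve twice: for the deterministic mean, which tends to
   [x n], and for the paths of the zero-pinned process, which tend to 0. *)
have pinned (T' : Type) (Y : R -> T' -> R) (z : nat -> R) (w : T') :
    (forall u, 0 < u -> {for u, continuous (Y ^~ w)}) ->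
    ucvg 0^'+ (fun e (t : I01 R) => X_cond (cov_fun X) tau Y z n (affine_time (tau n) e t) w)
      (fun=> z n).
  move=> cY c c0.
  have pn : X_cond (cov_fun X) tau Y z n (tau n) w = z n.
    by rewrite -{1 2 3}(prednK hn) X_cond_pin ?prednK.
  have := @continuous_X_cond R (cov_fun X) tau k_cont n tau_gt0 T' Y z w n _ (leqnn n) taun cY.
  move=> /cvgrPdist_lt/(_ _ c0)/nbhs_ballP[r /= r0 hr].
  apply: filterS2 (nbhs_right_lt r0) (@nbhs_right_gt R 0) => e er e0 t.
  rewrite -pn; apply: hr; rewrite -ball_normE /= distrC.
  exact: le_lt_trans (affine_time_dist _ (ltW e0) t) er.
have V_normal e l : 0 < e -> centered_normal P
    (fun w => pair_list l (fun t : I01 R =>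
       X_cond (cov_fun X) tau X (fun=> 0) n (affine_time (tau n) e t) w))
    (quad_list (cond_kernel (cov_fun X) tau n e) l l).
  move=> e0; pose f t := cond_list (cov_fun X) tau n (affine_time (tau n) e t).
  have times p : p \in bind_list f l -> 0 <= p.2.
    move=> /flatten_mapP[p' _] /mapP[p'' p''l ->] /=.
    apply: (cond_list_times _ _ p''l); first exact/ltW/(affine_time_gt0 taun (ltW e0)).
    by move=> i /tau_gt0/ltW.
  have := centered_normal_list hXgauss hXcentered times; rewrite quad_list_bind.
  rewrite (_ : (fun w => pair_list (bind_list f l) _) = (fun w => pair_list l
      (fun t => X_cond (cov_fun X) tau X (fun=> 0) n (affine_time (tau n) e t) w))); last first.
    apply/funext => w; rewrite pair_list_bind; congr pair_list; apply/funext => t.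
    exact: (pair_cond_list _ _ (fun u => X u : T -> R)).
  rewrite (_ : (fun i j => quad_list _ _ _) = cond_kernel (cov_fun X) tau n e)//.
  by apply/funext => s; apply/funext => t; exact: quad_cond_list.
apply: (@gaussian_LDP _ _ _ P _ _ _ _ _ gamma (x n) _
  (fun e w t => X_cond (cov_fun X) tau X (fun=> 0) n (affine_time (tau n) e t) w)
  (fun e t => X_cond (cov_fun X) tau (fun _ _ => 0) x n (affine_time (tau n) e t) tt)
  (cond_kernel (cov_fun X) tau n)) => //.
- move=> p; have := @continuous_kbar_cond _ _ _ _ k_sym k_cont hn tau_gt0 hvar _ hgamma_pos.
  move=> /(_ _ _ diff_cvg diff2_cvg p); exact.
- exact: (@kbar_cond_sym _ _ _ _ k_sym k_cont hn tau_gt0 hvar _ hgamma_pos kbar rhobar diff_cvg diff2_cvg).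
(* The limit form is nonnegative as a limit of rescaled variances. *)
- move=> l.
  apply: (cvgr_to_ge
    (@quad_kbar_cond_cvg _ _ _ _ k_sym k_cont hn tau_gt0 hvar _ hgamma_pos kbar rhobar diff_cvg diff2_cvg l l)).
  apply: filterS (@nbhs_right_gt R 0) => e e0.
  by have [_ v0 _] := V_normal e l e0; rewrite divr_ge0// sqr_ge0.
- exact: (@kbar_cond_zero _ _ _ _ k_sym k_cont hn tau_gt0 hvar _ hgamma_pos kbar rhobar diff_cvg diff2_cvg).
- by move=> e w t e0; rewrite (hU0 (e, w))//= X_condE addrC.
- by move=> e s t; rewrite /cond_kernel k_cond_sym.
- exact: (@cond_kernel_cvg _ _ _ _ k_sym k_cont hn tau_gt0 hvar _ hgamma_pos kbar rhobar diff_cvg diff2_cvg).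
- by apply: pinned => u u0; exact: cvg_cst.
- by move=> w; apply: (@pinned T (fun u => X u : T -> R) (fun=> 0)) => u u0; exact: X_cont.
Qed.
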